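(* Let $\mathbf{a}=(a_i)_{i\ge 0}$ be a sequence of nonnegative integers satisfying (A1)–(A3) (see context), and let $\varrho:=\varrho_{\mathbf{a}}:\mathcal{A}\to\mathcal{A}^+$ be the associated substitution on the compact alphabet $\mathcal{A}$. Then: (i) The subshift $(X_\varrho,\sigma)$ is minimal and uniquely ergodic. (ii) There is a unique (up to scaling) strictly positive, continuous, natural tile length function, which turns $\varrho$ into a geometric substitution in $\mathbb{R}$. (iii) The associated tiling dynamical system $(\Omega_\varrho,\mathbb{R})$ is minimal and uniquely ergodic.
   Context: Conditions on $\mathbf{a}$: (A1) $\mathbf{a}$ is bounded; put $N:=\max_i a_i$. (A2) $a_0\neq 0$. (A3) There is an integer $C>0$ such that if $a_i=a_{i+1}=\dots=a_{i+k}=0$ then $k<C$. Alphabet. Let $\mathcal{S}=\{*,0,1,\dots,N\}^{\mathbb{Z}}$ with the product topology and let $\sigma$ be the left shift, $\sigma(x)_n=x_{n+1}$. Let $\mathbf{0}\in\mathcal{S}$ be given by $\mathbf{0}_m=a_m$ for $m\ge 0$ and $\mathbf{0}_m=*$ for $m<0$. Define $\iota_{\mathbf{a}}:\mathbb{N}_0\to\mathcal{S}$ by $\iota_{\mathbf{a}}([i])=\sigma^i(\mathbf{0})$ ($[i]$ denotes $i\in\mathbb{N}_0$ viewed as a letter). The alphabet is the closure $\mathcal{A}=\overline{\iota_{\mathbf{a}}(\mathbb{N}_0)}\subset\mathcal{S}$ with the subspace topology. Write $[i]$ for the letter $\iota_{\mathbf{a}}([i])$ and $[\infty_{\mathbf{b}}]$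 for a letter $\mathbf{b}\in\mathcal{A}\setminus\iota_{\mathbf{a}}(\mathbb{N}_0)$. For such $\mathbf{b}=(b_n)_{n\in\mathbb{Z}}$, no entry is $*$ and $\sigma^{\pm1}(\mathbf{b})\in\mathcal{A}\setminus\iota_{\mathbf{a}}(\mathbb{N}_0)$. Substitution. $\varrho_{\mathbf{a}}([0])=[0]^{a_0}[1]$; $\varrho_{\mathbf{a}}([i])=[0]^{a_i}[i-1][i+1]$ for $i>0$; $\varrho_{\mathbf{a}}([\infty_{\mathbf{b}}])=[0]^{b_0}[\infty_{\sigma^{-1}(\mathbf{b})}][\infty_{\sigma(\mathbf{b})}]$. Here $[0]^m$ is $m$ copies of $[0]$ in a row. It is extended to words by concatenation. Subshift. $\mathcal{A}^n$ (words of length $n$) has the product topology, $\mathcal{A}^+=\bigcup_{n\ge1}\mathcal{A}^n$ the disjoint union topology, $\mathcal{A}^*=\mathcal{A}^+\cup\{\text{empty word}\}$. The language $\mathcal{L}(\varrho)$ is the closure in $\mathcal{A}^*$ of the set of all subwords (blocks of consecutive letters) of the words $\varrho^k(c)$, $k\ge 0$, $c\in\mathcal{A}$. $X_\varrho=\{x\in\mathcal{A}^{\mathbb{Z}}:\text{every finite subword of }x\text{ lies in }\mathcal{L}(\varrho)\}$, with the left shift, also denoted $\sigma$. A strictly positive continuous natural tile length function is a continuous $\ell:\mathcal{A}\to(0,\infty)$ for which there is $\lambda>1$ with $\sum_{b\in\varrho(c)}\ell(b)=\lambda\,\ell(c)$ for all $c\in\mathcal{A}$ (sum over letters of $\varrho(c)$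 with multiplicity). It turns $\varrho$ into a geometric substitution: the letter $c$ becomes an interval of length $\ell(c)$, whose inflation by $\lambda$ is dissected into the intervals of the letters of $\varrho(c)$, in order. Tiling dynamical system. $(\Omega_\varrho,\mathbb{R})$ is the space of tilings of $\mathbb{R}$ obtained from elements of $X_\varrho$ by replacing each letter $c$ by a tile (labelled by $c$) of length $\ell(c)$, together with all translates, with the translation action of $\mathbb{R}$. It is identified with the suspension flow of $(X_\varrho,\sigma)$ with roof function $h(x)=\ell(x_0)$, i.e. the quotient of $X_\varrho\times\mathbb{R}$ by the equivalence relation generated by $(x,t+\ell(x_0))\sim(\sigma(x),t)$, with flow induced by translation of the second coordinate. Minimal: every orbit is dense. Uniquely ergodic: there is exactly one invariant Borel probability measure. *)

(* Defs.v *)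
From HB Require Import structures.
From Stdlib Require Import Relation_Operators.
From mathcomp Require Import all_boot all_order all_algebra.
From mathcomp Require Import generic_quotient.
From mathcomp Require Import all_classical all_reals all_analysis.
Import numFieldNormedType.Exports.
Import Order.TTheory GRing.Theory Num.Theory.

Set Implicit Arguments.
Unset Strict Implicit.
Unset Printing Implicit Defensive.

Local Open Scope classical_set_scope.
Local Open Scope ring_scope.
Local Open Scope quotient_scope.

(* [shift k] is the k-th power of the left shift on two-sided sequences. *)
Definition shift (T : Type) (k : int) (x : int -> T) : int -> T :=
  fun n => x (n + k).

Lemma shift0 (T : Type) (x : int -> T) : shift 0 x = x.
Proof. by apply/funext => n; rewrite /shift addr0. Qed.

Lemma shiftD (T : Type) (j k : int) (x : int -> T) :
  shift j (shift k x) = shift (j + k) x.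
Proof. by apply/funext => n; rewrite /shift addrA. Qed.

Lemma shift_continuous (T : topologicalType) (k : int) :
  continuous (shift k : prod_topology (fun _ : int => T) ->
                        prod_topology (fun _ : int => T)).
Proof.
move=> x; apply/cvg_sup; first exact/fmap_filter/nbhs_filter.
move=> n U [_ [[W oW <-] Wx] WU].
have : nbhs x (proj (n + k) @^-1` W).
  by apply: (@proj_continuous int (fun=> T)); exact: open_nbhs_nbhs.
by move=> h; apply: (@filterS _ (nbhs x) (nbhs_filter x) _ _ _ h) => y; exact: WU.
Qed.

(* The space {*,0,...,N}^Z; the extra symbol * is [None]. *)
Definition seqspace (N : nat) : Type :=
  prod_topology (fun _ : int => discrete_topology (option 'I_N.+1)).

HB.instance Definition _ N := Topological.on (seqspace N).

Section alphabet.
Variables (a : nat -> nat) (N : nat).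

(* [inord (a n)] has value [a n] as soon as [a n <= N]. *)
Definition base_seq : seqspace N :=
  fun m => if m is Posz n then Some (inord (a n)) else None.

Definition iota_seq (i : nat) : seqspace N := shift i%:Z base_seq.

Definition alphabet : set (seqspace N) := closure (range iota_seq).

Definition letter : Type := alphabet.
HB.instance Definition _ := Topological.on letter.

Lemma alphabet_iota i : alphabet (iota_seq i).
Proof. by apply: subset_closure; exists i. Qed.

Definition fin_letter (i : nat) : letter := SigSub (mem_set (@alphabet_iota i)).

Definition is_fin (c : letter) : Prop := exists i, c = fin_letter i.

Lemma seqspace_closed1 (x : seqspace N) : closed [set x].
Proof.
apply/accessible_closed_set1/hausdorff_accessible.
by apply: hausdorff_product => ?; exact: discrete_hausdorff.
Qed.

Lemma alphabet_shift (c : letter) : alphabet (shift 1 (val c)).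
Proof.
move=> U /shift_continuous /(set_mem (valP c)) [_ [[i _ <-] Ui]].
exists (iota_seq i.+1); split; first by exists i.+1.
by move: Ui; rewrite /= /iota_seq shiftD -PoszD add1n.
Qed.

Lemma alphabet_shiftN (c : letter) : ~ is_fin c -> alphabet (shift (-1) (val c)).
Proof.
move=> cfin U /shift_continuous nU.
have {}nU : nbhs (val c : seqspace N) (shift (-1) @^-1` U) by exact: nU.
have n0 : nbhs (val c : seqspace N) (~` [set iota_seq 0]).
  apply: open_nbhs_nbhs; split; first exact/closed_openC/seqspace_closed1.
  by move=> c0; apply: cfin; exists 0%N; exact: val_inj.
have [_ [[i _ <-] [Ui i0]]] := set_mem (valP c) _ (filterI nU n0).
case: i => [|i] in Ui i0 *; first by case: i0.
exists (iota_seq i); split; first by exists i.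
move: Ui; rewrite /= /iota_seq shiftD.
by rewrite (_ : -1 + i.+1%:Z = i%:Z) // -add1n PoszD addKr.
Qed.

Definition letter_succ (c : letter) : letter :=
  SigSub (mem_set (@alphabet_shift c)).

Definition letter_pred (c : letter) (h : ~ is_fin c) : letter :=
  SigSub (mem_set (@alphabet_shiftN c h)).

(* The entry b_0; the default value is never used, as b has no entry * . *)
Definition entry0 (c : letter) : nat :=
  if val c 0 is Some k then nat_of_ord k else 0%N.

Definition rho (c : letter) : seq letter :=
  match pselect (is_fin c) with
  | left h =>
      match projT1 (cid h) with
      | 0%N => nseq (a 0%N) (fin_letter 0) ++ [:: fin_letter 1]
      | i.+1 => nseq (a i.+1) (fin_letter 0) ++ [:: fin_letter i; fin_letter i.+2]
      end
  | right h =>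
      nseq (entry0 c) (fin_letter 0) ++ [:: letter_pred h; letter_succ c]
  end.

Lemma fin_letter_inj : injective fin_letter.
Proof.
have aux i j : (i < j)%N -> fin_letter i <> fin_letter j.
  move=> ij /(congr1 (fun c : letter => val c (- j%:Z))).
  rewrite /= /iota_seq /shift addNr /=.
  rewrite (_ : - j%:Z + i%:Z = Negz (j - i).-1) //.
  by rewrite NegzE prednK ?subn_gt0// -subzn 1?ltnW// opprB addrC.
by move=> i j ij; case: (ltngtP i j) => // /aux; rewrite ij.
Qed.

Lemma rho_fin0 :
  rho (fin_letter 0) = nseq (a 0%N) (fin_letter 0) ++ [:: fin_letter 1].
Proof.
rewrite /rho; case: pselect => [h|[]]; last by exists 0%N.
by case: (cid h) => i /= /fin_letter_inj <-.
Qed.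

Lemma rho_finS i : rho (fin_letter i.+1) =
  nseq (a i.+1) (fin_letter 0) ++ [:: fin_letter i; fin_letter i.+2].
Proof.
rewrite /rho; case: pselect => [h|[]]; last by exists i.+1.
by case: (cid h) => j /= /fin_letter_inj <-.
Qed.

Definition rho_word (w : seq letter) : seq letter := flatten (map rho w).

(* Words of all lengths with the disjoint union topology; the empty word is
   the only one of length 0, hence an isolated point. *)
Definition word : Type :=
  {n : nat & (prod_topology (fun _ : 'I_n => letter) : topologicalType)}.
HB.instance Definition _ := Topological.on word.

Definition word_of_seq (w : seq letter) : word :=
  existT _ (size w) (fun i => tnth (in_tuple w) i).

Definition language : set word :=
  closure [set word_of_seq u | u in
    [set u | exists k c, infix u (iter k rho_word [:: c])]].

Definition subshift_set : set (prod_topology (fun _ : int => letter)) :=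
  [set x | forall (m : int) (n : nat),
     language (existT _ n (fun i : 'I_n => x (m + i%:Z)))].

Definition subshift : Type := subshift_set.
HB.instance Definition _ := Topological.on subshift.

Lemma subshift_setS (k : int) (x : subshift) : subshift_set (shift k (val x)).
Proof.
move=> m n; have := set_mem (valP x) (m + k) n; congr (language (existT _ n _)).
by apply/funext => i; rewrite /shift addrAC.
Qed.

Definition subshift_act (k : int) (x : subshift) : subshift :=
  SigSub (mem_set (@subshift_setS k x)).

Variable R : realType.

Definition is_tile_length (l : letter -> R) : Prop :=
  [/\ continuous l, forall c, 0 < l c &
      exists2 lambda : R, 1 < lambda &
        forall c, \sum_(b <- rho c) l b = lambda * l c].

Section suspension.
Variable l : letter -> R.

Definition roof (x : subshift) : R := l (val x 0).

Definition susp_step (p q : subshift * R) : Prop :=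
  q.1 = subshift_act 1 p.1 /\ p.2 = q.2 + roof p.1.

Definition susp_eqv (p q : subshift * R) : bool :=
  `[< clos_refl_sym_trans _ susp_step p q >].

Lemma susp_eqv_refl : reflexive susp_eqv.
Proof. by move=> p; apply/asboolP; exact: rst_refl. Qed.

Lemma susp_eqv_sym : symmetric susp_eqv.
Proof. by move=> p q; apply/asboolP/asboolP => ?; exact: rst_sym. Qed.

Lemma susp_eqv_trans : transitive susp_eqv.
Proof.
move=> q p r /asboolP pq /asboolP qr; apply/asboolP; exact: rst_trans qr.
Qed.

Canonical susp_equiv_rel :=
  EquivRel susp_eqv susp_eqv_refl susp_eqv_sym susp_eqv_trans.

Definition tiling_space : Type := quotient_topology {eq_quot susp_equiv_rel}.
HB.instance Definition _ := Topological.on tiling_space.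
HB.instance Definition _ := Quotient.on tiling_space.

Definition susp_translate (s : R) (p : subshift * R) : subshift * R :=
  (p.1, p.2 + s).

Definition tiling_flow (s : R) (w : tiling_space) : tiling_space :=
  \pi_tiling_space (susp_translate s (repr w)).

(* The flow does not depend on the choice of representatives. *)
Lemma tiling_flow_pi (s : R) (p : subshift * R) :
  tiling_flow s (\pi_tiling_space p) = \pi_tiling_space (susp_translate s p).
Proof.
rewrite /tiling_flow; apply/eqmodP/asboolP.
have /eqmodP/asboolP :
  repr (\pi_tiling_space p) = p %[mod {eq_quot susp_equiv_rel}].
  exact: (@reprK _ tiling_space).
move: (repr _) => r; elim=> {p r} [p q [e1 e2]|p|p q _|p q r _ pq _].
- by apply: rst_step; split => //=; rewrite e2 addrAC.
- exact: rst_refl.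
- exact: rst_sym.
- exact: rst_trans.
Qed.

End suspension.

End alphabet.

Section dynamics.

(* The library's measurable types are pointed; the Borel sigma-algebra does
   not depend on the chosen base point. *)
Definition pointed_at (T : topologicalType) (x0 : T) : Type := T.
HB.instance Definition _ (T : topologicalType) (x0 : T) :=
  Topological.on (pointed_at x0).
HB.instance Definition _ (T : topologicalType) (x0 : T) :=
  isPointed.Build (pointed_at x0) x0.

Definition borel (T : topologicalType) (x0 : T) :=
  g_sigma_algebraType (@open (pointed_at x0)).

Variables (G : Type) (T : topologicalType) (act : G -> T -> T).

Definition minimal : Prop := forall x, dense (range (act ^~ x)).

(* For G = int this amounts to invariance under the generator [act 1]. *)
Definition invariant_measure (R : realType) (x0 : T)
    (mu : probability (borel x0) R) : Prop :=
  forall (g : G) (A : set (borel x0)), measurable A -> mu (act g @^-1` A) = mu A.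

(* A probability measure only lives on a non-empty space, so the existence of
   a base point is no restriction. Measures are compared on Borel sets, since
   the library leaves their values on other sets arbitrary. *)
Definition uniquely_ergodic (R : realType) : Prop :=
  exists x0 : T, exists2 mu : probability (borel x0) R,
    invariant_measure mu &
    forall nu : probability (borel x0) R, invariant_measure nu ->
      forall A : set (borel x0), measurable A -> nu A = mu A.

End dynamics.

(* Main.v *)
From HB Require Import structures.
From Stdlib Require Import Relation_Operators.
Require Import Defs.
From mathcomp Require Import all_boot all_order all_algebra.
From mathcomp Require Import generic_quotient.
From mathcomp Require Import all_classical all_reals all_analysis.
From mathcomp Require Import measurable_realfun zify ring lra.
Import Defs numFieldNormedType.Exports.
Import Order.TTheory GRing.Theory Num.Theory.

Set Implicit Arguments.
Unset Strict Implicit.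
Unset Printing Implicit Defensive.
Local Open Scope classical_set_scope.
Local Open Scope ring_scope.
Local Open Scope quotient_scope.

(** The letters are two-sided sequences, and two letters are close exactly when
they agree on a long window of coordinates around 0. Every topological
statement below is therefore handled as a statement about words that agree up
to a precision n. The substitution loses one unit of precision, since the last
letters of rho(c) are shifts of c by one place; in return rho^k is
combinatorially constant near every letter, so a word of rho^k(c) is
approximated by words of rho^k([i]) (lemmas [agree_rk], [legal_approx]).

Everything rests on two combinatorial facts. The letter [0] occurs in
rho^K(c) for one K and all c ([zero_in_rk]): following the successors of c one
meets a nonzero entry after a bounded number of steps, that entry produces
[0], and [0] reproduces itself because a_0 is nonzero. Conversely [i] occurs in
rho^i([0]). Hence every legal word is approximated by subwords of some
rho^M([0]), and rho^M([0]) occurs in all long legal words: this is minimality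
of the subshift.

A length function with eigenvalue lambda = x + 1/x has to solve
l(sigma b) + l(sigma^-1 b) + b_0 l([0]) = lambda l(b). As x^|k| is the Green
function of this second-order operator, l(b) = sum_k b_k x^|k| is a solution
as soon as the left boundary is right: the missing letter [-1] must have
length 0. This is achieved by giving the symbol * next to a_0 the weight -1,
and it forces sum_n a_n x^(n+1) = 1, an equation with a root in (0,1) by the
intermediate value theorem ([length_root_exists], [tile_len_eigen]).

For uniqueness, and for all frequencies, let M f(c) be the sum of f over
rho(c). The quotient M^n f / (lambda^n l) at c is an average of the quotients
at level n - K over the letters of rho^K(c), with a weight bounded below on the
common letter [0]. Its oscillation thus contracts geometrically, so the
quotient converges uniformly to a constant ([sum_rk_converges]). For f another
length function this gives f = k l. For f(c) the number of occurrences of a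
pattern in rho^k(c) it gives uniform frequencies of patterns per unit length in
all long legal words ([uniform_frequency]), because such a word is a
concatenation of supertiles rho^n(c) up to two bounded ends.

Uniform frequencies decide unique ergodicity of both systems. If some finite
averages of the indicator of A along an orbit are uniformly close to p, then
every invariant probability measure gives A the mass p ([invariant_average]).
In the subshift this applies to the cylinders, which generate the Borel sets;
conversely the frequencies form an additive function on the algebra of
cylinders, countably additive by compactness, and its extension to the Borel
sets is the invariant measure. In the tiling space it applies to flow boxes
U x [s,t) over cylinders U: if the height h = t - s is at most the length of a
tile, an orbit sampled at the multiples of h hits the box exactly once for each
visit of the sequence to U ([box_count]). An invariant measure of the flow
comes from the product of the measure of the subshift with Lebesgue measure,
restricted to the fundamental domain 0 <= t < l(x_0). Minimality of the flow
follows from that of the subshift by moving along the orbits. *)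

(** * Neighbourhoods in products and subspaces *)

Section product_nbhs.
Variables (I : choiceType) (T : topologicalType).
Implicit Types x y : prod_topology (fun _ : I => T).

(** The sets on the right form a filter that refines each coordinate
neighbourhood filter, hence the product filter; the other inclusion is
continuity of the projections. *)
Lemma prod_nbhsP x (O : set (prod_topology (fun _ : I => T))) :
  nbhs x O <-> exists (s : seq I) (W : I -> set T),
    (forall i, nbhs (x i) (W i)) /\
    forall y, (forall i, i \in s -> W i (y i)) -> O y.
Proof.
pose F := [set O : set (prod_topology (fun _ : I => T)) |
  exists (s : seq I) (W : I -> set T),
    (forall i, nbhs (x i) (W i)) /\
    forall y, (forall i, i \in s -> W i (y i)) -> O y].
have FF : Filter F.
  split.
  - by exists [::], (fun=> setT); split => // i; exact: filterT.
  - move=> A B [s [V [Vx VA]]] [t [W [Wx WB]]].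
    exists (s ++ t), (fun i => V i `&` W i); split.
      by move=> i; apply: filterI.
    move=> y yVW; split; [apply: VA|apply: WB] => i is_;
      by case: (yVW i) => //; rewrite mem_cat is_ ?orbT.
  - move=> A B AB [s [V [Vx VA]]]; exists s, V; split => // y /VA; exact: AB.
split; last first.
  move=> [s [W [Wx WO]]].
  suff : nbhs x [set y | forall i, i \in s -> W i (y i)].
    by move=> h; apply: (@filterS _ (nbhs x) (nbhs_filter x) _ _ _ h).
  elim: s {WO} => [|i s IHs].
    by apply: (@filterS _ (nbhs x) (nbhs_filter x) setT _ _ (@filterT _ (nbhs x) (nbhs_filter x))) => y.
  have Wi : nbhs x (proj i @^-1` W i).
    by apply: (@proj_continuous I (fun=> T)); exact: Wx.
  apply: (@filterS _ (nbhs x) (nbhs_filter x) _ _ _ (@filterI _ (nbhs x) (nbhs_filter x) _ _ Wi IHs)) => y [yi ys] j.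
  by rewrite inE => /orP[/eqP -> //|]; exact: ys.
have : cvg_to F (nbhs x).
  apply/cvg_sup => i U [_ [[V oV <-] Vx] VU].
  exists [:: i], (fun j => if j == i then V else setT); split.
    move=> j; case: eqP => [->|_]; last exact: filterT.
    exact: open_nbhs_nbhs.
  move=> y /(_ i); rewrite inE eqxx => /(_ isT) yV; exact: VU.
exact.
Qed.
End product_nbhs.

Lemma int_seq_bound (s : seq int) :
  exists n : nat, forall k, k \in s -> (`|k| <= n)%N.
Proof.
elim: s => [|k s [n sn]]; first by exists 0%N.
exists (maxn `|k| n) => j; rewrite inE => /orP[/eqP ->|/sn jn].
  exact: leq_maxl.
by rewrite (leq_trans jn)// leq_maxr.
Qed.

Lemma subtype_nbhsP (T : topologicalType) (A : set T) (x : A) (O : set A) :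
  nbhs x O <-> exists2 V, nbhs (val x) V & forall y : A, V (val y) -> O y.
Proof.
split.
  move=> [_ [[V oV <-] Vx] VO]; exists V; first exact: open_nbhs_nbhs.
  by move=> y; exact: VO.
move=> [V xV VO].
have : nbhs x (val @^-1` V) by exact: (@initial_continuous _ _ (@set_val _ A)).
by apply: filterS => y; exact: VO.
Qed.

(** A cluster point of the image filter lies in A, and neighbourhoods in the
subspace are traces of neighbourhoods outside. *)
Lemma subtype_compact (T : topologicalType) (A : set T) :
  compact A -> compact [set: A].
Proof.
move=> cA F FF _.
have /cA [x [Ax clx]] : (val @ F) A.
  by apply: (@filterS _ F _ setT) => [y _|]; [exact: set_mem (valP y)|exact: filterT].
exists (SigSub (mem_set Ax)); split => // B C FB /subtype_nbhsP[V xV VC].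
have [_ [[y By <-] Vy]] := clx (val @` B) V
  (@filterS _ F _ _ _ (@preimage_image _ _ val B) FB) xV.
by exists y; split => //; exact: VC.
Qed.

(** * Letters and the substitution up to finite precision *)

Definition gaps_below (a : nat -> nat) (C : nat) : Prop := forall i k : nat,
  (forall j : nat, (j <= k)%N -> a (i + j)%N = 0%N) -> (k < C)%N.

Definition bounded_gaps (a : nat -> nat) : Prop :=
  exists C : nat, (0 < C)%N /\ gaps_below a C.

Section Letters.
Variables (a : nat -> nat) (N : nat).
Local Notation L := (letter a N).
Implicit Types c d : L.

Definition agree (n : nat) c d := forall k : int, (`|k| <= n)%N -> val c k = val d k.

Lemma agreeC n c d : agree n c d -> agree n d c.
Proof. by move=> cd k kn; rewrite cd. Qed.
Lemma agree_trans n c d e : agree n c d -> agree n d e -> agree n c e.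
Proof. by move=> cd de k kn; rewrite cd// de. Qed.
Lemma agreeW m n c d : (m <= n)%N -> agree n c d -> agree m c d.
Proof. by move=> mn cd k km; rewrite cd// (leq_trans km). Qed.

Lemma seqspace_nbhsP (x : seqspace N) O :
  nbhs x O <-> exists n : nat, forall y : seqspace N,
    (forall k : int, (`|k| <= n)%N -> y k = x k) -> O y.
Proof.
split=> [/prod_nbhsP[s [W [Wx WO]]]|[n nO]].
  have [n sn] := int_seq_bound s; exists n => y yx; apply: WO => i /sn /yx ->.
  exact: nbhs_singleton.
apply/prod_nbhsP.
exists ([seq i%:Z | i <- iota 0 n.+1] ++ [seq - i%:Z | i <- iota 0 n.+1]).
exists (fun i => [set x i]); split.
  by move=> i; apply: open_nbhs_nbhs; split => //; exact: discrete_open.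
move=> y yx; apply: nO => k kn; apply: yx; rewrite mem_cat.
apply/orP; case: (leP 0 k) => k0; [left|right]; apply/mapP; exists `|k|%N;
  rewrite ?mem_iota//; lia.
Qed.

(** The coordinates take values in a finite discrete set, so a basic
neighbourhood just prescribes finitely many of them. *)
Lemma letter_nbhsP c (O : set L) :
  nbhs c O <-> exists n, forall d, agree n c d -> O d.
Proof.
split=> [/subtype_nbhsP[V /seqspace_nbhsP[n nV] VO]|[n nO]].
  by exists n => d cd; apply: VO; apply: nV => k kn; rewrite -cd.
apply/subtype_nbhsP; exists [set y | forall k : int, (`|k| <= n)%N -> y k = val c k].
  by apply/seqspace_nbhsP; exists n.
by move=> d cd; apply: nO => k kn; rewrite cd.
Qed.

Lemma agree_nbhs n c : nbhs c (agree n c).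
Proof. by apply/letter_nbhsP; exists n. Qed.

(** The alphabet is by definition the closure of the letters [i]. *)
Lemma fin_letter_dense n c : exists i, agree n c (fin_letter a N i).
Proof.
have [_ [[i _ <-] ci]] : range (@iota_seq a N) `&`
    [set y | forall k : int, (`|k| <= n)%N -> y k = val c k] !=set0.
  apply: (set_mem (valP c)).
  by apply/seqspace_nbhsP; exists n.
by exists i => k kn; exact/esym/ci.
Qed.

Lemma compact_letter : compact [set: L].
Proof.
apply: subtype_compact.
have : compact [set: seqspace N].
  have := @tychonoff int (fun _ => discrete_topology (option 'I_N.+1)) (fun=> setT)
    (fun _ => @finite_compact (discrete_topology (option 'I_N.+1)) setT
      (@finite_finset (option 'I_N.+1) setT)).
  by congr compact; apply/seteqP; split.
by move=> cT; apply: (subclosed_compact _ cT) => //; exact: closed_closure.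
Qed.

(** An entry * at a nonnegative coordinate would persist in nearby letters [i],
which have none. *)
Lemma letter_Some c (n : nat) : exists k, val c n%:Z = Some k.
Proof.
have [i ci] := fin_letter_dense n c; exists (inord (a (n + i))).
by rewrite ci ?absz_nat.
Qed.

Lemma succ_fin i : letter_succ (fin_letter a N i) = fin_letter a N i.+1.
Proof. by apply: val_inj; rewrite /= /iota_seq shiftD -PoszD add1n. Qed.

Lemma succ_inj : injective (@letter_succ a N).
Proof.
move=> c d cd; apply: val_inj.
have : shift (-1) (val (letter_succ c)) = shift (-1) (val (letter_succ d)).
  by rewrite cd.
by rewrite /= !shiftD addNr !shift0.
Qed.

Lemma is_fin_succ c : is_fin (letter_succ c) -> is_fin c.
Proof.
move=> [[|i] ci]; last by exists i; apply: succ_inj; rewrite succ_fin.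
have [k] := letter_Some c 0.
have -> : val c 0%:Z = val (letter_succ c) (-1) by [].
by rewrite ci.
Qed.

(** This allows one to treat the letters [i] with i > 0 and the limit letters
alike: both are of the form sigma(d), and rho has one formula on these. *)
Lemma letter_cases c : c = fin_letter a N 0 \/ exists d, c = letter_succ d.
Proof.
have [[[|i] ->]|h] := pselect (is_fin c); [by left|right|right].
  by exists (fin_letter a N i); rewrite succ_fin.
exists (letter_pred h); apply: val_inj => /=.
by rewrite shiftD addrN shift0.
Qed.

Hypothesis a_le_N : forall i, (a i <= N)%N.

Lemma entry0_fin i : entry0 (fin_letter a N i) = a i.
Proof.
have -> : entry0 (fin_letter a N i) = nat_of_ord (inord (a i) : 'I_N.+1) by [].
by rewrite inordK// ltnS a_le_N.
Qed.

Lemma entry0_le c : (entry0 c <= N)%N.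
Proof. by rewrite /entry0; case: (val c 0) => // k; rewrite -ltnS. Qed.

(** On sigma(c), finite or not, the two neighbours are c and sigma^2(c). *)
Lemma rho_succ c : rho (letter_succ c) =
  nseq (entry0 (letter_succ c)) (fin_letter a N 0)
    ++ [:: c; letter_succ (letter_succ c)].
Proof.
have [[i ci]|nc] := pselect (is_fin c).
  by rewrite ci !succ_fin entry0_fin rho_finS.
rewrite /rho; case: pselect => [/is_fin_succ //|h].
congr (_ ++ [:: _; _]); apply: val_inj => /=.
by rewrite shiftD addNr shift0.
Qed.

Lemma rho_zero : rho (fin_letter a N 0) =
  nseq (entry0 (fin_letter a N 0)) (fin_letter a N 0)
    ++ [:: letter_succ (fin_letter a N 0)].
Proof. by rewrite rho_fin0 entry0_fin succ_fin. Qed.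

Lemma succ_in_rho c : letter_succ c \in rho c.
Proof.
by case: (letter_cases c) => [->|[d ->]];
  rewrite (rho_zero, rho_succ) mem_cat !inE eqxx !orbT.
Qed.

Lemma size_rho_le c : (size (rho c) <= N.+2)%N.
Proof.
by case: (letter_cases c) => [->|[d ->]];
  rewrite (rho_zero, rho_succ) size_cat size_nseq -addn2 leq_add// entry0_le.
Qed.

(** Uniform closeness in the topology on words: words of different lengths lie
in different components of the disjoint union. *)
Fixpoint agree_word n (u v : seq L) : Prop :=
  match u, v with
  | [::], [::] => True
  | x :: u', y :: v' => agree n x y /\ agree_word n u' v'
  | _, _ => False
  end.

Lemma agree_word_size n u v : agree_word n u v -> size u = size v.
Proof. by elim: u v => [|x u IH] [|y v] //= [_ /IH ->]. Qed.

Lemma agree_word_nth x0 n u v i : agree_word n u v ->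
  agree n (nth x0 u i) (nth x0 v i).
Proof. by elim: u v i => [|x u IH] [|y v] [|i] //= [xy uv] //; exact: IH. Qed.

Lemma agree_wordxx n u : agree_word n u u.
Proof. by elim: u. Qed.

Lemma agree_wordC n u v : agree_word n u v -> agree_word n v u.
Proof.
by elim: u v => [|x u IH] [|y v] //= [xy uv]; split;
  [exact: agreeC|exact: IH].
Qed.

Lemma agree_wordW m n u v : (m <= n)%N -> agree_word n u v -> agree_word m u v.
Proof.
move=> mn; elim: u v => [|x u IH] [|y v] //= [xy uv]; split; last exact: IH.
exact: agreeW xy.
Qed.

Lemma agree_word_trans n u v w :
  agree_word n u v -> agree_word n v w -> agree_word n u w.
Proof.
elim: u v w => [|x u IH] [|y v] [|z w] //= [xy uv] [yz vw]; split.
  exact: agree_trans yz.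
exact: IH vw.
Qed.

Lemma agree_word_cat n u v u' v' :
  agree_word n u u' -> agree_word n v v' -> agree_word n (u ++ v) (u' ++ v').
Proof. by elim: u u' => [|x u IH] [|y u'] //= [xy uu' vv']; split; auto. Qed.

Lemma agree_word_take n k u v :
  agree_word n u v -> agree_word n (take k u) (take k v).
Proof.
elim: u v k => [|x u IH] [|y v] [|k] //= [xy uv]; split => //; exact: IH.
Qed.

Lemma agree_word_drop n k u v :
  agree_word n u v -> agree_word n (drop k u) (drop k v).
Proof. elim: u v k => [|x u IH] [|y v] [|k] //= [xy uv]; exact: IH. Qed.

Lemma agree_word_infix n u w w' : infix u w -> agree_word n w w' ->
  exists2 u', infix u' w' & agree_word n u u'.
Proof.
move=> /infixP[p [q ->]] ww'.
exists (take (size u) (drop (size p) w')).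
  apply: infix_trans (infix_drop _ _); exact: infix_take.
have := agree_word_take (size u) (agree_word_drop (size p) ww').
by rewrite drop_size_cat// take_size_cat.
Qed.

Lemma agree_succ n c d : agree n.+1 c d -> agree n (letter_succ c) (letter_succ d).
Proof. by move=> cd k kn; rewrite /= /shift cd//; lia. Qed.

Lemma agree_succV n c d : agree n.+1 (letter_succ c) (letter_succ d) -> agree n c d.
Proof.
move=> cd k kn; have := cd (k - 1); rewrite /= /shift subrK; apply; lia.
Qed.

Lemma agree_entry0 n c d : agree n c d -> entry0 c = entry0 d.
Proof. by move=> cd; rewrite /entry0 cd. Qed.

(** The coordinate -1 tells [0], where it is *, from every successor. *)
Lemma succ_neq0 c : ~ agree 1 (fin_letter a N 0) (letter_succ c).
Proof.
move=> /(_ (-1) erefl) /=.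
have -> : iota_seq a N 0 (-1) = None by [].
by rewrite /shift /=; have [k ->] := letter_Some c 0.
Qed.

(** Precision 1 already determines the length of rho(c) and the number of its
letters [0]; the remaining letters are shifts by one place, which costs one
unit of precision. *)
Lemma agree_rho n c d : agree n.+1 c d -> agree_word n (rho c) (rho d).
Proof.
move=> cd.
case: (letter_cases c) (letter_cases d) cd => [->|[c' ->]] [->|[d' ->]] cd.
- exact: agree_wordxx.
- by case: (@succ_neq0 d'); apply: agreeW cd.
- by case: (@succ_neq0 c'); apply: agreeC; apply: agreeW cd.
- rewrite !rho_succ (agree_entry0 cd); apply: agree_word_cat.
    exact: agree_wordxx.
  split; first exact: agree_succV.
  by split => //; exact: agree_succ.
Qed.

Lemma agree_rho_word n u v :
  agree_word n.+1 u v -> agree_word n (rho_word u) (rho_word v).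
Proof.
elim: u v => [|x u IH] [|y v] //= [xy uv]; apply: agree_word_cat.
  exact: agree_rho.
exact: IH.
Qed.

Lemma rho_word_cat u v : @rho_word a N (u ++ v) = rho_word u ++ rho_word v.
Proof. by rewrite /rho_word map_cat flatten_cat. Qed.

Local Notation rk k c := (iter k (@rho_word a N) [:: c]).

Lemma iter_rho_flatten k w :
  iter k (@rho_word a N) w = flatten [seq rk k c | c <- w].
Proof.
have cat u v : iter k (@rho_word a N) (u ++ v) =
    iter k (@rho_word a N) u ++ iter k (@rho_word a N) v.
  by elim: k => //= k ->; rewrite rho_word_cat.
elim: w => [|c w IH] /=; first by elim: k {cat} => //= k ->.
by rewrite -cat1s cat IH.
Qed.

(** The words rho^j(d) are the supertiles of level j. *)
Lemma rk_flatten j k c : rk (j + k) c = flatten [seq rk j d | d <- rk k c].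
Proof. by rewrite iterD iter_rho_flatten. Qed.

Lemma agree_rk n k c d : agree (n + k) c d -> agree_word n (rk k c) (rk k d).
Proof.
elim: k n => [|k IH] n cd; first by rewrite addn0 in cd.
by rewrite /=; apply: agree_rho_word; apply: IH; rewrite addSnnS.
Qed.

Lemma rk_trans j k c d e : d \in rk k c -> e \in rk j d -> e \in rk (j + k) c.
Proof.
by move=> dk ej; rewrite rk_flatten; apply/flattenP; exists (rk j d) => //; apply: map_f.
Qed.

Lemma rk1 c : rk 1 c = rho c.
Proof. by rewrite /= /rho_word /= cats0. Qed.

Lemma rk_infix j k c d : d \in rk k c -> infix (rk j d) (rk (j + k) c).
Proof.
rewrite rk_flatten => /splitPr[p q].
by rewrite map_cat flatten_cat /=; apply/infixP; do 2 eexists.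
Qed.

Hypothesis a0_neq0 : a 0%N <> 0%N.

Lemma zero_in_rho0 : fin_letter a N 0 \in rho (fin_letter a N 0).
Proof.
rewrite rho_zero entry0_fin mem_cat mem_nseq eqxx andbT lt0n.
by move/eqP: a0_neq0 => ->.
Qed.

Lemma zero_in_rk0 k : fin_letter a N 0 \in rk k (fin_letter a N 0).
Proof.
elim: k => [|k IH]; first by rewrite inE.
by rewrite -add1n; apply: rk_trans IH _; rewrite rk1 zero_in_rho0.
Qed.

(** The last letter of rho(c) is the successor of c. *)
Lemma fin_in_rk0 k : fin_letter a N k \in rk k (fin_letter a N 0).
Proof.
elim: k => [|k IH]; first by rewrite inE.
by rewrite -add1n; apply: rk_trans IH _; rewrite rk1 -succ_fin succ_in_rho.
Qed.

Lemma size_rho_ge c : (2 <= size (rho c))%N.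
Proof.
case: (letter_cases c) => [->|[d ->]].
  rewrite rho_zero size_cat size_nseq entry0_fin /= addn1 !ltnS lt0n.
  exact/eqP.
by rewrite rho_succ size_cat /= addn2.
Qed.

Lemma size_rk_le k c : (size (rk k c) <= N.+2 ^ k)%N.
Proof.
elim: k => //= k IH; rewrite expnS.
apply: leq_trans (leq_mul (leqnn _) IH).
elim: (iter _ _ _) => //= d w; rewrite /rho_word /= size_cat mulnS => h.
by apply: leq_add => //; exact: size_rho_le.
Qed.

Lemma size_rk_ge k c : (2 ^ k <= size (rk k c))%N.
Proof.
elim: k => //= k IH; rewrite expnS.
apply: leq_trans (leq_mul (leqnn _) IH) _.
elim: (iter _ _ _) => //= d w; rewrite /rho_word /= size_cat mulnS => h.
by apply: leq_add => //; exact: size_rho_ge.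
Qed.

(** The gap condition on the sequence a passes to all letters by density of
the letters [i]. *)
Lemma entry_gap (C : nat) : gaps_below a C ->
  forall c, exists2 j, (j <= C)%N & (0 < entry0 (iter j (@letter_succ a N) c))%N.
Proof.
move=> aC c; have [i ci] := fin_letter_dense C c.
have [j jC aj] : exists2 j, (j <= C)%N & a (i + j)%N <> 0%N.
  apply: contrapT => h; have : (C < C)%N; last by rewrite ltnn.
  by apply: (aC i C) => j jC; apply: contrapT => aj; apply: h; exists j.
exists j => //.
have -> : entry0 (iter j (@letter_succ a N) c) =
          entry0 (iter j (@letter_succ a N) (fin_letter a N i)).
  apply: (@agree_entry0 (C - j)).
  elim: j jC {aj} => [|j IH] jC; first by rewrite subn0.
  by apply: agree_succ; rewrite subnSK //; apply: IH; exact: ltnW.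
have -> : iter j (@letter_succ a N) (fin_letter a N i) = fin_letter a N (i + j).
  elim: j {jC aj} => [|j IH]; first by rewrite addn0.
  by rewrite addnS -succ_fin -IH.
by rewrite entry0_fin lt0n; apply/eqP.
Qed.

(** Primitivity. The successors of c occur in the iterates of rho on c; the
first one with a nonzero entry at 0 produces [0] one step later, and [0] then
persists. *)
Lemma zero_in_rk (C : nat) : gaps_below a C ->
  forall c, fin_letter a N 0 \in rk C.+1 c.
Proof.
move=> aC c; have [j jC ej] := entry_gap aC c.
have jin : iter j (@letter_succ a N) c \in rk j c.
  elim: j {jC ej} => [|j IH]; first by rewrite inE.
  by rewrite -add1n; apply: rk_trans IH _; rewrite rk1 succ_in_rho.
rewrite -(subnK jC) -addnS; apply: rk_trans (zero_in_rk0 _).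
rewrite -add1n; apply: rk_trans jin _; rewrite rk1.
move: ej; case: (letter_cases (iter j (@letter_succ a N) c)) => [->|[d ->]] ej.
  by rewrite zero_in_rho0.
by rewrite rho_succ mem_cat mem_nseq ej eqxx.
Qed.

Definition legal (u : seq L) := exists k c, infix u (rk k c).

Lemma legal_infix u v : infix u v -> legal v -> legal u.
Proof. by move=> uv [k [c vc]]; exists k, c; exact: infix_trans vc. Qed.

Lemma prefix_flatten (f : L -> seq L) B : (forall c, (size (f c) <= B)%N) ->
  forall v w, prefix w (flatten (map f v)) ->
  exists v' p, w = flatten (map f v') ++ p /\ (size p <= B)%N.
Proof.
move=> fB; elim=> [|x v IH] w.
  by case: w => // _; exists [::], [::].
move=> /prefixP[r /= e]; case: (leqP (size w) (size (f x))) => wx.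
  by exists [::], w; split => //; exact: leq_trans (fB x).
have e1 : take (size (f x)) w = f x.
  have /(congr1 (take (size (f x)))) := e.
  by rewrite take_size_cat// take_cat wx.
have [|v' [p [e2 pB]]] := IH (drop (size (f x)) w).
  apply/prefixP; exists r.
  have /(congr1 (drop (size (f x)))) := e.
  by rewrite drop_size_cat// drop_cat wx.
exists (x :: v'), p; split => //=.
by rewrite -catA -e2 -{1}(cat_take_drop (size (f x)) w) e1.
Qed.

(** The start of w is located in a block by induction; what follows that block
is covered by [prefix_flatten]. *)
Lemma infix_flatten (f : L -> seq L) B : (forall c, (size (f c) <= B)%N) ->
  forall v w, infix w (flatten (map f v)) ->
  exists s v' p, [/\ w = s ++ flatten (map f v') ++ p, (size s <= B)%N &
    (size p <= B)%N].
Proof.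
move=> fB v w /infixP[q [r]]; elim: v q => [|x v IH] q /=.
  move=> /esym/eqP; rewrite -!size_eq0 !size_cat !addn_eq0 !size_eq0.
  by move=> /and3P[_ /eqP -> _]; exists [::], [::], [::].
move=> e; case: (leqP (size (f x)) (size q)) => qx.
  apply: (IH (drop (size (f x)) q)).
  have /(congr1 (drop (size (f x)))) := e.
  rewrite drop_size_cat// => ->; rewrite drop_cat.
  case: ltngtP qx => // qx _; by rewrite qx subnn drop0 drop_size.
have e1 : take (size q) (f x) = q.
  have /(congr1 (take (size q))) := e.
  by rewrite take_cat qx take_size_cat.
have e2 : drop (size q) (f x) ++ flatten (map f v) = w ++ r.
  have /(congr1 (drop (size q))) := e.
  by rewrite drop_cat qx drop_size_cat.
set s' := drop (size q) (f x) in e2.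
have s'B : (size s' <= B)%N.
  by rewrite size_drop (leq_trans (leq_subr _ _)).
case: (leqP (size w) (size s')) => ws.
  by exists w, [::], [::]; rewrite /= cats0; split => //; exact: leq_trans ws _.
have e3 : take (size s') w = s'.
  have /(congr1 (take (size s'))) := e2.
  by rewrite take_size_cat// take_cat ws.
have [|v' [p [e4 pB]]] := @prefix_flatten f B fB v (drop (size s') w).
  apply/prefixP; exists r.
  have /(congr1 (drop (size s'))) := e2.
  by rewrite drop_size_cat// drop_cat ws.
exists s', v', p; split => //.
by rewrite -e4 -{1}(cat_take_drop (size s') w) e3.
Qed.

(** A legal word lies in some rho^k(c), with k at least n because the word is
long, and then rho^k(c) is a concatenation of supertiles rho^n(d). *)
Lemma legal_decomp n w : legal w -> (N.+2 ^ n < size w)%N ->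
  exists s v p, [/\ w = s ++ flatten [seq rk n c | c <- v] ++ p,
    (size s <= N.+2 ^ n)%N & (size p <= N.+2 ^ n)%N].
Proof.
move=> [k [c wk]] wn; case: (leqP n k) => nk.
  move: wk; rewrite -(subnKC nk) rk_flatten.
  by apply: infix_flatten => d; exact: size_rk_le.
suff : (size w <= N.+2 ^ n)%N by rewrite leqNgt wn.
apply: leq_trans (size_infix wk) _; apply: leq_trans (size_rk_le k c) _.
by rewrite leq_pexp2l// ltnW.
Qed.

End Letters.

(** * The subshift: language, compactness and minimality *)

Section Subshift.
Variables (a : nat -> nat) (N : nat).
Local Notation L := (letter a N).
Local Notation X := (subshift a N).
Local Notation rk k c := (iter k (@rho_word a N) [:: c]).
Local Notation zero := (fin_letter a N 0).

Definition seq_of_word (w : word a N) : seq L :=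
  [seq projT2 w i | i <- enum 'I_(projT1 w)].

Lemma word_of_seqK u : seq_of_word (word_of_seq u) = u.
Proof.
rewrite /seq_of_word /=; apply: (@eq_from_nth _ zero).
  by rewrite size_map size_enum_ord.
move=> i; rewrite size_map size_enum_ord => iu.
rewrite (nth_map (Ordinal iu)) ?size_enum_ord// (tnth_nth zero) /=.
by rewrite nth_enum_ord.
Qed.

Lemma word_of_seqE u n : size u = n ->
  word_of_seq u = existT _ n (fun i : 'I_n => nth zero u i).
Proof.
move=> <-; rewrite /word_of_seq; congr existT.
by apply/funext => i; rewrite (tnth_nth zero).
Qed.

Lemma agree_word_map (I : eqType) n (f g : I -> L) (s : seq I) :
  (forall i, i \in s -> agree n (f i) (g i)) ->
  agree_word n (map f s) (map g s).
Proof.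
elim: s => //= i s IH h; split; first by apply: h; rewrite inE eqxx.
by apply: IH => j js; apply: h; rewrite inE js orbT.
Qed.

(** The language is a closure, and a word has finitely many letters, so one
precision serves all of them. *)
Lemma languageP (w : word a N) : language w <->
  forall K, exists2 u, legal u & agree_word K (seq_of_word w) u.
Proof.
split=> [lw K|h].
  have nw : nbhs w [set w' | agree_word K (seq_of_word w) (seq_of_word w')].
    case: w {lw} => n f.
    change (nbhs (f : prod_topology (fun _ : 'I_n => L)) [set g : 'I_n -> L |
      agree_word K (seq_of_word (existT _ n f)) (seq_of_word (existT _ n g))]).
    apply/prod_nbhsP; exists (enum 'I_n), (fun i => agree K (f i)); split.
      by move=> i; exact: agree_nbhs.
    by move=> g fg; exact: agree_word_map.
  have [_ [[u [k [c uk]] <-]]] := lw _ nw.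
  by rewrite /= word_of_seqK => wu; exists u => //; exists k, c.
case: w h => n f h O nO.
have /prod_nbhsP[s [W [fW WO]]] : nbhs (f : prod_topology (fun _ : 'I_n => L))
  [set g : 'I_n -> L | O (existT _ n g)] by exact: nO.
have [K KW] : exists K, forall i : 'I_n, agree K (f i) `<=` W i.
  have : forall i : 'I_n, exists K, agree K (f i) `<=` W i.
    by move=> i; have /letter_nbhsP[K KW] := fW i; exists K.
  move=> /choice[K KW]; exists (\max_i K i)%N => i d fd; apply: KW.
  by apply: agreeW fd; exact: leq_bigmax.
have [u [k [c uk]] fu] := h K.
exists (word_of_seq u); split; first by exists u => //; exists k, c.
have su := agree_word_size fu.
rewrite size_map size_enum_ord /= in su.
have -> : word_of_seq u = existT _ n (fun i : 'I_n => nth zero u i).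
  exact/word_of_seqE.
apply: WO => i _; apply: KW.
have := agree_word_nth zero i fu.
by rewrite /seq_of_word /= (nth_map i) ?size_enum_ord// nth_ord_enum.
Qed.

Definition window (x : int -> L) (m : int) (n : nat) : seq L :=
  [seq x (m + i%:Z) | i <- iota 0 n].

Lemma size_window x m n : size (window x m n) = n.
Proof. by rewrite size_map size_iota. Qed.

Lemma nth_window x m n i : (i < n)%N -> nth zero (window x m n) i = x (m + i%:Z).
Proof. by move=> ni; rewrite (nth_map 0%N) ?size_iota// nth_iota// add0n. Qed.

Lemma window_infix x m n u : infix u (window x m n) ->
  exists p, u = window x p (size u).
Proof.
move=> /infixP[p [q e]]; exists (m + (size p)%:Z).
apply: (@eq_from_nth _ zero); first by rewrite size_window.
move=> i iu; rewrite nth_window// -addrA -PoszD.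
have sz : n = (size p + (size u + size q))%N.
  by rewrite -!size_cat -e size_window.
rewrite -(nth_window x m (n := n)); last by rewrite sz ltn_add2l ltn_addr.
by rewrite e nth_cat ltnNge leq_addr /= addKn nth_cat iu.
Qed.

Lemma window_sub x m n p k : m <= p -> p + k%:Z <= m + n%:Z ->
  infix (window x p k) (window x m n).
Proof.
move=> mp pk; rewrite (_ : window x p k = take k (drop `|p - m|%N (window x m n))).
  by apply: infix_trans (infix_drop _ _); exact: infix_take.
have sz : (`|p - m| + k <= n)%N by lia.
apply: (@eq_from_nth _ zero).
  by rewrite size_window size_takel// size_drop size_window; lia.
move=> i; rewrite size_window => ik.
rewrite nth_take// nth_drop !nth_window//; last by lia.
by congr x; lia.
Qed.

Lemma subshiftP x : subshift_set x <->
  forall m n K, exists2 u, legal u & agree_word K (window x m n) u.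
Proof.
have e m n : seq_of_word (existT _ n (fun i : 'I_n => x (m + i%:Z))) = window x m n.
  rewrite /seq_of_word /window /= -val_enum_ord -map_comp.
  by apply: eq_map.
split=> [h m n|h m n]; first by have /languageP := h m n; rewrite e.
by apply/languageP; rewrite e.
Qed.

(** One index n bounds both the range of positions and the precision of the
letters, so that these relations form a countable base of neighbourhoods. *)
Definition agree_seq n (x y : int -> L) :=
  forall j : int, (`|j| <= n)%N -> agree n (x j) (y j).

Lemma agree_seqW m n x y : (m <= n)%N -> agree_seq n x y -> agree_seq m x y.
Proof. by move=> mn xy j jm; apply: (agreeW mn); apply: xy; exact: leq_trans mn. Qed.

Lemma agree_seqC n x y : agree_seq n x y -> agree_seq n y x.
Proof. by move=> xy j jm; apply: agreeC; exact: xy. Qed.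

Lemma agree_seq_trans n x y z : agree_seq n x y -> agree_seq n y z -> agree_seq n x z.
Proof. by move=> xy yz j jm; apply: agree_trans (xy j jm) (yz j jm). Qed.

Lemma agree_seq_window n x y : agree_seq n x y <->
  agree_word n (window x (- n%:Z) n.*2.+1) (window y (- n%:Z) n.*2.+1).
Proof.
split=> [xy|xy j jn].
  by apply: agree_word_map => i; rewrite mem_iota => ni; apply: xy; lia.
have := agree_word_nth zero `|j + n%:Z| xy.
by rewrite !nth_window; [|lia..]; rewrite (_ : - n%:Z + _ = j)//; lia.
Qed.

Lemma seq_nbhsP (x : prod_topology (fun _ : int => L)) O :
  nbhs x O <-> exists n, forall y, agree_seq n x y -> O y.
Proof.
split=> [/prod_nbhsP[s [W [Wx WO]]]|[n nO]].
  have [K KW] : exists K, forall i, i \in s -> agree K (x i) `<=` W i.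
    have : forall i : int, exists K, agree K (x i) `<=` W i.
      by move=> i; have /letter_nbhsP[K KW] := Wx i; exists K.
    move=> /choice[K KW]; exists (\max_(i <- s) K i)%N => i si d fd; apply: KW.
    by apply: agreeW fd; exact: leq_bigmax_seq.
  have [n sn] := int_seq_bound s; exists (maxn K n) => y xy; apply: WO => i si.
  apply: KW => //; apply: (agreeW (leq_maxl K n)); apply: xy.
  by rewrite (leq_trans (sn _ si))// leq_maxr.
apply/prod_nbhsP.
exists ([seq i%:Z | i <- iota 0 n.+1] ++ [seq - i%:Z | i <- iota 0 n.+1]).
exists (fun i => agree n (x i)); split.
  by move=> i; exact: agree_nbhs.
move=> y yx; apply: nO => k kn; apply: yx; rewrite mem_cat.
apply/orP; case: (leP 0 k) => k0; [left|right]; apply/mapP; exists `|k|%N;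
  rewrite ?mem_iota//; lia.
Qed.

Lemma subshift_nbhsP (x : X) (O : set X) :
  nbhs x O <-> exists n, forall y : X, agree_seq n (val x) (val y) -> O y.
Proof.
split=> [/subtype_nbhsP[V /seq_nbhsP[n nV] VO]|[n nO]].
  by exists n => y xy; apply: VO; exact: nV.
apply/subtype_nbhsP; exists (agree_seq n (val x)) => //.
by apply/seq_nbhsP; exists n.
Qed.

Lemma compact_seq : compact [set: prod_topology (fun _ : int => L)].
Proof.
have := @tychonoff int (fun _ => L) (fun=> setT) (fun=> @compact_letter a N).
by congr compact; apply/seteqP; split.
Qed.

Lemma compact_subshift : compact [set: X].
Proof.
apply: subtype_compact; apply: (subclosed_compact _ compact_seq) => //.
move=> x clx; apply/subshiftP => m n K.
have [y [/subshiftP Xy xy]] : @subshift_set a N `&` agree_seq (`|m| + n + K)%N x !=set0.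
  by apply: clx; apply/seq_nbhsP; exists (`|m| + n + K)%N.
have [u lu yu] := Xy m n K; exists u => //; apply: agree_word_trans yu.
apply: agree_word_map => i; rewrite mem_iota => ni.
apply: (@agreeW _ _ _ (`|m| + n + K)%N); first by rewrite leq_addl.
by apply: xy; lia.
Qed.

Hypothesis a_le_N : forall i, (a i <= N)%N.
Hypothesis a0_neq0 : a 0%N <> 0%N.

Lemma legal_long n : exists2 u : seq L, legal u & size u = n.
Proof.
exists (take n (rk n zero)); first by exists n, zero; exact: infix_take.
rewrite size_takel//; apply: leq_trans (size_rk_ge a_le_N a0_neq0 n zero).
by rewrite ltnW// ltn_expl.
Qed.

(** Cluster point of bi-infinite sequences that carry longer and longer legal
words centred at 0. *)
Lemma subshift_nonempty : exists x : int -> L, subshift_set x.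
Proof.
have /choice[w wP] : forall n, exists u : seq L, legal u /\ size u = n.*2.+1.
  by move=> n; have [u lu su] := legal_long n.*2.+1; exists u.
(* The word w n has length 2n+1 and is placed at the positions from -n to n. *)
pose x n : prod_topology (fun _ : int => L) := fun j : int => nth zero (w n) (absz (j + n%:Z)).
have [|y [_ cly]] := @compact_seq (x @ \oo) _; first exact: filterT.
exists y; apply/subshiftP => m n K.
have [_ [[i iM <-] yx]] : (x @` [set i | (`|m| + n + K <= i)%N]) `&`
    agree_seq (`|m| + n + K)%N y !=set0.
  apply: cly; last by apply/seq_nbhsP; exists (`|m| + n + K)%N.
  by exists (`|m| + n + K)%N => // i /= iM; exists i.
exists (window (x i) m n).
  have [lw sw] := wP i; apply: legal_infix lw.
  have -> : w i = window (x i) (- i%:Z) i.*2.+1.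
    apply: (@eq_from_nth _ zero); first by rewrite size_window.
    move=> j; rewrite sw => ji; rewrite nth_window// /x; congr nth; lia.
  apply: window_sub; move: iM => /=; lia.
apply: agree_word_map => j; rewrite mem_iota => ni.
apply: (@agreeW _ _ _ (`|m| + n + K)%N); first by rewrite leq_addl.
by apply: yx; lia.
Qed.

(** A letter c may be replaced by a nearby [i], and [i] occurs in rho^i([0]). *)
Lemma legal_approx K u : legal u ->
  exists M, exists2 u', infix u' (rk M zero) & agree_word K u u'.
Proof.
move=> [k [c uk]]; have [i ci] := fin_letter_dense (K + k) c.
have [u' u'k uu'] := agree_word_infix uk (agree_rk a_le_N ci).
exists (k + i)%N, u' => //; apply: infix_trans u'k _.
by apply: rk_infix; exact: fin_in_rk0.
Qed.

Hypothesis a_gaps : bounded_gaps a.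

Lemma zero_in_rk_uniform : exists K, forall c, zero \in rk K c.
Proof. by have [C [_ aC]] := a_gaps; exists C.+1 => c; exact: zero_in_rk. Qed.

(** A long legal word contains a complete supertile rho^(M+K)(d), and [0]
occurs in rho^K(d). *)
Lemma legal_recurrent M : exists n0, forall w : seq L, legal w ->
  (n0 <= size w)%N -> infix (rk M zero) w.
Proof.
have [K zK] := zero_in_rk_uniform.
exists ((N.+2 ^ (M + K)).*2.+1)%N => w lw wn.
have [|s [v [p [e sB pB]]]] := @legal_decomp a N a_le_N (M + K) w lw.
  by apply: leq_trans wn; rewrite ltnS -addnn leq_addr.
case: v e => [|d v] e.
  suff : (size w <= (N.+2 ^ (M + K)).*2)%N by rewrite leqNgt wn.
  by rewrite e !size_cat /= add0n -addnn leq_add.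
rewrite e /=; apply: infix_trans (rk_infix M (zK d)) _.
by apply/infixP; exists s, (flatten [seq rk (M + K) c | c <- v] ++ p); rewrite !catA.
Qed.

(** A central word of y is approximated by a subword of some rho^M([0]), which
in turn occurs in every long word that approximates a window of x. *)
Theorem subshift_minimal : minimal (@subshift_act a N).
Proof.
move=> x O [y Oy] oO.
have /subshift_nbhsP[n nO] : nbhs y O by apply: open_nbhs_nbhs.
have /subshiftP Xy := set_mem (valP y).
have /subshiftP Xx := set_mem (valP x).
have [u lu yu] := Xy (- n%:Z) n.*2.+1 n.
have [M [u' u'M uu']] := legal_approx n lu.
have [n0 rec] := legal_recurrent M.
have [w lw xw] := Xx 0 n0 n.
have u'w : infix u' w.
  apply: infix_trans u'M _; apply: rec => //.
  by rewrite -(agree_word_size xw) size_window.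
have [v vx u'v] := agree_word_infix u'w (agree_wordC xw).
have [p vp] := window_infix vx.
have su : size v = n.*2.+1.
  rewrite -(agree_word_size u'v) -(agree_word_size uu') -(agree_word_size yu).
  exact: size_window.
exists (subshift_act (p + n%:Z) x); split; last by exists (p + n%:Z).
apply: nO; apply/agree_seq_window.
have -> : window (val (subshift_act (p + n%:Z) x)) (- n%:Z) n.*2.+1 = v.
  rewrite vp su; apply: eq_map => i /=; rewrite /shift; congr (val x _); lia.
by apply: agree_word_trans yu _; apply: agree_word_trans uu' u'v.
Qed.

End Subshift.

(** * Uniform convergence of inflated sums and uniform frequencies *)

Section RealFacts.
Variable R : realType.

Lemma geom_small (q eta : R) : 0 <= q < 1 -> 0 < eta -> exists n, q ^+ n <= eta.
Proof.
move=> /andP[q0 q1] eta0; have := @cvg_expr R q.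
rewrite ger0_norm// => /(_ q1)/cvgrPdist_le/(_ _ eta0)[n _ /(_ n (leqnn n))].
by rewrite sub0r normrN ger0_norm ?exprn_ge0// => h; exists n.
Qed.

Lemma geom_large (q A : R) : 1 < q -> exists n0, forall n, (n0 <= n)%N -> A <= q ^+ n.
Proof.
move=> q1; have q0 : 0 < q by rewrite (lt_trans ltr01).
have [n nA] : exists n, q^-1 ^+ n <= (`|A| + 1)^-1.
  by apply: geom_small; rewrite ?invr_gt0 ?ltr_wpDl// invr_ge0 ltW//= invf_lt1.
exists n => m nm; have A0 : 0 < `|A| + 1 by rewrite ltr_wpDl.
rewrite exprVn lef_pV2 ?posrE ?exprn_gt0// in nA.
apply: le_trans (ler_weXn2l (ltW q1) nm); apply: le_trans nA.
by rewrite (le_trans (ler_norm _))// lerDl.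
Qed.

(** If all lower bounds lie below all upper bounds, the supremum of the lower
bounds separates them. *)
Lemma nested_intervals (Q : R -> R -> Prop) :
  (forall x y x' y', Q x y -> Q x' y' -> x <= y') ->
  (exists x y, Q x y) ->
  exists p, forall x y, Q x y -> x <= p <= y.
Proof.
move=> comp [x0 [y0 Q0]]; pose A := [set x | exists y, Q x y].
have hA : has_sup A.
  by split; [exists x0, y0|exists y0 => x [y Qxy]; exact: comp Qxy Q0].
exists (sup A) => x y Qxy; apply/andP; split.
  by apply: sup_upper_bound => //; exists y.
by apply: ge_sup; [exists x0, y0|move=> x' [y' Q']; exact: comp Q' Qxy].
Qed.

End RealFacts.

Section Ergodic.
Variables (R : realType) (a : nat -> nat) (N : nat).
Local Notation L := (letter a N).
Local Notation rk k c := (iter k (@rho_word a N) [:: c]).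
Local Notation zero := (fin_letter a N 0).
Hypothesis a_le_N : forall i, (a i <= N)%N.
Hypothesis a0_neq0 : a 0%N <> 0%N.
Hypothesis a_gaps : bounded_gaps a.

Lemma sum_rk (f : L -> R) j k c :
  \sum_(b <- rk (j + k) c) f b = \sum_(d <- rk k c) \sum_(b <- rk j d) f b.
Proof. by rewrite rk_flatten big_flatten /= big_map. Qed.

Lemma tile_length_bounds (l : L -> R) : continuous l -> (forall c, 0 < l c) ->
  exists lmin lmax, 0 < lmin /\ forall c, lmin <= l c <= lmax.
Proof.
move=> cl l0.
have T0 : [set: L] !=set0 by exists zero.
have cT : {within [set: L], continuous l} by exact: continuous_subspaceT.
have [c _ cmin] := compact_EVT_min T0 (@compact_letter a N) cT.
have [d _ dmax] := compact_EVT_max T0 (@compact_letter a N) cT.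
exists (l c), (l d); split => // e.
by rewrite cmin ?dmax ?inE.
Qed.

Section fixed_length.
Variables (l : L -> R) (lam lmin lmax : R).
Hypothesis lam1 : 1 < lam.
Hypothesis l_eigen : forall c, \sum_(b <- rho c) l b = lam * l c.
Hypothesis lmin0 : 0 < lmin.
Hypothesis l_bounds : forall c, lmin <= l c <= lmax.

Let lam0 : 0 < lam. Proof. exact: lt_trans lam1. Qed.
Let lamn0 n : 0 < lam ^+ n. Proof. exact: exprn_gt0. Qed.
Let l0 c : 0 < l c. Proof. by have /andP[h _] := l_bounds c; exact: lt_le_trans h. Qed.
Let lmax0 : 0 < lmax.
Proof. by have /andP[h h'] := l_bounds zero; rewrite (lt_le_trans lmin0)// (le_trans h). Qed.

Lemma sum_l_rk n c : \sum_(b <- rk n c) l b = lam ^+ n * l c.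
Proof.
elim: n c => [|n IH] c; first by rewrite big_seq1 expr0 mul1r.
rewrite -addn1 sum_rk rk1.
rewrite (eq_bigr (fun d => lam ^+ n * l d)); last by move=> d _; exact: IH.
by rewrite -mulr_sumr l_eigen addn1 exprSr mulrA.
Qed.

Lemma size_le_sum (w : seq L) : (size w)%:R * lmin <= \sum_(b <- w) l b.
Proof.
elim: w => [|c w IH]; first by rewrite big_nil mul0r.
rewrite big_cons /= -natr1 mulrDl mul1r addrC lerD//.
by have /andP[] := l_bounds c.
Qed.

Lemma sum_le_size (w : seq L) : \sum_(b <- w) l b <= (size w)%:R * lmax.
Proof.
elim: w => [|c w IH]; first by rewrite big_nil mul0r.
rewrite big_cons /= -natr1 mulrDl mul1r addrC lerD//.
by have /andP[] := l_bounds c.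
Qed.

(** The bounds on g m c / (lam^m l c) are multiplied out to avoid division. *)
Definition encloses (g : nat -> L -> R) (x y : R) := exists m0 : nat,
  forall m c, (m0 <= m)%N -> x * (lam ^+ m * l c) <= g m c <= y * (lam ^+ m * l c).

Lemma encloses_limit (g : nat -> L -> R) :
  (forall eta, 0 < eta -> exists x y, encloses g x y /\ y - x <= eta) ->
  exists p, (forall x y, encloses g x y -> x <= p <= y) /\
    forall eta, 0 < eta -> exists m0 : nat, forall m c, (m0 <= m)%N ->
      `|g m c - p * (lam ^+ m * l c)| <= eta * (lam ^+ m * l c).
Proof.
move=> g_small.
have [||p pP] := @nested_intervals R (encloses g).
- move=> x y x' y' [m gm] [m' gm'].
  have /andP[h1 _] := gm (maxn m m') zero (leq_maxl _ _).
  have /andP[_ h2] := gm' (maxn m m') zero (leq_maxr _ _).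
  by have := le_trans h1 h2; rewrite ler_pM2r// mulr_gt0.
- by have [x [y [gxy _]]] := g_small 1 ltr01; exists x, y.
exists p; split => // eta eta0; have [x [y [gxy xy]]] := g_small _ eta0.
have /andP[xp py] := pP _ _ gxy; case: gxy => m0 gxy; exists m0 => m c mm0.
have /andP[h1 h2] := gxy m c mm0.
have lp : 0 < lam ^+ m * l c by rewrite mulr_gt0.
move: (lam ^+ m * l c) (g m c) h1 h2 lp => t z h1 h2 lp.
by rewrite ler_norml; apply/andP; split; nra.
Qed.

(** With M f(c) the sum of f over rho(c), the function M^(k+K) f / (lam^(k+K) l)
is an average of M^k f / (lam^k l), and the letter [0], which occurs in every
rho^K(c), has weight at least eps in it. So enclosing constants at level k can
be moved towards the value at [0] by the factor eps, and their distance
contracts by 1 - eps every K steps (Doeblin's argument). *)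
Lemma sum_rk_converges (f : L -> R) (B : R) : (forall c, `|f c| <= B) ->
  let g n c := \sum_(b <- rk n c) f b in
  exists p, (forall x y, encloses g x y -> x <= p <= y) /\
    forall eta, 0 < eta -> exists m0 : nat, forall m c, (m0 <= m)%N ->
      `|g m c - p * (lam ^+ m * l c)| <= eta * (lam ^+ m * l c).
Proof.
move=> fB g.
have [K zK] := zero_in_rk_uniform a_le_N a0_neq0 a_gaps.
pose Q x y := exists k, forall c,
  x * (lam ^+ k * l c) <= g k c <= y * (lam ^+ k * l c).
have Qenc x y : Q x y -> encloses g x y.
  move=> [k gk]; exists k => m c km.
  rewrite /g -(subnKC km) sum_rk -/(g k) exprD -mulrA -sum_l_rk !mulr_sumr.
  apply/andP; split; apply: ler_sum => d _; by have /andP[] := gk d.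
(* A lower bound for l zero / (lam ^+ K * l c), the share of one letter [0] in
   the total length of rho^K(c). *)
pose eps := l zero / (lam ^+ K * lmax).
have eps01 : 0 < eps <= 1.
  rewrite divr_gt0 ?mulr_gt0//= ler_pdivrMr ?mulr_gt0// mul1r.
  have /andP[_ h] := l_bounds zero; apply: le_trans h _.
  by rewrite ler_peMl// ?exprn_ege1 ?ltW.
have Qstep x y : Q x y -> exists x' y', Q x' y' /\ y' - x' = (1 - eps) * (y - x).
  move=> [k gk]; pose t := g k zero / (lam ^+ k * l zero).
  have lz : 0 < lam ^+ k * l zero by rewrite mulr_gt0.
  have gt : g k zero = t * (lam ^+ k * l zero) by rewrite /t divfK// gt_eqF.
  have /andP[xt ty] : x <= t <= y.
    by have := gk zero; rewrite gt !ler_pM2r.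
  exists (x + (t - x) * eps), (y - (y - t) * eps); split; last by ring.
  exists (k + K)%N => c; rewrite /g sum_rk -/(g k).
  have key (h : L -> R) : (forall d, 0 <= h d) -> h zero <= \sum_(d <- rk K c) h d.
    move=> h0; rewrite (perm_big _ (perm_to_rem (zK c))) big_cons /=.
    by rewrite lerDl sumr_ge0.
  have lc : l zero * lam ^+ k >= eps * (lam ^+ (k + K) * l c).
    have -> : l zero * lam ^+ k = eps * (lam ^+ (k + K) * lmax).
      rewrite /eps exprD; field.
      by rewrite !gt_eqF.
    by apply: ler_wpM2l; [case/andP: eps01 => /ltW|apply: ler_wpM2l;
      [exact: ltW|by have /andP[] := l_bounds c]].
  have sl : \sum_(d <- rk K c) lam ^+ k * l d = lam ^+ (k + K) * l c.
    by rewrite -mulr_sumr sum_l_rk mulrA exprD.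
  have k1 := key (fun d => g k d - x * (lam ^+ k * l d)).
  have k2 := key (fun d => y * (lam ^+ k * l d) - g k d).
  rewrite !sumrB -!mulr_sumr in k1 k2.
  rewrite -!mulr_sumr in sl; rewrite sl in k1 k2.
  have {}k1 := k1 _; have {}k2 := k2 _.
  have {}k1 : g k zero - x * (lam ^+ k * l zero) <=
    \sum_(i <- rk K c) g k i - x * (lam ^+ (k + K) * l c).
    by apply: k1 => d; rewrite subr_ge0; have /andP[] := gk d.
  have {}k2 : y * (lam ^+ k * l zero) - g k zero <=
    y * (lam ^+ (k + K) * l c) - \sum_(i <- rk K c) g k i.
    by apply: k2 => d; rewrite subr_ge0; have /andP[] := gk d.
  rewrite gt in k1 k2.
  move: (lam ^+ (k + K) * l c) (\sum_(i <- rk K c) g k i) lc k1 k2 => T S lc k1 k2.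
  by apply/andP; split; nra.
have Q0 : Q (- (B / lmin)) (B / lmin).
  exists 0%N => c; rewrite expr0 mul1r /g /= big_seq1 mulNr -ler_norml.
  apply: (le_trans (fB c)); rewrite -mulrA ler_peMr//.
    exact: le_trans (fB zero).
  by rewrite mulrC ler_pdivlMr// mul1r; have /andP[] := l_bounds c.
have Qn n : exists x y, Q x y /\ y - x = (1 - eps) ^+ n * (B / lmin - - (B / lmin)).
  elim: n => [|n [x [y [Qxy e]]]].
    by exists (- (B / lmin)), (B / lmin); rewrite expr0 mul1r.
  have [x' [y' [Q' e']]] := Qstep _ _ Qxy; exists x', y'; split => //.
  by rewrite e' e exprS mulrA.
apply: encloses_limit => eta eta0.
set D := B / lmin - - (B / lmin) in Qn.
have D0 : 0 <= D.
  by rewrite /D opprK addr_ge0// divr_ge0// ?(le_trans _ (fB zero))// ltW.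
have [n nP] : exists n, (1 - eps) ^+ n <= eta / (D + 1).
  apply: geom_small; last by rewrite divr_gt0// ltr_wpDl.
  by case/andP: eps01 => e0 e1; rewrite subr_ge0 e1 ltrBlDr ltrDl.
have [x [y [Qxy e]]] := Qn n; exists x, y; split; first exact: Qenc.
rewrite e; apply: (@le_trans _ _ (eta / (D + 1) * D)); first exact: ler_wpM2r.
rewrite mulrAC ler_pdivrMr ?ltr_wpDl//; nra.
Qed.

Section counting.
Variables (F : seq L -> R) (r : nat).
Hypothesis F01 : forall w, 0 <= F w <= 1.

(** Factors near the end of w that are shorter than r are included; this keeps
the recursion simple and changes the sum by at most r. *)
Fixpoint count_sum (w : seq L) : R :=
  if w is x :: w' then F (take r w) + count_sum w' else 0.

Lemma count_sum_bounds w : 0 <= count_sum w <= (size w)%:R.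
Proof.
elim: w => [|x w /andP[h1 h2]]; first by rewrite lexx.
have /andP[h3 h4] := F01 (take r (x :: w)).
by rewrite [count_sum _]/= -natr1 addr_ge0//= addrC lerD.
Qed.

Lemma count_sum_cat_min u v :
  `|count_sum (u ++ v) - (count_sum u + count_sum v)| <= (minn r (size u))%:R.
Proof.
elim: u => [|x u IH]; first by rewrite /= add0r subrr normr0.
rewrite cat_cons [count_sum (x :: _)]/= [count_sum (x :: u)]/=.
case: (leqP r (size (x :: u))) => ru.
  have -> : take r (x :: u ++ v) = take r (x :: u).
    rewrite -cat_cons take_cat; case: ltngtP ru => // ru _.
    by rewrite ru subnn take0 cats0 take_size.
  have -> (A B C D : R) : A + B - (A + C + D) = B - (C + D) by ring.
  by apply: (le_trans IH); rewrite ler_nat geq_minl.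
have /andP[h1 h2] := F01 (take r (x :: u ++ v)).
have /andP[h3 h4] := F01 (take r (x :: u)).
have {}IH : `|count_sum (u ++ v) - (count_sum u + count_sum v)| <= (size u)%:R.
  by apply: (le_trans IH); rewrite ler_nat geq_minr.
rewrite /= -natr1; move: IH; rewrite !ler_norml => /andP[h5 h6].
by apply/andP; split; lra.
Qed.

Lemma count_sum_cat u v :
  `|count_sum (u ++ v) - (count_sum u + count_sum v)| <= r%:R.
Proof. by apply: (le_trans (count_sum_cat_min u v)); rewrite ler_nat geq_minl. Qed.

Lemma count_sum_flatten (h : L -> seq L) (v : seq L) :
  `|count_sum (flatten (map h v)) - \sum_(c <- v) count_sum (h c)|
    <= r%:R * (size v)%:R.
Proof.
elim: v => [|c v IH]; first by rewrite big_nil /= subrr normr0 mulr0.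
rewrite big_cons /= -natr1 mulrDr mulr1.
have := count_sum_cat (h c) (flatten (map h v)).
move: IH; rewrite !ler_norml => /andP[h1 h2] /andP[h3 h4].
by apply/andP; split; lra.
Qed.

(** Counting in rho^(k0+m)(c) is, up to an error r for each supertile, the sum
over the letters d of rho^m(c) of the count in rho^k0(d), to which
[sum_rk_converges] applies. The error is small compared to the length once k0
is large, so the bounds obtained from all k0 enclose one common frequency. *)
Lemma count_sum_rk : exists p, forall eta, 0 < eta -> exists m0 : nat,
  forall m c, (m0 <= m)%N ->
    `|count_sum (rk m c) - p * (lam ^+ m * l c)| <= eta * (lam ^+ m * l c).
Proof.
have [|p [_ pP]] := @encloses_limit (fun m c => count_sum (rk m c)); last by exists p.
move=> eta eta0; pose rr := r%:R / lmin + 1.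
have rr0 : 0 < rr by rewrite ltr_wpDl// divr_ge0// ltW.
have [k0 /(_ k0 (leqnn _)) kP] := @geom_large R lam (2 * rr / eta) lam1.
have [|p [_ pP]] := @sum_rk_converges (fun d => count_sum (rk k0 d)) (N.+2 ^ k0)%:R.
  move=> c; have /andP[h1 h2] := count_sum_bounds (rk k0 c).
  by rewrite ger0_norm// (le_trans h2)// ler_nat size_rk_le.
have [n0 nP] := pP 1 ltr01.
exists ((p - rr) / lam ^+ k0), ((p + rr) / lam ^+ k0); split; last first.
  rewrite -mulrBl (_ : p + rr - (p - rr) = 2 * rr); last by ring.
  by rewrite ler_pdivrMr// [eta * _]mulrC -ler_pdivrMr.
exists (k0 + n0)%N => m c mm.
have -> : m = (k0 + (m - k0))%N by lia.
have mm0 : (n0 <= m - k0)%N by lia.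
move: (m - k0)%N mm0 => {mm}m mm0.
have := nP m c mm0; rewrite mul1r => h1.
have := count_sum_flatten (fun d => rk k0 d) (rk m c); rewrite -rk_flatten => h2.
have h3 : r%:R * (size (rk m c))%:R <= r%:R / lmin * (lam ^+ m * l c).
  rewrite -mulrA ler_wpM2l// mulrC ler_pdivlMr//.
  by rewrite -sum_l_rk; exact: size_le_sum.
have e (z : R) : z / lam ^+ k0 * (lam ^+ (k0 + m) * l c) = z * (lam ^+ m * l c).
  by rewrite exprD; field; rewrite gt_eqF.
rewrite !e; move: h1 (le_trans h2 h3); rewrite !ler_norml /rr.
by move=> /andP[h4 h5] /andP[h6 h7]; apply/andP; split; lra.
Qed.

(** A long legal word is a concatenation of supertiles of one large level
up to its two ends; inside each supertile the count is nearly p times the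
length, and the boundary effects are negligible per unit length. *)
Theorem uniform_frequency : exists p, forall eta, 0 < eta -> exists n0 : nat,
  forall w, legal w -> (n0 <= size w)%N ->
    `|count_sum w - p * \sum_(b <- w) l b| <= eta * \sum_(b <- w) l b.
Proof.
have [p pP] := count_sum_rk; exists p => eta eta0.
have eta4 : 0 < eta / 4 by rewrite divr_gt0.
have [m0 mP] := pP _ eta4.
have [m1 m1P] := @geom_large R lam (r%:R / lmin / (eta / 4)) lam1.
pose n := maxn m0 m1; pose B := (N.+2 ^ n)%N.
pose K0 := 2 * r%:R + 2 * B%:R + 2 * `|p| * (B%:R * lmax).
have [n0 n0P] : exists n0 : nat, K0 / (eta / 4 * lmin) <= n0%:R.
  exists (Num.bound `|K0 / (eta / 4 * lmin)|).
  by rewrite (le_trans (ler_norm _))// ltW// archi_boundP.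
exists (maxn n0 B.+1) => w lw wn.
have [|s [v [q [e sB qB]]]] := legal_decomp a_le_N (n := n) lw.
  by apply: leq_trans wn; rewrite leq_maxr.
have K0w : K0 <= eta / 4 * \sum_(b <- w) l b.
  apply: le_trans (ler_wpM2l (ltW eta4) (size_le_sum w)).
  rewrite mulrA mulrAC -ler_pdivrMl ?mulr_gt0// mulrC; apply: (le_trans n0P).
  by rewrite ler_nat (leq_trans _ wn)// leq_maxl.
have e1 := count_sum_cat s (flatten [seq rk n c | c <- v] ++ q).
have e2 := count_sum_cat (flatten [seq rk n c | c <- v]) q.
have e3 := count_sum_flatten (fun c => rk n c) v.
rewrite -e in e1.
have lv : \sum_(b <- flatten [seq rk n c | c <- v]) l b = lam ^+ n * \sum_(c <- v) l c.
  rewrite big_flatten /= big_map mulr_sumr; apply: eq_bigr => c _; exact: sum_l_rk.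
have lw' : \sum_(b <- w) l b = \sum_(b <- s) l b + (lam ^+ n * \sum_(c <- v) l c
    + \sum_(b <- q) l b) by rewrite e !big_cat /= lv.
have e4 : `|\sum_(c <- v) count_sum (rk n c) - p * (lam ^+ n * \sum_(c <- v) l c)|
    <= eta / 4 * (lam ^+ n * \sum_(c <- v) l c).
  rewrite !mulr_sumr -sumrB (le_trans (ler_norm_sum _ _ _))//.
  by apply: ler_sum => c _; apply: mP; rewrite leq_maxl.
have sl := sum_le_size s; have ql := sum_le_size q.
have sl0 : 0 <= \sum_(b <- s) l b by apply: sumr_ge0 => b _; exact: ltW.
have ql0 : 0 <= \sum_(b <- q) l b by apply: sumr_ge0 => b _; exact: ltW.
have vl0 : 0 <= lam ^+ n * \sum_(c <- v) l c.
  by rewrite mulr_ge0 ?sumr_ge0// ?ltW// => b _; exact: ltW.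
have rv : r%:R * (size v)%:R <= eta / 4 * (lam ^+ n * \sum_(c <- v) l c).
  have h := size_le_sum v.
  have h2 : r%:R / lmin <= eta / 4 * lam ^+ n.
    by rewrite [eta / 4 * _]mulrC -ler_pdivrMr//; apply: m1P; rewrite leq_maxr.
  rewrite mulrA.
  apply: (@le_trans _ _ (r%:R / lmin * \sum_(c <- v) l c)).
    by rewrite -mulrA ler_wpM2l// mulrC ler_pdivlMr.
  by apply: ler_wpM2r => //; apply: sumr_ge0 => b _; exact: ltW.
have sB' : (size s)%:R * lmax <= B%:R * lmax by rewrite ler_wpM2r ?ler_nat// ltW.
have qB' : (size q)%:R * lmax <= B%:R * lmax by rewrite ler_wpM2r ?ler_nat// ltW.
have /andP[s1 s2] := count_sum_bounds s; have /andP[q1 q2] := count_sum_bounds q.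
have sB2 : (size s)%:R <= B%:R :> R by rewrite ler_nat.
have qB2 : (size q)%:R <= B%:R :> R by rewrite ler_nat.
have ps : `|p * (\sum_(b <- s) l b + \sum_(b <- q) l b)| <= 2 * `|p| * (B%:R * lmax).
  rewrite normrM (ger0_norm (addr_ge0 sl0 ql0)) -mulrA mulrCA ler_wpM2l//; lra.
rewrite lw' in K0w *; rewrite /K0 in K0w.
have es := mulr_ge0 (ltW eta0) sl0; have eq := mulr_ge0 (ltW eta0) ql0.
have ev := mulr_ge0 (ltW eta0) vl0.
rewrite !ler_norml in e1 e2 e3 e4 ps *.
move: e1 e2 e3 e4 ps => /andP[? ?] /andP[? ?] /andP[? ?] /andP[? ?] /andP[? ?].
by apply/andP; split; lra.
Qed.

End counting.
End fixed_length.

(** By [sum_rk_converges] for f = l', the quotient (lam'/lam)^n l'/l converges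
uniformly to a constant p, which is positive because l'/l, hence its averages
over supertiles, is bounded below. Therefore lam' = lam, and l'/l is the
constant p. *)
Theorem tile_length_unique (l l' : L -> R) : is_tile_length l -> is_tile_length l' ->
  exists2 k : R, 0 < k & forall c, l' c = k * l c.
Proof.
move=> [cl l0 [lam lam1 el]] [cl' l0' [lam' lam1' el']].
have [m [M [m0 mM]]] := tile_length_bounds cl l0.
have [m' [M' [m0' mM']]] := tile_length_bounds cl' l0'.
have [|p [penc pP]] := @sum_rk_converges l lam m M lam1 el m0 mM l' M'.
  by move=> c; rewrite gtr0_norm//; have /andP[] := mM' c.
have lam0 : 0 < lam by exact: lt_trans lam1.
have lamn0 n : 0 < lam ^+ n by exact: exprn_gt0.
pose t := lam' / lam; pose g c := l' c / l c.
have {}pP eta : 0 < eta -> exists n0, forall n c, (n0 <= n)%N ->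
    `|t ^+ n * g c - p| <= eta.
  move=> /pP[n0 nP]; exists n0 => n c /(nP n c).
  rewrite (sum_l_rk el').
  have lc : 0 < lam ^+ n * l c by rewrite mulr_gt0.
  have -> : lam' ^+ n * l' c = t ^+ n * g c * (lam ^+ n * l c).
    by rewrite /t /g expr_div_n; field; rewrite !gt_eqF.
  by rewrite -mulrBl normrM (gtr0_norm lc) ler_pM2r.
have p0 : 0 < p.
  have M0 : 0 < M.
    by have /andP[h h'] := mM zero; rewrite (lt_le_trans m0)// (le_trans h).
  apply: (@lt_le_trans _ _ (m' / M)); first by rewrite divr_gt0.
  suff enc : encloses l lam (fun n c => \sum_(b <- rk n c) l' b) (m' / M) (M' / m).
    by have /andP[] := penc _ _ enc.
  exists 0%N => n c _; rewrite -(sum_l_rk el) !mulr_sumr.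
  apply/andP; split; apply: ler_sum => d _;
    have /andP[h1 h2] := mM d; have /andP[h3 h4] := mM' d.
    apply: le_trans h3; rewrite mulrAC ler_pdivrMr//.
    by rewrite ler_wpM2l// ltW.
  apply: (le_trans h4); rewrite mulrAC ler_pdivlMr//.
  by rewrite ler_wpM2l// (le_trans (ltW m0') (le_trans h3 h4)).
have t0 : 0 < t by rewrite divr_gt0// (lt_trans ltr01).
(* Consecutive powers t^n and t^(n+1) both bring the quotient to p. *)
have t1 : t = 1.
  apply/eqP; rewrite -subr_eq0; apply/eqP.
  suff : (t - 1) * p = 0 by move=> /eqP; rewrite mulf_eq0 (gt_eqF p0) orbF => /eqP.
  apply/normr0_eq0/le_anti; rewrite normr_ge0 andbT.
  apply/ler_addgt0Pr => eta eta0; rewrite add0r.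
  have [|n nP] := pP (eta / (t + 1)) _; first by rewrite divr_gt0// addr_gt0.
  have := nP n zero (leqnn _); have := nP n.+1 zero (leqnSn _).
  rewrite exprS -mulrA; move: (t ^+ n * g zero) => z h1 h2.
  have -> : (t - 1) * p = (t * z - p) - t * (z - p) by ring.
  apply: (le_trans (ler_normB _ _)); rewrite normrM (gtr0_norm t0).
  have -> : eta = eta / (t + 1) + t * (eta / (t + 1)).
    by field; rewrite gt_eqF// addr_gt0.
  by rewrite lerD// ler_wpM2l// ltW.
exists p => // c.
have gp : g c = p.
  apply/eqP; rewrite -subr_eq0; apply/eqP.
  apply/normr0_eq0/le_anti; rewrite normr_ge0 andbT.
  apply/ler_addgt0Pr => eta /pP[n nP]; rewrite add0r.
  by have := nP n c (leqnn _); rewrite t1 expr1n mul1r.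
by rewrite -gp /g divfK// gt_eqF.
Qed.

End Ergodic.

(** * Existence of a tile length function *)

Section PowerSeries.
Variable R : realType.
Implicit Types (u v : nat -> R) (x y B : R).

Definition psum x u : R := limn (series (fun n => u n * x ^+ n)).
Definition bounded_by B u := forall n, 0 <= u n <= B.

Lemma bounded_shift B u : bounded_by B u -> bounded_by B (fun n => u n.+1).
Proof. by move=> h n. Qed.

Section fixed_point.
Variables (x B : R).
Hypothesis x01 : 0 <= x < 1.

Let x0 : 0 <= x. Proof. by case/andP: x01. Qed.
Let normx : `|x| < 1. Proof. by rewrite ger0_norm//; case/andP: x01. Qed.
Let subx : 0 < 1 - x. Proof. by rewrite subr_gt0; case/andP: x01. Qed.

Lemma psum_cvg u : bounded_by B u -> cvgn (series (fun n => u n * x ^+ n)).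
Proof.
move=> uB; apply: (@series_le_cvg _ _ (geometric B x)).
- by move=> n; rewrite mulr_ge0 ?exprn_ge0//; case/andP: (uB n).
- move=> n; rewrite /geometric /= mulr_ge0 ?exprn_ge0//.
  by case/andP: (uB 0%N); exact: le_trans.
- by move=> n; rewrite /geometric /= ler_wpM2r ?exprn_ge0//; case/andP: (uB n).
- exact: is_cvg_geometric_series.
Qed.

Lemma psum_cst : psum x (fun=> B) = B / (1 - x).
Proof. by apply/cvg_lim => //; exact: cvg_geometric_series. Qed.

Lemma psum_split u : bounded_by B u -> psum x u = u 0%N + x * psum x (fun n => u n.+1).
Proof.
move=> uB; apply/cvg_lim => //; rewrite -cvg_shiftS.
have -> : [sequence series (fun n => u n * x ^+ n) n.+1]_n =
    (fun n => u 0%N + x * series (fun n => u n.+1 * x ^+ n) n).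
  apply/funext => n; rewrite /series /= big_nat_recl//= expr0 mulr1; congr (_ + _).
  by rewrite mulr_sumr; apply: eq_bigr => i _; rewrite exprS mulrCA.
apply: cvgD; first exact: cvg_cst.
apply: cvgMr; exact/psum_cvg/bounded_shift.
Qed.

Lemma psum_mono u v : bounded_by B u -> bounded_by B v ->
  (forall n, u n <= v n) -> psum x u <= psum x v.
Proof.
move=> uB vB uv; apply: lim_series_le; [exact: psum_cvg|exact: psum_cvg|].
by move=> n; rewrite ler_wpM2r ?exprn_ge0.
Qed.

Let B0 u : bounded_by B u -> 0 <= B.
Proof. by move=> /(_ 0%N)/andP[]; exact: le_trans. Qed.

Lemma psum_le u : bounded_by B u -> psum x u <= B / (1 - x).
Proof.
move=> uB; rewrite -psum_cst; apply: psum_mono => // n.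
  by rewrite (B0 uB) lexx.
by case/andP: (uB n).
Qed.

Lemma psum_0 : psum x (fun=> 0) = 0.
Proof.
apply/cvg_lim => //; rewrite (_ : series _ = fun=> 0); first exact: cvg_cst.
by apply/funext => n; rewrite /series /= big1// => i _; rewrite mul0r.
Qed.

Lemma psum_ge0 u : bounded_by B u -> 0 <= psum x u.
Proof.
move=> uB; rewrite -psum_0; apply: psum_mono => // n.
  by rewrite lexx (B0 uB).
by case/andP: (uB n).
Qed.

(** Complementary coefficients turn upper estimates into lower ones. *)
Lemma psum_compl u : bounded_by B u -> psum x (fun n => B - u n) = B / (1 - x) - psum x u.
Proof.
move=> uB; rewrite -psum_cst /psum -lim_seriesB.
- congr (limn (series _)); apply/funext => n.
  by rewrite mulrBl.
- by apply: psum_cvg => n; rewrite lexx (B0 uB).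
- exact: psum_cvg.
Qed.

Lemma psum_term u n : bounded_by B u -> u n * x ^+ n <= psum x u.
Proof.
elim: n u => [|n IH] u uB; rewrite (psum_split uB).
  by rewrite expr0 mulr1 lerDl mulr_ge0//; exact/psum_ge0/bounded_shift.
rewrite exprS mulrCA; apply: (@le_trans _ _ (x * psum x (fun n => u n.+1))).
  by rewrite ler_wpM2l//; apply: (IH (fun n => u n.+1)).
by rewrite lerDr; case/andP: (uB 0%N).
Qed.

Lemma psum_close u v n : bounded_by B u -> bounded_by B v ->
  (forall i, (i < n)%N -> u i = v i) -> `|psum x u - psum x v| <= x ^+ n * (B / (1 - x)).
Proof.
elim: n u v => [|n IH] u v uB vB uv.
  rewrite expr0 mul1r ler_norml.
  have := psum_ge0 uB; have := psum_ge0 vB; have := psum_le uB; have := psum_le vB.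
  by move=> *; apply/andP; split; lra.
rewrite (psum_split uB) (psum_split vB) (uv 0%N)// opprD addrACA subrr add0r.
rewrite -mulrBr normrM (ger0_norm x0) exprS -mulrA ler_wpM2l//.
by apply: IH => // i ni; exact: uv.
Qed.

End fixed_point.

Lemma psum_mono_x x y B u : 0 <= x -> x <= y -> y < 1 -> bounded_by B u ->
  psum x u <= psum y u.
Proof.
move=> x0 xy y1 uB; apply: lim_series_le.
- by apply: (psum_cvg (B := B)) => //; rewrite x0 (le_lt_trans xy).
- by apply: (psum_cvg (B := B)) => //; rewrite y1 (le_trans x0).
- move=> n; rewrite ler_wpM2l//; first by case/andP: (uB n).
  by rewrite lerXn2r// nnegrE// (le_trans x0).
Qed.

(** Both u and B - u have nonnegative coefficients, so both series increase;
hence the increment of the first is at most that of their sum B/(1-x). *)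
Lemma psum_diff_x x y B u : 0 <= x -> x <= y -> y < 1 -> bounded_by B u ->
  `|psum y u - psum x u| <= `|B / (1 - y) - B / (1 - x)|.
Proof.
move=> x0 xy y1 uB.
have h1 := psum_mono_x x0 xy y1 uB.
have uB' : bounded_by B (fun n => B - u n).
  by move=> n; have /andP[] := uB n; rewrite subr_ge0 lerBlDr lerDl => -> ->.
have h2 := psum_mono_x x0 xy y1 uB'.
have hx : 0 <= x < 1 by rewrite x0 (le_lt_trans xy).
have hy : 0 <= y < 1 by rewrite y1 (le_trans x0).
rewrite !(psum_compl _ uB)// in h2.
rewrite ger0_norm ?subr_ge0//.
apply: le_trans (ler_norm _); lra.
Qed.

Lemma psum_continuous B u x : 0 < x < 1 -> bounded_by B u ->
  {for x, continuous (psum^~ u)}.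
Proof.
move=> /andP[x0 x1] uB.
have hc : {for x, continuous (fun y => B / (1 - y))}.
  apply: cvgM; first exact: cvg_cst.
  apply: cvgV; first by rewrite gt_eqF// subr_gt0.
  by apply: cvgB; [exact: cvg_cst|exact: cvg_id].
apply/cvgrPdist_le => eta eta0.
move/cvgrPdist_le : hc => /(_ _ eta0) hc.
near=> y.
have hy : `|B / (1 - x) - B / (1 - y)| <= eta by near: y.
have y0 : 0 < y by near: y; exact: lt_nbhsr.
have y1 : y < 1 by near: y; exact: lt_nbhsl.
apply: le_trans hy; case: (leP x y) => xy.
  by rewrite distrC [leRHS]distrC; apply: psum_diff_x => //; exact: ltW.
by apply: psum_diff_x => //; exact: ltW.
Unshelve. all: by end_near. Qed.

Lemma bernoulli_ge (h : R) n : 0 <= h <= 1 -> 1 - h *+ n <= (1 - h) ^+ n.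
Proof.
move=> /andP[h0 h1]; elim: n => [|n IH]; first by rewrite expr0 mulr0n subr0.
have : (1 - h) * (1 - h *+ n) <= (1 - h) ^+ n.+1.
  by rewrite exprS ler_wpM2l// subr_ge0.
apply: le_trans; rewrite mulrSr.
have : 0 <= h * (h *+ n) by rewrite mulr_ge0// mulrn_wge0.
lra.
Qed.

End PowerSeries.

Section TileLength.
Variables (R : realType) (a : nat -> nat) (N : nat).
Local Notation L := (letter a N).
Local Notation zero := (fin_letter a N 0).
Hypothesis a_le_N : forall i, (a i <= N)%N.
Hypothesis a0_neq0 : a 0%N <> 0%N.
Hypothesis a_gaps : bounded_gaps a.

Let Rn := N.+1%:R : R.
Let Rn0 : 0 < Rn. Proof. by rewrite ltr0n. Qed.
Let aR n := (a n)%:R : R.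
Let aRB : bounded_by Rn aR.
Proof. by move=> n; rewrite ler0n ler_nat leqW. Qed.

(** The function x * psum x a is at most 1 near 0, and it is at least 1 near 1
because a_0 and one of the next C+1 terms are at least 1. *)
Lemma length_root_exists : exists2 x : R, 0 < x < 1 & x * psum x aR = 1.
Proof.
have [C [_ aC]] := a_gaps.
have [j jC aj] : exists2 j, (j <= C)%N & a j.+1 <> 0%N.
  apply: contrapT => h; have : (C < C)%N; last by rewrite ltnn.
  by apply: (aC 1%N C) => j jC; apply: contrapT => aj; apply: h; exists j.
(* With entries at most N+1 the series at e is at most (N+1)/(1-e), which is 1/e.
   The upper point Y is so close to 1 that Y^(C+2) is at least 1/2. *)
pose e : R := N.+2%:R^-1; pose h : R := (2 * C.+2%:R)^-1; pose Y := 1 - h.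
have e0 : 0 < e by rewrite invr_gt0.
have h0 : 0 < h by rewrite invr_gt0 mulr_gt0.
have h2 : h *+ C.+2 = 2^-1.
  have -> : h *+ C.+2 = h * C.+2%:R by rewrite mulr_natr.
  by rewrite /h invfM; apply: divfK; rewrite pnatr_eq0.
have h12 : h <= 4^-1.
  rewrite lef_pV2 ?posrE ?mulr_gt0//.
  rewrite (_ : 4 = 2 * 2 :> R); last by ring.
  by rewrite ler_wpM2l// ler_nat.
have e12 : e <= 2^-1 by rewrite lef_pV2 ?posrE// ler_nat.
have Y1 : Y < 1 by rewrite /Y; lra.
have eY : e <= Y by rewrite /Y; lra.
have fe : e * psum e aR <= 1.
  have e1 : 0 <= e < 1 by rewrite ltW//=; lra.
  apply: (@le_trans _ _ (e * (Rn / (1 - e)))).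
    by rewrite ler_wpM2l// ?psum_le// ltW.
  have -> : 1 - e = Rn * e.
    by rewrite /e /Rn -[N.+1%:R](addrK 1) natr1 mulrBl mul1r mulfV// pnatr_eq0.
  have -> : e * (Rn / (Rn * e)) = 1 by field; rewrite !gt_eqF.
  by [].
have fY : 1 <= Y * psum Y aR.
  have Y01 : 0 <= Y < 1 by rewrite Y1 andbT; lra.
  have Y0 : 0 <= Y by case/andP: Y01.
  have ge1 m : a m <> 0%N -> 1 <= aR m by move=> /eqP; rewrite -lt0n ler1n.
  rewrite (psum_split Y01 aRB).
  have t1 := psum_term Y01 j (bounded_shift aRB).
  have t2 : Y ^+ j <= psum Y (fun n => aR n.+1).
    by apply: le_trans t1; rewrite ler_peMl ?exprn_ge0// ge1.
  have t3 : Y ^+ C.+2 <= Y * (Y * Y ^+ j).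
    by rewrite -!exprS ler_wiXn2l// ?(ltW Y1)//; lia.
  have t4 : 2^-1 <= Y ^+ C.+2.
    rewrite -[leLHS](_ : 1 - h *+ C.+2 = _); last by rewrite h2; lra.
    apply: bernoulli_ge; rewrite ltW//=; lra.
  rewrite mulrDr; have t5 : Y <= Y * aR 0%N by rewrite ler_peMr// ge1.
  have t6 : Y * (Y * Y ^+ j) <= Y * (Y * psum Y (fun n => aR n.+1)).
    by rewrite !ler_wpM2l.
  have : 2^-1 <= Y by rewrite /Y; lra.
  lra.
have [||x xI fx] := @IVT R (fun x => x * psum x aR) e Y 1 eY.
- apply: continuous_in_subspaceT => x; rewrite inE /= in_itv /= => /andP[ex xY].
  apply: cvgM; first exact: cvg_id.
  apply: (psum_continuous _ aRB).
  by rewrite (lt_le_trans e0 ex) (le_lt_trans xY).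
- by rewrite ge_min fe le_max fY orbT.
exists x => //; move: xI; rewrite in_itv /= => /andP[ex xY].
by rewrite (lt_le_trans e0 ex) (le_lt_trans xY).
Qed.

Section construction.
Variable x : R.
Hypothesis x01 : 0 < x < 1.
Hypothesis xroot : x * psum x aR = 1.
Let x0 : 0 < x. Proof. by case/andP: x01. Qed.
Let x1 : x < 1. Proof. by case/andP: x01. Qed.
Let x01' : 0 <= x < 1. Proof. by rewrite ltW. Qed.

Definition entry (c : L) (k : int) : R :=
  if val c k is Some m then (nat_of_ord m)%:R else 0.
(** For the letter [i] this singles out n = i, the distance of the first
symbol * from coordinate -1; for a limit letter it is identically zero. *)
Definition edge (c : L) (n : nat) : R :=
  ((val c (- n.+1%:Z) == None) && (val c (- n%:Z) != None))%:R.

Let rgt (c : L) (n : nat) := entry c n%:Z.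
Let lft (c : L) (n : nat) := entry c (- n.+1%:Z).

Let rB c : bounded_by Rn (rgt c).
Proof.
move=> n; rewrite /rgt /entry; case: (val c _) => [m|]; last by rewrite lexx ltW.
by rewrite ler0n ler_nat ltnW.
Qed.
Let lB c : bounded_by Rn (lft c).
Proof.
move=> n; rewrite /lft /entry; case: (val c _) => [m|]; last by rewrite lexx ltW.
by rewrite ler0n ler_nat ltnW.
Qed.
Let eB c : bounded_by Rn (edge c).
Proof. by move=> n; rewrite /edge ler0n ler_nat /=; case: (_ && _). Qed.

(** The sum over k of x^|k| times the entry at k. The function x^|k| is the
Green function of the operator l(sigma b) + l(sigma^-1 b) - (x + 1/x) l(b), and
the first symbol * to the left of a_0 counts as -1 so that the analogous sum
for the missing neighbour sigma^-1([0]) vanishes. *)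
Definition tile_len (c : L) : R :=
  psum x (rgt c) + x * psum x (lft c) - x * psum x (edge c).

Lemma val_succ (c : L) k : val (letter_succ c) k = val c (k + 1).
Proof. by []. Qed.

Lemma entry_succ c k : entry (letter_succ c) k = entry c (k + 1).
Proof. by []. Qed.

Lemma psum_rgt c : psum x (rgt c) = entry c 0 + x * psum x (rgt (letter_succ c)).
Proof.
rewrite (psum_split x01' (rB c)); congr (_ + _ * psum _ _).
by apply/funext => n; rewrite /rgt entry_succ -PoszD addn1.
Qed.

Lemma psum_lft c : psum x (lft (letter_succ c)) = entry c 0 + x * psum x (lft c).
Proof.
rewrite (psum_split x01' (lB _)); congr (_ + _ * psum _ _).
  by apply/funext => n; rewrite /lft entry_succ (_ : - n.+2%:Z + 1 = - n.+1%:Z)//; lia.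
Qed.

Lemma psum_edge c : psum x (edge (letter_succ c)) = x * psum x (edge c).
Proof.
rewrite (psum_split x01' (eB _)).
have -> : edge (letter_succ c) 0 = 0.
  rewrite /edge !val_succ (_ : - 1%:Z + 1 = 0%:Z)//.
  by have [k ->] := letter_Some c 0.
rewrite add0r; congr (_ * psum _ _); apply/funext => n.
have e1 : - n.+2%:Z + 1 = - n.+1%:Z by lia.
have e2 : - n.+1%:Z + 1 = - n%:Z by lia.
by rewrite /edge !val_succ e1 e2.
Qed.

Lemma zero_left (n : nat) : val zero (- n.+1%:Z) = None.
Proof. by []. Qed.

Lemma entry_fin i : entry (fin_letter a N 0) i%:Z = aR i.
Proof.
rewrite /entry /aR.
have -> : val zero i%:Z = Some (inord (a i)).
  by rewrite /= /iota_seq /shift addr0.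
by rewrite inordK// ltnS.
Qed.

Lemma tile_len0 : tile_len zero = x^-1 - x.
Proof.
rewrite /tile_len.
have -> : rgt zero = aR by apply/funext => n; rewrite /rgt entry_fin.
have -> : lft zero = fun=> 0 by apply/funext => n; rewrite /lft /entry zero_left.
rewrite psum_0 mulr0 addr0 (psum_split x01' (eB _)).
have -> : edge zero 0 = 1 by [].
have -> : (fun n => edge zero n.+1) = fun=> 0.
  by apply/funext => n; rewrite /edge !zero_left.
have -> : psum x aR = x^-1 by apply: (mulfI (lt0r_neq0 x0)); rewrite xroot divff// lt0r_neq0.
by rewrite psum_0 mulr0 addr0 mulr1.
Qed.

Lemma entry0E (c : L) : (entry0 c)%:R = entry c 0.
Proof. by rewrite /entry0 /entry; case: (val c 0). Qed.

(** The recursions [psum_rgt], [psum_lft] and [psum_edge] express the lengths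
of c and of its two neighbours by the same three sums; the defect at
coordinate 0 is (1/x - x) times the entry, that is, the entry times the
length of [0]. *)
Lemma tile_len_eigen c : \sum_(b <- rho c) tile_len b = (x + x^-1) * tile_len c.
Proof.
have x_neq0 : x != 0 by rewrite lt0r_neq0.
have rsucc d : psum x (rgt (letter_succ d)) = (psum x (rgt d) - entry d 0) / x.
  by rewrite (psum_rgt d); field.
have snseq (m : nat) : \sum_(b <- nseq m zero) tile_len b = m%:R * tile_len zero.
  by rewrite big_nseq iter_addr addr0 mulr_natl.
have hs d : tile_len (letter_succ d) = (psum x (rgt d) - entry d 0) / x
     + x * (entry d 0 + x * psum x (lft d)) - x * (x * psum x (edge d)).
  by rewrite {1}/tile_len rsucc psum_lft psum_edge.
case: (letter_cases c) => [->|[d ->]].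
  rewrite rho_zero// big_cat /= snseq big_seq1 entry0E.
  have := tile_len0; rewrite hs /tile_len.
  have -> : lft zero = fun=> 0 by apply/funext => n; rewrite /lft /entry zero_left.
  rewrite psum_0 => e.
  have r0 : psum x (rgt zero) = x^-1.
    have -> : rgt zero = aR by apply/funext => n; rewrite /rgt entry_fin.
    by apply: (mulfI x_neq0); rewrite xroot divff.
  have e1 : psum x (edge zero) = 1.
    by apply: (mulfI x_neq0); move: e; rewrite r0; lra.
  by rewrite r0 e1; field.
rewrite rho_succ// big_cat /= snseq entry0E !big_cons big_nil addr0 tile_len0 hs.
rewrite /tile_len (psum_rgt d) psum_lft psum_edge.
by field.
Qed.

(** Where the edge term is 1, the entry is a_0 > 0: it dominates the weight -1
placed to its left. *)
Lemma edge_le c n : edge c n <= entry c (- n%:Z).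
Proof.
rewrite /edge; case: eqP => [e1|_]; last first.
  by rewrite /= /entry; case: (val c _).
case: eqP => [_|e2] /=; first by rewrite /entry; case: (val c _).
have [i ci] := fin_letter_dense n.+1 c.
rewrite (ci (- n.+1%:Z)) ?(ci (- n%:Z)) in e1 e2; [|lia..].
have : i = n.
  move: e1 e2; rewrite /= /iota_seq /shift.
  case E1 : (- n.+1%:Z + i%:Z) => [m|m] //= _.
  case E2 : (- n%:Z + i%:Z) => [m'|m'] //= _.
  lia.
move=> ein; rewrite {}ein in ci.
have := entry_fin 0; rewrite /entry ci; last by lia.
have -> : val (fin_letter a N n) (- n%:Z) = val zero 0%:Z.
  by rewrite /= /iota_seq /shift addNr.
by move=> ->; rewrite ler1n lt0n; apply/eqP.
Qed.

(** The negative edge term is compensated by the entry a_0 next to it, except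
for the letter [0], where it is at most x < 1 <= a_0. What is left is positive
since some entry at a nonnegative coordinate does not vanish. *)
Lemma tile_len_gt0 c : 0 < tile_len c.
Proof.
have h1 : psum x (edge c) <= edge c 0 + x * psum x (lft c).
  rewrite (psum_split x01' (eB c)) lerD2l ler_wpM2l ?(ltW x0)//.
  apply: (psum_mono x01' (B := Rn)) => //.
    exact/bounded_shift.
  by move=> n; exact: edge_le.
have l0 := psum_ge0 x01' (lB c).
have h2 : psum x (rgt c) - x * edge c 0 <= tile_len c.
  rewrite /tile_len -addrA lerD2l.
  have : x * psum x (edge c) <= x * edge c 0 + x * (x * psum x (lft c)).
    by rewrite -mulrDr ler_wpM2l// ltW.
  have : x * (x * psum x (lft c)) <= x * psum x (lft c).
    by rewrite ler_piMl ?(mulr_ge0 (ltW x0))// ltW.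
  lra.
apply: lt_le_trans h2.
have [e1|e0] : edge c 0 = 1 \/ edge c 0 = 0.
    by rewrite /edge; case: (_ && _); [left|right].
  rewrite e1 mulr1 subr_gt0; apply: lt_le_trans x1 _.
  have := edge_le c 0; rewrite e1 oppr0 => h.
  apply: (le_trans h); rewrite psum_rgt lerDl mulr_ge0 ?(ltW x0)//.
  exact: psum_ge0.
rewrite e0 mulr0 subr0.
have [C [_ aC]] := a_gaps; have [j _] := entry_gap a_le_N aC c.
move=> ej; apply: lt_le_trans (psum_term x01' j (rB c)).
rewrite mulr_gt0 ?exprn_gt0//.
have -> : rgt c j = (entry0 (iter j (@letter_succ a N) c))%:R.
  rewrite entry0E /rgt; elim: j c {ej h1 l0 e0} => [|j IH] c //.
  by rewrite iterSr -IH entry_succ -PoszD addn1.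
by rewrite ltr0n.
Qed.

Lemma tile_len_close n c d : agree n c d ->
  `|tile_len c - tile_len d| <= x ^+ n * (3 * (Rn / (1 - x))).
Proof.
move=> cd.
have ec (k : int) : (`|k| <= n)%N -> entry c k = entry d k.
  by move=> kn; rewrite /entry cd.
have h1 : `|psum x (rgt c) - psum x (rgt d)| <= x ^+ n * (Rn / (1 - x)).
  by apply: (psum_close x01') => // i ni; apply: ec; rewrite absz_nat ltnW.
have h2 : `|psum x (lft c) - psum x (lft d)| <= x ^+ n * (Rn / (1 - x)).
  by apply: (psum_close x01') => // i ni; apply: ec; lia.
have h3 : `|psum x (edge c) - psum x (edge d)| <= x ^+ n * (Rn / (1 - x)).
  apply: (psum_close x01') => // i ni; rewrite /edge !cd//; lia.
have A (z t : R) : `|z| <= t -> `|x * z| <= t.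
  move=> zt; apply: le_trans zt; rewrite normrM ger0_norm; last exact: ltW.
  by rewrite ler_piMl// ltW.
move/A in h2; move/A in h3.
move: h1 h2 h3; rewrite !ler_norml /tile_len.
move=> /andP[? ?] /andP[? ?] /andP[? ?]; apply/andP; split; lra.
Qed.

Lemma tile_len_continuous : continuous tile_len.
Proof.
move=> c; have FF : Filter (nbhs c) := nbhs_filter c.
apply/cvgrPdist_le => eta eta0.
have D0 : 0 < 3 * (Rn / (1 - x)) by rewrite mulr_gt0// divr_gt0// subr_gt0.
have [n nP] := geom_small x01' (divr_gt0 eta0 D0).
apply/letter_nbhsP; exists n => d cd /=.
by apply: (le_trans (tile_len_close cd)); rewrite -ler_pdivlMr.
Qed.

Lemma tile_len_is_tile_length : is_tile_length tile_len.
Proof.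
split; [exact: tile_len_continuous|exact: tile_len_gt0|].
exists (x + x^-1); last exact: tile_len_eigen.
by rewrite ltr_pwDl// invf_ge1// ltW.
Qed.

End construction.

Theorem tile_length_exists : exists l : L -> R, is_tile_length l.
Proof.
by have [x x01 xr] := length_root_exists; exists (tile_len x); exact: tile_len_is_tile_length.
Qed.

End TileLength.

(** * Invariant measures and uniform averages *)

(** Carries the proofs of the axioms as arguments, so that the measure structure
on it is found by unification. *)
Definition as_measure d (T : semiRingOfSetsType d) (R : realType)
  (m : set T -> \bar R) (m0 : m set0 = 0%E) (mge0 : forall A, (0 <= m A)%E)
  (madd : semi_sigma_additive m) : set T -> \bar R := m.

HB.instance Definition _ d (T : semiRingOfSetsType d) (R : realType)
  (m : set T -> \bar R) (m0 : m set0 = 0%E) (mge0 : forall A, (0 <= m A)%E)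
  (madd : semi_sigma_additive m) :=
  isMeasure.Build d T R (@as_measure d T R m m0 mge0 madd) m0 mge0 madd.

Lemma borel_preimage (T : topologicalType) (x0 : T) (f : T -> T) (A : set (borel x0)) :
  continuous f -> measurable A -> measurable (f @^-1` A : set (borel x0)).
Proof.
move=> cf; rewrite /measurable /= => mA.
suff : <<s @open (pointed_at x0) >> `<=`
    [set B | <<s @open (pointed_at x0) >> (f @^-1` B)] by apply.
apply: smallest_sub; first split => /=.
- by rewrite preimage_set0; exact: sigma_algebra0.
- by move=> B mB; rewrite setTD preimage_setC; exact: sigma_algebraC.
- by move=> F mF; rewrite preimage_bigcup; exact: sigma_algebra_bigcup.
- move=> B oB; apply: sub_sigma_algebra.
  by move/continuousP : cf; apply.
Qed.

Section averaging.
Variables (G : Type) (T : topologicalType) (act : G -> T -> T) (R : realType).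
Variables (x0 : T) (mu : probability (borel x0) R).
Hypothesis mu_inv : invariant_measure act mu.
Hypothesis act_cont : forall g, continuous (act g).

(** The integral of the orbit average of the indicator of A is the mass of A by
invariance, and it is within eta of p by uniformity. *)
Lemma invariant_average (A : set (borel x0)) (p : R) : measurable A ->
  (forall eta, 0 < eta -> exists2 gs : seq G, (0 < size gs)%N & forall x,
     `|\sum_(g <- gs) \1_A (act g x : borel x0) - p * (size gs)%:R|
       <= eta * (size gs)%:R) ->
  mu A = p%:E.
Proof.
move=> mA avg.
have muA_fin : mu A \is a fin_num by exact: fin_num_measure.
rewrite -(fineK muA_fin); congr (_%:E); set v := fine (mu A).
apply/eqP; rewrite -subr_eq0; apply/eqP/normr0_eq0/le_anti; rewrite normr_ge0 andbT.
apply/ler_addgt0Pr => eta /avg[gs gs0 gsP]; rewrite add0r.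
set s : R := (size gs)%:R in gsP.
have s0 : 0 < s by rewrite ltr0n.
pose f (x : borel x0) : R := \sum_(g <- gs) \1_A (act g x : borel x0).
have mact g : measurable (act g @^-1` A : set (borel x0)).
  by apply: borel_preimage.
have f0 x : 0 <= f x by apply: sumr_ge0 => g _; rewrite indicE.
pose ind g (x : borel x0) : \bar R := (\1_(act g @^-1` A : set (borel x0)) x)%:E.
have intf : (\int[mu]_x (f x)%:E = (s * v)%:E)%E.
  rewrite (_ : (fun x => (f x)%:E) = fun x => (\sum_(g <- gs) ind g x)%E); last first.
    by apply/funext => x; rewrite /f -sumEFin; apply: eq_bigr => g _; rewrite /ind !indicE.
  have mi g : measurable_fun setT (ind g).
    by apply/measurable_EFinP; exact: measurable_indic.
  have i0 g x : setT x -> (0 <= ind g x)%E.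
    by move=> _; rewrite lee_fin indicE.
  rewrite (ge0_integral_sum mu measurableT mi i0).
  rewrite (eq_bigr (fun=> v%:E)) => [|g _].
    by rewrite sumEFin big_const_seq count_predT iter_addr addr0 mulr_natl.
  by rewrite integral_indic// setIT /v fineK//; exact: mu_inv.
have mf : measurable_fun setT (fun x : borel x0 => (f x)%:E).
  apply/measurable_EFinP; apply: measurable_sum => g.
  rewrite (_ : (fun x => _) = \1_(act g @^-1` A : set (borel x0))).
    exact: measurable_indic.
  by apply/funext => x; rewrite !indicE.
have fP x : (p - eta) * s <= f x <= (p + eta) * s.
  have := gsP x; rewrite ler_norml -/(f x) !mulrBl !mulrDl => /andP[h1 h2].
  by apply/andP; split; lra.
have up : s * v <= (p + eta) * s.
  rewrite -lee_fin -intf -[leRHS]mule1 -(@probability_setT _ _ _ mu).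
  rewrite -integral_cst//; apply: ge0_le_integral => //.
  - by move=> x _; rewrite lee_fin.
  - by move=> x _; rewrite lee_fin; have /andP[h1 h2] := fP x.
have lo : (p - eta) * s <= s * v.
  have [h|h] := leP (p - eta) 0.
    apply: (@le_trans _ _ 0); first by rewrite pmulr_lle0.
    by rewrite mulr_ge0 ?fine_ge0// ltW.
  rewrite -lee_fin -intf -[leLHS]mule1 -(@probability_setT _ _ _ mu).
  rewrite -integral_cst//; apply: ge0_le_integral => //.
  - by move=> x _; rewrite lee_fin mulr_ge0// ltW.
  - by move=> x _; rewrite lee_fin; have /andP[h1 h2] := fP x.
move: up lo; rewrite [s * v]mulrC !ler_pM2r// => up lo.
by rewrite ler_norml; apply/andP; split; lra.
Qed.

End averaging.

(** * Cylinders and their frequencies of visits *)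

Section Cylinders.
Variables (a : nat -> nat) (N : nat).
Local Notation L := (letter a N).
Local Notation X := (subshift a N).
Implicit Types U V : set X.

Definition cyl_at n U := forall x y : X, agree_seq n (val x) (val y) -> U x -> U y.

(** By compactness these are exactly the clopen sets. *)
Definition cylinder : set (set X) := [set U | exists n, cyl_at n U].

Lemma cylinder0 : cylinder set0. Proof. by exists 0%N. Qed.
Lemma cylinderT : cylinder setT. Proof. by exists 0%N. Qed.

Lemma cylinderC U : cylinder U -> cylinder (~` U).
Proof. by move=> [n h]; exists n => x y xy nUx Uy; apply: nUx; apply: h Uy; exact: agree_seqC. Qed.

Lemma cylinderI : setI_closed cylinder.
Proof.
move=> U V [m hU] [n hV]; exists (maxn m n) => x y xy [Ux Vx]; split.
  by apply: hU Ux; apply: agree_seqW xy; rewrite leq_maxl.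
by apply: hV Vx; apply: agree_seqW xy; rewrite leq_maxr.
Qed.

Lemma cylinderD : setD_closed cylinder.
Proof. by move=> U V hU hV; rewrite setDE; apply: cylinderI => //; exact: cylinderC. Qed.

Lemma cylinderU U V : cylinder U -> cylinder V -> cylinder (U `|` V).
Proof.
move=> hU hV; rewrite -(setCK (U `|` V)) setCU; apply: cylinderC.
by apply: cylinderI; exact: cylinderC.
Qed.

Lemma cylinder_bigsetU (F : nat -> set X) n : (forall i, cylinder (F i)) ->
  cylinder (\big[setU/set0]_(i < n) F i).
Proof.
move=> h; elim: n => [|n IH]; first by rewrite big_ord0; exact: cylinder0.
by rewrite big_ord_recr; exact: cylinderU.
Qed.

Lemma agree_seq_shift n k (x y : int -> L) :
  agree_seq (n + `|k|) x y -> agree_seq n (shift k x) (shift k y).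
Proof.
move=> xy j jn; rewrite /shift; apply: (@agreeW _ _ _ (n + `|k|)); first exact: leq_addr.
by apply: xy; lia.
Qed.

Lemma subshift_act_continuous k : continuous (@subshift_act a N k).
Proof.
move=> x O /subshift_nbhsP[n nO]; apply/subshift_nbhsP; exists (n + `|k|)%N => y xy.
by apply: nO; exact: agree_seq_shift.
Qed.

Lemma cylinder_preimage k U : cylinder U -> cylinder (subshift_act k @^-1` U).
Proof.
move=> [n h]; exists (n + `|k|)%N => x y xy; apply: h; exact: agree_seq_shift.
Qed.

Lemma cylinder_open U : cylinder U -> open U.
Proof.
move=> [n h]; rewrite openE => x Ux; apply/subshift_nbhsP; exists n => y xy.
exact: h Ux.
Qed.

(** Only countably many relations are needed, so open sets are countable unions
of cylinders. *)
Lemma open_cylinders (O : set X) : open O ->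
  O = \bigcup_n [set x | forall y : X, agree_seq n (val x) (val y) -> O y].
Proof.
move=> oO; apply/seteqP; split=> [x Ox|x [n _ h]]; last by apply: h => j _.
have /subshift_nbhsP[n nO] : nbhs x O by apply: open_nbhs_nbhs.
by exists n.
Qed.

Lemma cylinder_core n (O : set X) :
  cylinder [set x | forall y : X, agree_seq n (val x) (val y) -> O y].
Proof. by exists n => x y xy h z yz; apply: h; apply: agree_seq_trans yz. Qed.

Lemma borel_cylinder : <<s @open X >> = <<s cylinder >>.
Proof.
apply/seteqP; split; apply: smallest_sub.
- exact: smallest_sigma_algebra.
- move=> O oO; rewrite (open_cylinders oO); apply: sigma_algebra_bigcup => n.
  by apply: sub_sigma_algebra; exact: cylinder_core.
- exact: smallest_sigma_algebra.
- by move=> U hU; apply: sub_sigma_algebra; exact: cylinder_open.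
Qed.

(** The members of F together with the complement of their union form an open
cover; disjointness excludes all members with an index beyond the finite
subcover. *)
Lemma cylinder_compact (x0 : X) (F : nat -> set X) :
  (forall i, cylinder (F i)) -> trivIset setT F -> cylinder (\bigcup_n F n) ->
  exists n, forall i, (n <= i)%N -> F i = set0.
Proof.
move=> cF tF cUF.
have : compact [set: pointed_at x0] by exact: (@compact_subshift a N).
rewrite compact_cover => /(_ nat setT (fun i => F i `|` ~` (\bigcup_n F n))).
case.
- move=> i _; apply: (@cylinder_open (F i `|` ~` (\bigcup_n F n))).
  by apply: cylinderU => //; exact: cylinderC.
- move=> x _; have [[i _ Fx]|nFx] := pselect ((\bigcup_n F n) x).
    by exists i => //; left.
  by exists 0%N => //; right.
- move=> D _ cov; exists (\max_(i <- finmap.enum_fset D) i.+1)%N => i iD.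
  apply/seteqP; split => // x Fx.
  have [j /= jD [Fjx|[]]] := cov x I; last by exists i.
  have ij : i = j by apply: tF => //; exists x.
  have : (j < i)%N by apply: leq_trans iD; exact: (@leq_bigmax_seq _ _ xpredT succn j jD isT).
  by rewrite ij ltnn.
Qed.

End Cylinders.

Section Visits.
Variables (R : realType) (a : nat -> nat) (N : nat).
Local Notation L := (letter a N).
Local Notation X := (subshift a N).
Hypothesis a_le_N : forall i, (a i <= N)%N.
Hypothesis a0_neq0 : a 0%N <> 0%N.
Hypothesis a_gaps : bounded_gaps a.

Definition visits (U : set X) (x : X) (m : int) (n : nat) : R :=
  \sum_(i < n) \1_U (subshift_act (m + i%:Z) x).

Definition length_sum (l : L -> R) (x : int -> L) (m : int) (n : nat) : R :=
  \sum_(i < n) l (x (m + i%:Z)).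

(** Moving a summation window by one place exchanges one term. *)
Lemma shift_sum_le (f : int -> R) (m : int) (n k : nat) :
  (forall i, 0 <= f i <= 1) ->
  `|\sum_(i < n) f (m + k%:Z + i%:Z) - \sum_(i < n) f (m + i%:Z)| <= k%:R.
Proof.
move=> f01; elim: k => [|k IH].
  by rewrite (eq_bigr (fun i : 'I_n => f (m + i%:Z))) ?subrr ?normr0// => i _; rewrite addr0.
have e : f (m + k%:Z) + \sum_(i < n) f (m + k.+1%:Z + i%:Z) =
    \sum_(i < n) f (m + k%:Z + i%:Z) + f (m + k%:Z + n%:Z).
  transitivity (\sum_(i < n.+1) f (m + k%:Z + i%:Z)); last by rewrite big_ord_recr.
  rewrite big_ord_recl /= addr0; congr (_ + _); apply: eq_bigr => i _.
  by congr f; rewrite /bump /=; lia.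
rewrite -natr1; have /andP[h1 h2] := f01 (m + k%:Z).
have /andP[h3 h4] := f01 (m + k%:Z + n%:Z).
move: IH; rewrite !ler_norml => /andP[h5 h6]; apply/andP; split; lra.
Qed.

Section cylinder_count.
Variables (U : set X) (n : nat).
Hypothesis cU : cyl_at n U.

(** The indicator of U read off from the central window of a point, extended to
all words by approximation so that it also applies to legal words. *)
Definition word_in (w : seq L) : R :=
  (`[< exists x : X, U x /\ agree_word n (window (val x) (- n%:Z) n.*2.+1) w >])%:R.

Lemma word_in01 w : 0 <= word_in w <= 1.
Proof. by rewrite /word_in; case: asbool; rewrite /= ?lexx ?ler01. Qed.

Lemma word_in_agree w w' : agree_word n w w' -> word_in w = word_in w'.
Proof.
move=> ww'; rewrite /word_in; congr ((nat_of_bool _)%:R); apply/asboolP/asboolP.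
  by move=> [x [Ux xw]]; exists x; split => //; exact: agree_word_trans ww'.
by move=> [x [Ux xw]]; exists x; split => //; apply: agree_word_trans xw (agree_wordC ww').
Qed.

Lemma word_in_window (x : X) m :
  word_in (window (val x) m n.*2.+1) = \1_U (subshift_act (m + n%:Z) x).
Proof.
have e : window (val (subshift_act (m + n%:Z) x)) (- n%:Z) n.*2.+1 =
    window (val x) m n.*2.+1.
  by apply: eq_map => i /=; rewrite /shift; congr (val x _); lia.
rewrite /word_in indicE; congr ((nat_of_bool _)%:R); apply/asboolP/idP.
  move=> [y [Uy yw]]; rewrite inE; apply: cU Uy; apply/agree_seq_window.
  by rewrite e.
rewrite inE => Ux; exists (subshift_act (m + n%:Z) x); split => //.
by rewrite e; exact: agree_wordxx.
Qed.

Lemma window_cons (x : int -> L) m k : window x m k.+1 = x m :: window x (m + 1) k.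
Proof.
rewrite /window /= addr0; congr (_ :: _); rewrite -[1%N]addn0 iotaDl -map_comp.
by apply: eq_map => i /=; congr x; lia.
Qed.

Lemma take_window (x : int -> L) m k j : (j <= k)%N -> take j (window x m k) = window x m j.
Proof. by move=> jk; rewrite /window -map_take take_iota (minn_idPl jk). Qed.

Lemma count_sum_cons (F : seq L -> R) r c w :
  count_sum F r (c :: w) = F (take r (c :: w)) + count_sum F r w.
Proof. by []. Qed.

(** Away from the right end, the factors of a window of x correspond to the
visits of its shifts to U; the shift by n centres them. *)
Lemma count_window (x : X) m k :
  `|count_sum word_in n.*2.+1 (window (val x) m k) - visits U x (m + n%:Z) k|
    <= (minn n.*2.+1 k)%:R.
Proof.
rewrite /visits; elim: k m => [|k IH] m; first by rewrite big_ord0 /= subrr normr0.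
rewrite window_cons count_sum_cons -window_cons big_ord_recl.
rewrite [m + n%:Z + _]addr0.
have -> : \sum_(i < k) \1_U (subshift_act (m + n%:Z + (lift ord0 i)%:Z) x) =
          \sum_(i < k) \1_U (subshift_act (m + 1 + n%:Z + i%:Z) x) :> R.
  by apply: eq_bigr => i _; congr (\1_U (subshift_act _ x)); rewrite /= /bump /=; lia.
have := IH (m + 1); case: (leqP n.*2.+1 k.+1) => kn {}IH.
  rewrite take_window// word_in_window.
  have -> (A B C : R) : A + B - (A + C) = B - C by ring.
  by apply: (le_trans IH); rewrite ler_nat geq_minl.
have /andP[h1 h2] := word_in01 (take n.*2.+1 (window (val x) m k.+1)).
have h3 : 0 <= \1_U (subshift_act (m + n%:Z) x) :> R by rewrite indicE.
have h4 : \1_U (subshift_act (m + n%:Z) x) <= 1 :> R by rewrite indicE; case: (_ \in _).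
have {}IH : `|count_sum word_in n.*2.+1 (window (val x) (m + 1) k) -
     \sum_(i < k) \1_U (subshift_act (m + 1 + n%:Z + i%:Z) x)| <= k%:R.
  by apply: (le_trans IH); rewrite ler_nat geq_minr.
rewrite -natr1; move: IH; rewrite !ler_norml => /andP[h5 h6].
by apply/andP; split; lra.
Qed.

End cylinder_count.

Lemma count_sum_agree n r (F : seq L -> R) (w w' : seq L) :
  (forall v v', agree_word n v v' -> F v = F v') ->
  agree_word n w w' -> count_sum F r w = count_sum F r w'.
Proof.
move=> hF; elim: w w' => [|x w IH] [|y w'] //= [xy ww']; congr (_ + _).
  apply: hF; exact: (@agree_word_take _ _ n r (x :: w) (y :: w')).
exact: IH.
Qed.

Lemma window_length (l : L -> R) (x : int -> L) m k :
  \sum_(b <- window x m k) l b = length_sum l x m k.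
Proof. by rewrite /window big_map -{1}[k]subn0 big_mkord. Qed.

(** Continuity of l makes the total length of a word of fixed size stable
under approximation. *)
Lemma legal_window_length (l : L -> R) (x : X) (n : nat) m k (eta : R) :
  continuous l -> 0 < eta ->
  exists u, [/\ legal u, agree_word n (window (val x) m k) u &
    `|\sum_(b <- window (val x) m k) l b - \sum_(b <- u) l b| <= eta].
Proof.
move=> cl eta0; set w := window (val x) m k.
pose e := eta / (k%:R + 1).
have e0 : 0 < e by rewrite divr_gt0// ltr_wpDl.
(* Precision K moves the length of each letter by at most e. *)
have loc (v : seq L) : exists K, forall v', agree_word K v v' ->
    `|\sum_(b <- v) l b - \sum_(b <- v') l b| <= e * (size v)%:R.
  elim: v => [|b v [K IH]].
    by exists 0%N => -[|//] _; rewrite !big_nil subrr normr0 mulr0.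
  have FF : Filter (nbhs b) := nbhs_filter b.
  have /cvgrPdist_le/(_ _ e0)/letter_nbhsP[K' K'P] := cl b.
  exists (maxn K K') => -[|b' v'] //= [bb' vv'].
  rewrite !big_cons opprD addrACA -natr1 mulrDr mulr1 addrC.
  apply: (le_trans (ler_normD _ _)); apply: lerD.
    by apply: IH; apply: agree_wordW vv'; rewrite leq_maxl.
  by apply: K'P; apply: agreeW bb'; rewrite leq_maxr.
have [K KP] := loc w.
have [u lu wu] := (subshiftP (val x)).1 (set_mem (valP x)) m k (maxn n K).
exists u; split => //; first by apply: agree_wordW wu; rewrite leq_maxl.
have /KP h : agree_word K w u by apply: agree_wordW wu; rewrite leq_maxr.
apply: (le_trans h); rewrite size_window /e mulrAC ler_pdivrMr ?ltr_wpDl//.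
by rewrite ler_pM2l// lerDl.
Qed.

(** The frequency theorem for legal words, transferred to windows of points of
the subshift, which are limits of legal words. *)
Theorem uniform_visits (l : L -> R) (U : set X) : is_tile_length l -> cylinder U ->
  exists p, forall eta, 0 < eta -> exists n0 : nat, forall (x : X) m k, (n0 <= k)%N ->
    `|visits U x m k - p * length_sum l (val x) m k| <= eta * length_sum l (val x) m k.
Proof.
move=> [cl l0 [lam lam1 el]] [n cU].
have [lmin [lmax [lmin0 lb]]] := tile_length_bounds cl l0.
have [p pP] := uniform_frequency a_le_N a0_neq0 a_gaps lam1 el lmin0 lb n.*2.+1
  (word_in01 U n).
exists p => eta eta0.
have eta2 : 0 < eta / 2 by rewrite divr_gt0.
have [n0 nP] := pP _ eta2.
pose K0 : R := n.*2.+1%:R + n%:R + (`|p| + eta / 2).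
exists (maxn n0 (Num.bound (K0 / (eta / 2 * lmin)))) => x m k kn.
have [u [lu xu xul]] := legal_window_length x n m k cl ltr01.
have su := agree_word_size xu; rewrite size_window in su.
have := nP u lu; rewrite -su => /(_ (leq_trans (leq_maxl _ _) kn)) h1.
have h2 := count_window cU x m k.
have h3 : `|visits U x (m + n%:Z) k - visits U x m k| <= n%:R.
  apply: (@shift_sum_le (fun i => \1_U (subshift_act i x))) => i.
  by rewrite indicE; case: (_ \in _); rewrite /= ?lexx ?ler01.
rewrite window_length in xul.
have h4 : k%:R * lmin <= length_sum l (val x) m k.
  by rewrite -window_length -{1}(size_window (val x) m k); exact: size_le_sum lb _.
have K00 : 0 <= K0 by rewrite !addr_ge0// ltW.
have h5 : K0 <= eta / 2 * length_sum l (val x) m k.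
  apply: le_trans (ler_wpM2l (ltW eta2) h4).
  rewrite mulrA mulrAC -ler_pdivrMl ?mulr_gt0// mulrC.
  apply: ltW; apply: lt_le_trans (archi_boundP _) _; first by rewrite divr_ge0// ltW// mulr_gt0.
  by rewrite ler_nat (leq_trans _ kn)// leq_maxr.
have h6 : count_sum (word_in U n) n.*2.+1 (window (val x) m k) =
          count_sum (word_in U n) n.*2.+1 u.
  by apply: (@count_sum_agree n) => // v v'; exact: word_in_agree.
rewrite h6 in h2; have {}h2 := le_trans h2 (_ : _ <= n.*2.+1%:R).
have {}h2 := h2 _; rewrite ler_nat in h2; have {}h2 := h2 (geq_minl _ _).
have h7 : `|p * (length_sum l (val x) m k - \sum_(b <- u) l b)| <= `|p|.
  by rewrite normrM ler_piMr.
move: h1 h2 h3 h7 xul; rewrite !ler_norml /K0 in h5 *.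
move: (count_sum _ _ _) (visits U x m k) (visits U x (m + n%:Z) k) => A B C.
move: (\sum_(b <- u) l b) (length_sum l (val x) m k) h5 => Su S h5.
move=> /andP[a1 a2] /andP[a3 a4] /andP[a5 a6] /andP[a7 a8] /andP[a9 a10].
have b1 : eta / 2 * Su <= eta / 2 * (S + 1) by rewrite ler_pM2l//; lra.
by apply/andP; split; lra.
Qed.

End Visits.

(** * Unique ergodicity of the subshift *)

(** Existential form of the image measure, in which the measurability proof does
not appear in the type. *)
Lemma push_measure d d' (T : measurableType d) (T' : measurableType d') (R : realType)
  (f : T -> T') (m : {measure set T -> \bar R}) : measurable_fun setT f ->
  exists m' : {measure set T' -> \bar R}, forall A, m' A = m (f @^-1` A).
Proof.
move=> mf; unshelve eexists (pushforward m f); first exact: mf.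
by [].
Qed.

Lemma probability_lty d (T : measurableType d) (R : realType) (mu : probability T R) :
  (mu setT < +oo)%E.
Proof. by rewrite probability_setT ltry. Qed.

Section CylinderSpace.
Variables (a : nat -> nat) (N : nat) (x0 : subshift a N).

(** A copy of the subshift whose measurable sets are the cylinders alone, so
that its structure does not compete with the Borel sets. *)
Definition cylspace : Type := pointed_at x0.
HB.instance Definition _ := Pointed.on cylspace.
HB.instance Definition _ := @isSemiRingOfSets.Build default_measure_display cylspace
  (@cylinder a N) (@cylinder0 a N) (@cylinderI a N)
  (setD_semi_setD_closed (@cylinderD a N)).

End CylinderSpace.

Section Frequency.
Variables (R : realType) (a : nat -> nat) (N : nat).
Local Notation L := (letter a N).
Local Notation X := (subshift a N).
Hypothesis a_le_N : forall i, (a i <= N)%N.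
Hypothesis a0_neq0 : a 0%N <> 0%N.
Hypothesis a_gaps : bounded_gaps a.

(** The uniformity in the point x is what unique ergodicity requires. *)
Definition has_freq (U : set X) (q : R) := forall eta, 0 < eta ->
  exists n0 : nat, forall x k, (n0 <= k)%N ->
    `|visits R U x 0 k - q * k%:R| <= eta * k%:R.

Lemma visits_T (x : X) m k : visits R setT x m k = k%:R.
Proof.
rewrite /visits (eq_bigr (fun=> 1)) => [|i _]; last by rewrite indicT.
by rewrite big_const_ord iter_addr addr0.
Qed.

(** Frequencies per unit length are turned into frequencies per letter by
dividing by the frequency of the whole space, which is positive since tiles
have bounded length. *)
Lemma cylinder_has_freq (U : set X) : cylinder U -> exists q, has_freq U q.
Proof.
move=> cU; have [l hl] := tile_length_exists R a_le_N a0_neq0 a_gaps.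
have [p pP] := uniform_visits a_le_N a0_neq0 a_gaps hl cU.
have [p1 p1P] := uniform_visits a_le_N a0_neq0 a_gaps hl (@cylinderT a N).
have [cl l0 _] := hl.
have [lmin [lmax [lmin0 lb]]] := tile_length_bounds cl l0.
have lmax0 : 0 < lmax.
  have /andP[h h'] := lb (fin_letter a N 0).
  by rewrite (lt_le_trans lmin0)// (le_trans h).
have lsum (x : X) m k : 0 <= length_sum l (val x) m k <= lmax * k%:R.
  apply/andP; split; first by apply: sumr_ge0 => i _; exact: ltW.
  apply: (@le_trans _ _ (\sum_(i < k) lmax)).
    by apply: ler_sum => i _; have /andP[] := lb (val x (m + i%:Z)).
  by rewrite big_const_ord iter_addr addr0 mulr_natr.
have [x0 Xx0] := subshift_nonempty a_le_N a0_neq0.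
pose xx : X := SigSub (mem_set Xx0).
have p1_gt0 : 0 < p1.
  rewrite ltNge; apply/negP => p10.
  have e0 : 0 < (2 * lmax)^-1 by rewrite invr_gt0 mulr_gt0.
  have [n nP] := p1P _ e0; have := nP xx 0 n.+1 (leqnSn _).
  rewrite visits_T; have /andP[] := lsum xx 0 n.+1.
  set S := length_sum _ _ _ _ => S0 S1.
  rewrite ler_norml => /andP[_ h].
  have h1 : (2 * lmax)^-1 * S <= 2^-1 * n.+1%:R.
    by rewrite mulrC ler_pdivrMr ?mulr_gt0//; lra.
  have h2 : 0 <= - p1 * S by rewrite mulr_ge0// oppr_ge0.
  have h3 : 0 < n.+1%:R :> R by rewrite ltr0n.
  lra.
exists (p / p1) => eta eta0.
pose e := eta / (lmax * (1 + `|p / p1|)).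
have c0 : 0 < 1 + `|p / p1| by rewrite ltr_pwDl.
have e0 : 0 < e by rewrite divr_gt0// mulr_gt0.
have [n nP] := pP _ e0; have [n1 n1P] := p1P _ e0.
exists (maxn n n1) => x k kn.
have h1 := nP x 0 k (leq_trans (leq_maxl _ _) kn).
have h2 := n1P x 0 k (leq_trans (leq_maxr _ _) kn).
rewrite visits_T in h2; have /andP[S0 S1] := lsum x 0 k.
move: h1 h2 S0 S1; set S := length_sum _ _ _ _ => h1 h2 S0 S1.
have -> : visits R U x 0 k - p / p1 * k%:R =
    (visits R U x 0 k - p * S) - p / p1 * (k%:R - p1 * S).
  by field; rewrite gt_eqF.
apply: (le_trans (ler_normB _ _)); rewrite normrM.
apply: (@le_trans _ _ (e * S + `|p / p1| * (e * S))).
  by rewrite lerD// ler_wpM2l.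
rewrite (_ : e * S + _ = e * (1 + `|p / p1|) * S); last by ring.
apply: (@le_trans _ _ (e * (1 + `|p / p1|) * (lmax * k%:R))).
  by rewrite ler_wpM2l// mulr_ge0// ltW.
rewrite le_eqVlt; apply/orP; left; apply/eqP; rewrite /e; field.
by rewrite !gt_eqF.
Qed.

Variable x0 : X.

Lemma has_freq_unique U q q' : has_freq U q -> has_freq U q' -> q = q'.
Proof.
move=> h h'; apply/eqP; rewrite -subr_eq0; apply/eqP/normr0_eq0/le_anti.
rewrite normr_ge0 andbT; apply/ler_addgt0Pr => eta eta0; rewrite add0r.
have eta2 : 0 < eta / 2 by rewrite divr_gt0.
have [n nP] := h _ eta2; have [n' n'P] := h' _ eta2.
have := nP x0 (maxn n n').+1 (leqW (leq_maxl _ _)).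
have := n'P x0 (maxn n n').+1 (leqW (leq_maxr _ _)).
set k := (maxn n n').+1; have k0 : 0 < k%:R :> R by rewrite ltr0n.
rewrite !ler_norml => /andP[h1 h2] /andP[h3 h4].
rewrite -(ler_pM2r k0) -(ler_pM2r k0 (q - q')); apply/andP; split; lra.
Qed.

Lemma has_freqU U V q q' : U `&` V = set0 -> has_freq U q -> has_freq V q' ->
  has_freq (U `|` V) (q + q').
Proof.
move=> UV h h' eta eta0; have eta2 : 0 < eta / 2 by rewrite divr_gt0.
have [n nP] := h _ eta2; have [n' n'P] := h' _ eta2.
exists (maxn n n') => x k kn.
have := nP x k (leq_trans (leq_maxl _ _) kn).
have := n'P x k (leq_trans (leq_maxr _ _) kn).
have -> : visits R (U `|` V) x 0 k = visits R U x 0 k + visits R V x 0 k.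
  rewrite -big_split; apply: eq_bigr => i _ /=; rewrite !indicE in_setU.
  set y := subshift_act _ _; case: (boolP (y \in U)) => [|_]; last by rewrite add0r.
  rewrite inE => Uy; case: (boolP (y \in V)) => [|_]; last by rewrite addr0.
  by rewrite inE => Vy; have : (U `&` V) y by []; rewrite UV.
by rewrite !ler_norml => /andP[h1 h2] /andP[h3 h4]; apply/andP; split; lra.
Qed.

Definition freq (U : set X) : R := xget 0 [set q | has_freq U q].

Lemma freqP U q : has_freq U q -> freq U = q.
Proof. by move=> h; apply: (has_freq_unique _ h); apply: (xgetPex 0 (ex_intro _ q h)). Qed.

Lemma has_freq_ge0 U q : has_freq U q -> 0 <= q.
Proof.
move=> h; apply/ler_addgt0Pr => eta /h[n /(_ x0 n.+1 (leqnSn _))].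
have k0 : 0 < n.+1%:R :> R by rewrite ltr0n.
have v0 : 0 <= visits R U x0 0 n.+1 by apply: sumr_ge0 => i _; rewrite indicE.
rewrite ler_norml => /andP[_ h2].
by rewrite -(pmulr_lge0 _ k0); lra.
Qed.

Lemma freq_ge0 U : 0 <= freq U.
Proof.
by rewrite /freq; case: xgetP => [q _ h|//]; exact: has_freq_ge0 h.
Qed.

Lemma freq0 : freq set0 = 0.
Proof.
apply: freqP => eta eta0; exists 0%N => x k _.
rewrite /visits big1 => [|i _]; last by rewrite indic0.
by rewrite mul0r subrr normr0 mulr_ge0// ltW.
Qed.

Lemma freqT : freq setT = 1.
Proof.
apply: freqP => eta eta0; exists 0%N => x k _.
by rewrite visits_T mul1r subrr normr0 mulr_ge0// ltW.
Qed.

Lemma freq_bigsetU (F : nat -> set X) n : (forall i, cylinder (F i)) ->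
  trivIset setT F -> freq (\big[setU/set0]_(i < n) F i) = \sum_(i < n) freq (F i).
Proof.
move=> cF tF; elim: n => [|n IH]; first by rewrite !big_ord0 freq0.
rewrite !big_ord_recr /= -IH; apply: freqP; apply: has_freqU.
- rewrite -bigcup_mkord; apply/seteqP; split => // x [[i /= ni Fi] Fn].
  by have := tF i n I I (ex_intro _ x (conj Fi Fn)) => e; move: ni; rewrite e ltnn.
- have [q hq] := cylinder_has_freq (cylinder_bigsetU n cF).
  by rewrite (freqP hq).
- by have [q hq] := cylinder_has_freq (cF n); rewrite (freqP hq).
Qed.

Definition freq_content (U : set (cylspace x0)) : \bar R := (freq U)%:E.

Lemma freq_content0 : freq_content set0 = 0%E.
Proof. by rewrite /freq_content freq0. Qed.

Lemma freq_content_ge0 U : (0 <= freq_content U)%E.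
Proof. by rewrite lee_fin freq_ge0. Qed.

(** A disjoint sequence of cylinders whose union is a cylinder is eventually
empty by compactness, so finite additivity suffices. *)
Lemma freq_content_additive : semi_sigma_additive freq_content.
Proof.
move=> F mF tF mUF; have [n nP] := cylinder_compact x0 mF tF mUF.
apply: cvg_near_cst; exists n => // k /= nk.
rewrite big_mkord /freq_content sumEFin -freq_bigsetU//; congr (freq _)%:E.
apply/seteqP; split; first by rewrite -bigcup_mkord; apply: bigcup_sub => i _ x; exists i.
move=> x [i _ Fi]; rewrite -bigcup_mkord; exists i => //=.
by rewrite ltnNge; apply/negP => ki; move: Fi; rewrite (nP i (leq_trans nk ki)).
Qed.

Definition freq_measure : {measure set (cylspace x0) -> \bar R} :=
  as_measure freq_content0 freq_content_ge0 freq_content_additive.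

Lemma borel_measurableE :
  @measurable _ (borel x0) = @measurable _ (g_sigma_algebraType (@measurable _ (cylspace x0))).
Proof. exact: borel_cylinder. Qed.

Lemma has_freq_shift k U q : has_freq U q -> has_freq (subshift_act k @^-1` U) q.
Proof.
move=> h eta /h[n nP]; exists n => x j nj; have := nP (subshift_act k x) j nj.
rewrite /visits (eq_bigr (fun i : 'I_j => \1_(subshift_act k @^-1` U) (subshift_act (0 + i%:Z) x)))//.
move=> i _; rewrite !indicE; congr (nat_of_bool _)%:R.
suff -> : subshift_act (0 + i%:Z) (subshift_act k x) =
  subshift_act k (subshift_act (0 + i%:Z) x) by [].
by apply: val_inj; rewrite /= !shiftD addrC.
Qed.

(** Caratheodory extension of the frequencies; normalizing only packages
it as a probability. *)
Lemma cylinder_measure_exists : exists mu : probability (borel x0) R,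
  forall U : set X, cylinder U -> mu U = (freq U)%:E.
Proof.
pose T' := g_sigma_algebraType (@measurable _ (cylspace x0)).
have mid : measurable_fun setT (id : T' -> borel x0).
  by move=> _ A mA; rewrite setTI; move: mA; rewrite borel_measurableE.
have [m mE] := push_measure (measure_extension freq_measure) mid.
exists (mnormalize m (dirac (x0 : borel x0))) => U cU.
have ext V : cylinder V -> m V = (freq V)%:E.
  move=> cV; rewrite mE preimage_id.
  exact: (@measurable_mu_extE _ R (cylspace x0) freq_measure V cV).
have mT : m setT = 1%E by rewrite ext ?freqT//; exact: cylinderT.
by rewrite /= /mnormalize mT onee_eq0 /= invr1 mule1; exact: ext.
Qed.

Lemma invariant_measure_cylinder (mu : probability (borel x0) R) :
  invariant_measure (@subshift_act a N) mu ->
  forall U : set X, cylinder U -> mu U = (freq U)%:E.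
Proof.
move=> inv U cU; apply: (invariant_average inv).
- exact: subshift_act_continuous.
- by apply: sub_sigma_algebra; exact: cylinder_open.
- have [q hq] := cylinder_has_freq cU; rewrite (freqP hq).
  move=> eta /hq[n nP]; exists [seq i%:Z | i <- iota 0 n.+1].
    by rewrite size_map size_iota.
  move=> x; rewrite size_map size_iota big_map.
  have := nP x n.+1 (leqnSn _); rewrite /visits.
  rewrite -(big_mkord xpredT (fun i => \1_U (subshift_act (0 + i%:Z) x))).
  rewrite /index_iota subn0.
  by under eq_bigr do rewrite add0r.
Qed.

(** The cylinders are stable under intersection and generate the Borel sets. *)
Lemma measure_eq_cylinder (mu nu : {measure set (borel x0) -> \bar R}) :
  (mu setT < +oo)%E -> (forall U : set X, cylinder U -> mu U = nu U) ->
  forall A : set (borel x0), measurable A -> mu A = nu A.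
Proof.
move=> mufin munu A mA.
apply: (@measure_unique _ R (borel x0) (@cylinder a N) (fun=> setT) _ _ _ _ mu nu) => //.
- exact: borel_cylinder.
- exact: cylinderI.
- by move=> _; exact: cylinderT.
- by apply/seteqP; split => // x _; exists 0%N.
Qed.

(** Both existence and uniqueness reduce to cylinders, where every invariant
measure equals the frequency and the frequency is shift invariant. *)
Lemma subshift_ergodic_at : exists2 mu : probability (borel x0) R,
    invariant_measure (@subshift_act a N) mu &
    forall nu : probability (borel x0) R, invariant_measure (@subshift_act a N) nu ->
      forall A : set (borel x0), measurable A -> nu A = mu A.
Proof.
have [mu muP] := cylinder_measure_exists; exists mu; last first.
  move=> nu /invariant_measure_cylinder nuP; apply: measure_eq_cylinder.
    exact: probability_lty.
  by move=> U cU; exact: etrans (nuP U cU) (esym (muP U cU)).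
move=> k A mA.
have mact : measurable_fun setT (subshift_act k : borel x0 -> borel x0).
  by move=> _ B mB; rewrite setTI; apply: borel_preimage => //; exact: subshift_act_continuous.
have [m mE] := push_measure mu mact.
rewrite -mE; apply: measure_eq_cylinder => //.
  have -> : m setT = 1%E by rewrite mE; exact: (@probability_setT _ _ _ mu).
  exact: ltry.
move=> U cU; rewrite mE; transitivity (freq (subshift_act k @^-1` U))%:E.
  exact/muP/cylinder_preimage.
transitivity (freq U)%:E; last exact/esym/muP.
have [q hq] := cylinder_has_freq cU.
by rewrite (freqP hq) (freqP (has_freq_shift k hq)).
Qed.

End Frequency.

(** * The tiling space and minimality of the flow *)

Section Flow.
Variables (R : realType) (a : nat -> nat) (N : nat).
Local Notation L := (letter a N).
Local Notation X := (subshift a N).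
Variables (l : L -> R) (lmin lmax : R).
Hypothesis l_cont : continuous l.
Hypothesis lmin0 : 0 < lmin.
Hypothesis l_bounds : forall c, lmin <= l c <= lmax.
Local Notation W := (tiling_space l).
Local Notation proj p := (\pi_(tiling_space l) p).
Implicit Types (p q : X * R) (x y : X).

(** Generator of the equivalence relation defining the tiling space, as a
homeomorphism of the product: the base point moves from one tile to the next. *)
Definition slide p : X * R := (subshift_act 1 p.1, p.2 - roof l p.1).
Definition unslide p : X * R :=
  (subshift_act (-1) p.1, p.2 + roof l (subshift_act (-1) p.1)).

(** The left end of the n-th tile when the zeroth one starts at 0. *)
Definition tile_pos x n := length_sum l (val x) 0 n.

Lemma act_act j k x : subshift_act j (subshift_act k x) = subshift_act (j + k) x.
Proof. by apply: val_inj; rewrite /= shiftD. Qed.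

Lemma act0 x : subshift_act 0 x = x.
Proof. by apply: val_inj; rewrite /= shift0. Qed.

Lemma slideK : cancel slide unslide.
Proof. by move=> [x t]; rewrite /slide /unslide /= !act_act addNr act0 subrK. Qed.

Lemma unslideK : cancel unslide slide.
Proof. by move=> [x t]; rewrite /slide /unslide /= !act_act addrN act0 addrK. Qed.

Lemma roof_bounds x : lmin <= roof l x <= lmax.
Proof. exact: l_bounds. Qed.

Lemma tile_posS x n : tile_pos x n.+1 = tile_pos x n + roof l (subshift_act n%:Z x).
Proof. by rewrite /tile_pos /length_sum big_ord_recr. Qed.

Lemma tile_pos0 x : tile_pos x 0 = 0.
Proof. by rewrite /tile_pos /length_sum big_ord0. Qed.

Lemma iter_slide n x t : iter n slide (x, t) = (subshift_act n%:Z x, t - tile_pos x n).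
Proof.
elim: n => [|n IH]; first by rewrite /= act0 tile_pos0 subr0.
rewrite iterS IH /slide /= act_act tile_posS opprD addrA.
by congr (subshift_act _ _, _).
Qed.

Lemma tile_pos_ge x n : n%:R * lmin <= tile_pos x n.
Proof.
elim: n => [|n IH]; first by rewrite mul0r tile_pos0.
rewrite tile_posS -natr1 mulrDl mul1r lerD//.
by have /andP[] := roof_bounds (subshift_act n%:Z x).
Qed.

Lemma tile_pos_le x n : tile_pos x n <= n%:R * lmax.
Proof.
elim: n => [|n IH]; first by rewrite mul0r tile_pos0.
rewrite tile_posS -natr1 mulrDl mul1r lerD//.
by have /andP[] := roof_bounds (subshift_act n%:Z x).
Qed.

(** Since [slide] is injective, this is the equivalence relation generated by it;
the disjunction stands for an integer exponent. *)
Definition same_orbit p q := exists n, q = iter n slide p \/ p = iter n slide q.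

Lemma same_orbit_iter i j p q : iter i slide p = iter j slide q -> same_orbit p q.
Proof.
wlog ij : i j p q / (i <= j)%N => [h e|].
  case: (leqP i j) => [ij|/ltnW ij]; first exact: h ij e.
  by have [n [|]] := h _ _ _ _ ij (esym e); [exists n; right|exists n; left].
have inj u v : iter i slide u = iter i slide v -> u = v.
  by elim: i {ij} => //= i IH /(can_inj slideK).
rewrite -(subnKC ij) iterD => /inj ->.
by exists (j - i)%N; right.
Qed.

Lemma proj_slide p : proj (slide p) = proj p.
Proof.
by apply/esym/eqmodP/asboolP; apply: rst_step; split => //; rewrite /slide /= subrK.
Qed.

Lemma proj_iter n p : proj (iter n slide p) = proj p.
Proof. by elim: n => // n IH; rewrite iterS proj_slide. Qed.

Lemma proj_eq p q : proj p = proj q <-> same_orbit p q.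
Proof.
split; last by move=> [n [] ->]; rewrite proj_iter.
move=> /eqmodP/asboolP pq.
suff [i [j e]] : exists i j, iter i slide p = iter j slide q by exact: same_orbit_iter e.
elim: pq => {p q} [p q [e1 e2]|p|p q _ [i [j e]]|p q r _ [i [j e]] _ [i' [j' e']]].
- exists 1%N, 0%N; rewrite /= /slide -e1 e2 addrK.
  by case: q {e1 e2}.
- by exists 0%N, 0%N.
- by exists j, i.
- exists (i' + i)%N, (j + j')%N; rewrite !iterD e -e' -!iterD.
  by rewrite addnC.
Qed.

(** Each slide lowers the real coordinate by at least lmin. *)
Lemma same_orbit_close p q : `|p.2 - q.2| < lmin -> same_orbit p q -> p = q.
Proof.
have key p' q' n : `|p'.2 - q'.2| < lmin -> q' = iter n slide p' -> p' = q'.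
  case: p' => x t; case: n => // n d e; move: d; rewrite e iter_slide /=.
  rewrite opprB addrCA subrr addr0 ger0_norm; last first.
    by rewrite (le_trans _ (tile_pos_ge x n.+1))// mulr_ge0// ltW.
  have := tile_pos_ge x n.+1; rewrite -natr1 mulrDl mul1r.
  have : 0 <= n%:R * lmin by rewrite mulr_ge0// ltW.
  move=> h1 h2 h3; have : lmin < lmin by lra.
  by rewrite ltxx.
move=> d [n [e|e]]; first exact: key e.
by apply/esym; apply: (key _ _ n) => //; rewrite distrC.
Qed.

(** The set of pairs with 0 <= t < roof meets each class once. *)
Lemma same_orbit_normal x t y s : same_orbit (x, t) (y, s) ->
  0 <= t < roof l x -> 0 <= s < roof l y -> (x, t) = (y, s).
Proof.
have key x' t' y' s' n : (y', s') = iter n slide (x', t') ->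
    0 <= t' < roof l x' -> 0 <= s' -> (x', t') = (y', s').
  case: n => [->//|n]; rewrite iter_slide => -[-> ->] /andP[t0 tr] s0.
  have : tile_pos x' 1 <= tile_pos x' n.+1.
    elim: n {s0} => // n IH; apply: (le_trans IH); rewrite [leRHS]tile_posS lerDl.
    by have /andP[h _] := roof_bounds (subshift_act n.+1%:Z x'); rewrite (le_trans (ltW lmin0)).
  rewrite tile_posS tile_pos0 add0r act0 => h; have : t' < t' by lra.
  by rewrite ltxx.
move=> [n [e|e]] ht hs; first by apply: (key _ _ _ _ n) => //; case/andP: hs.
by apply/esym; apply: (key _ _ _ _ n) => //; case/andP: ht.
Qed.

Lemma tile_at x t : 0 <= t -> exists n, tile_pos x n <= t < tile_pos x n.+1.
Proof.
move=> t0; have ex : exists n, t < tile_pos x n.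
  exists (Num.bound (t / lmin)); apply: lt_le_trans (tile_pos_ge _ _).
  by rewrite -ltr_pdivrMr// archi_boundP// divr_ge0// ltW.
case: (ex_minnP ex) => -[|n]; first by rewrite tile_pos0 ltNge t0.
move=> tn nmin; exists n; rewrite tn andbT leNgt; apply/negP => /nmin.
by rewrite ltnn.
Qed.

(** Unsliding raises the real coordinate by at least lmin each time. *)
Lemma proj_ge0 p : exists q, 0 <= q.2 /\ proj p = proj q.
Proof.
have key n : exists q, p = iter n slide q /\ p.2 + n%:R * lmin <= q.2.
  elim: n => [|n [q [pq h]]]; first by exists p; rewrite mul0r addr0.
  exists (unslide q); rewrite iterSr unslideK; split => //.
  rewrite -natr1 mulrDl mul1r addrA; apply: lerD => //.
  by have /andP[] := roof_bounds (subshift_act (-1) q.1).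
have [q [pq h]] := key (Num.bound (`|p.2| / lmin)).
exists q; split; last by rewrite pq proj_iter.
apply: le_trans h; rewrite -lerBlDl sub0r.
apply: (@le_trans _ _ `|p.2|); first by rewrite ler_normr lexx orbT.
by rewrite -ler_pdivrMr// ltW// archi_boundP// divr_ge0// ltW.
Qed.

Lemma proj_normal (w : W) : exists x t, 0 <= t < roof l x /\ w = proj (x, t).
Proof.
have [[x t] [/= t0 e]] := proj_ge0 (repr w).
have [n /andP[h1 h2]] := tile_at x t0.
exists (subshift_act n%:Z x), (t - tile_pos x n); split.
  by rewrite subr_ge0 h1 ltrBlDl -tile_posS.
by rewrite -iter_slide proj_iter -e reprK.
Qed.

Lemma roof_continuous : continuous (roof l : X -> R).
Proof.
move=> x O /l_cont /letter_nbhsP[n nO]; apply/subshift_nbhsP; exists n => y xy.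
by apply: nO; exact: xy.
Qed.

Lemma act_fst_continuous k : continuous (fun p => subshift_act k p.1).
Proof.
move=> p; apply: (@continuous_comp _ _ _ fst (@subshift_act a N k)).
  exact: cvg_fst.
exact: subshift_act_continuous.
Qed.

Lemma pair_continuous (T U V : topologicalType) (f : T -> U) (g : T -> V) :
  continuous f -> continuous g -> continuous (fun z => (f z, g z)).
Proof. by move=> cf cg z; exact: (cvg_pair (cf z) (cg z)). Qed.

Lemma slide_continuous : continuous slide.
Proof.
apply: pair_continuous; first exact: act_fst_continuous.
move=> p; apply: cvgB; first exact: cvg_snd.
apply: (@continuous_comp _ _ _ fst (roof l)); first exact: cvg_fst.
exact: roof_continuous.
Qed.

Lemma unslide_continuous : continuous unslide.
Proof.
apply: pair_continuous; first exact: act_fst_continuous.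
move=> p; apply: cvgD; first exact: cvg_snd.
apply: (@continuous_comp _ _ _ (fun p => subshift_act (-1) p.1) (roof l)).
  exact: act_fst_continuous.
exact: roof_continuous.
Qed.

Lemma iter_continuous (T : topologicalType) (f : T -> T) n :
  continuous f -> continuous (iter n f).
Proof.
move=> cf; elim: n => [|n IH] z; first exact: cvg_id.
by apply: (continuous_comp (IH z)); exact: cf.
Qed.

Lemma tiling_openP (O : set W) : open O <-> open ((fun p => proj p) @^-1` O).
Proof. by []. Qed.

Lemma translate_continuous (s : R) : continuous (@susp_translate a N R s).
Proof.
apply: pair_continuous => p; first exact: cvg_fst.
by apply: cvgD; [exact: cvg_snd|exact: cvg_cst].
Qed.

Lemma flow_continuous (s : R) : continuous (@tiling_flow a N R l s).
Proof.
apply/continuousP => O oO; apply/tiling_openP.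
have -> : (fun p => proj p) @^-1` (@tiling_flow a N R l s @^-1` O) =
    @susp_translate a N R s @^-1` ((fun p => proj p) @^-1` O).
  by apply/seteqP; split => p /=; rewrite tiling_flow_pi.
by move/continuousP : (@translate_continuous s); apply.
Qed.

Lemma flow_proj (s : R) p : tiling_flow s (proj p) = proj (p.1, p.2 + s).
Proof. exact: tiling_flow_pi. Qed.

Lemma flow_add (s t : R) (w : W) : tiling_flow s (tiling_flow t w) = tiling_flow (t + s) w.
Proof.
by rewrite -[w](@reprK _ W) !flow_proj /= addrA.
Qed.

Lemma flow0 (w : W) : tiling_flow 0 w = w.
Proof. by rewrite -[w](@reprK _ W) flow_proj /= addr0 -surjective_pairing. Qed.

Lemma open_prod (O : set (X * R)) (x : X) (t : R) : open O -> O (x, t) ->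
  exists n (e : R), 0 < e /\
    forall y s, agree_seq n (val x) (val y) -> `|t - s| < e -> O (y, s).
Proof.
move=> oO Oxt; have [[A B] /= [xA tB] ABO] : nbhs (x, t) O by apply: open_nbhs_nbhs.
have /subshift_nbhsP[n nA] := xA.
have /nbhs_ballP[e e0 eB] := tB.
exists n, e; split => // y s xy ts; apply: ABO; split; first exact: nA.
exact: eB.
Qed.

(** Represent the target set by a neighbourhood of a pair (y, s). Some shift z
of x is close to y, and the pair (z, s) lies on the flow orbit of x at a
time given by the positions of the tiles. *)
Theorem flow_minimal : minimal (@subshift_act a N) -> minimal (@tiling_flow a N R l).
Proof.
move=> smin w O [w' Ow'] oO.
have [x [t [_ wxt]]] := proj_normal w; have [y [s [_ wys]]] := proj_normal w'.
have Oys : ((fun p => proj p) @^-1` O) (y, s) by rewrite /= -wys.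
have [n [e [e0 eO]]] := open_prod ((tiling_openP O).1 oO) Oys.
have [||z [/= yz [k _ kx]]] := smin x [set z : X | agree_seq n (val y) (val z)].
- by exists y => j jn.
- by apply: cylinder_open; exists n => u v uv yu; exact: agree_seq_trans uv.
(* The sign of k decides on which side of the origin the tile of z starts. *)
have [r rz] : exists r, tiling_flow r w = proj (z, s).
  rewrite -kx wxt; case: k {kx} => k.
    exists (s + tile_pos x k - t); rewrite flow_proj /= addrC subrK.
    by rewrite -(proj_iter k) iter_slide addrK.
  exists (s - tile_pos (subshift_act (Negz k) x) k.+1 - t).
  rewrite flow_proj /= addrC subrK -[in RHS](proj_iter k.+1) iter_slide.
  rewrite act_act NegzE addrN act0.
  by [].
exists (tiling_flow r w); split; last by exists r.
by rewrite rz; apply: (eO z s yz); rewrite subrr normr0.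
Qed.

End Flow.

(** * Flow boxes *)

Section Boxes.
Variables (R : realType) (a : nat -> nat) (N : nat).
Local Notation L := (letter a N).
Local Notation X := (subshift a N).
Variables (l : L -> R) (lmin lmax : R).
Hypothesis l_cont : continuous l.
Hypothesis lmin0 : 0 < lmin.
Hypothesis l_bounds : forall c, lmin <= l c <= lmax.
Local Notation W := (tiling_space l).
Local Notation proj p := (\pi_(tiling_space l) p).

(** The interval is half-open so that a box of height h is met exactly once
by the sampling times i h during a visit. *)
Definition box (U : set X) (s t : R) : set W :=
  [set w | exists x r, [/\ U x, s <= r < t & w = proj (x, r)]].
(** Open version of [box], used to show that boxes are Borel sets. *)
Definition open_box (U : set X) (s t : R) : set W :=
  [set w | exists x r, [/\ U x, s < r < t & w = proj (x, r)]].

(** The saturation of an open set of the product is the union of its images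
under all powers of the homeomorphism [slide]. *)
Lemma open_box_open U s t : open U -> open (open_box U s t).
Proof.
move=> oU; apply/tiling_openP.
pose Z : set (X * R) := [set p | U p.1 /\ s < p.2 < t].
have oZ : open Z.
  have -> : Z = fst @^-1` U `&` (snd @^-1` [set r | s < r] `&` snd @^-1` [set r | r < t]).
    apply/seteqP; split => p /=; first by move=> [? /andP[]].
    by move=> [? [? ?]]; split => //; apply/andP.
  apply: openI; first by apply: open_comp => // p _; exact: cvg_fst.
  by apply: openI; apply: open_comp => [p _|]; [exact: cvg_snd|exact: open_gt
    |exact: cvg_snd|exact: open_lt].
(* Integer powers of the homeomorphism, written with two natural exponents. *)
have -> : (fun p => proj p) @^-1` open_box U s t = \bigcup_i \bigcup_j
    ((fun p => iter j (unslide l) (iter i (slide l) p)) @^-1` Z).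
  apply/seteqP; split=> [p [x [r [Ux rst]]]|p [i _ [j _ [Up pst]]]] /=.
    move=> /proj_eq [n [e|e]].
      by exists n => //; exists 0%N => //; rewrite /= -e.
    exists 0%N => //; exists n => //; rewrite /= e.
    have -> k q : iter k (unslide l) (iter k (slide l) q) = q.
      by elim: k q => // k IH q; rewrite [iter k.+1 (unslide l) _]iterSr iterS slideK.
    by [].
  set q := iter j _ _ in Up pst.
  exists q.1, q.2; split => //; rewrite -surjective_pairing.
  have e : iter j (slide l) q = iter i (slide l) p.
    rewrite /q; elim: (j) (iter i _ p) => // k IH z.
    by rewrite [iter k.+1 (slide l) _]iterSr iterS unslideK IH.
  by rewrite -(proj_iter l i p) -e proj_iter.
apply: bigcup_open => i _; apply: bigcup_open => j _.
apply: open_comp => // p _.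
apply: (@continuous_comp _ _ _ (iter i (slide l)) (iter j (unslide l))).
  by apply: iter_continuous; exact: slide_continuous.
by apply: iter_continuous; exact: unslide_continuous.
Qed.

(** Within the range of length lmin, different heights give different points of
the tiling space, so differences of boxes may be computed upstairs. *)
Lemma boxE U s t : s - lmin / 2 <= t <= s + lmin / 2 ->
  box U s t = open_box U (s - lmin / 2) t `\` open_box U (s - lmin / 2) s.
Proof.
move=> /andP[st1 st2]; apply/seteqP; split=> w.
  move=> [x [r [Ux /andP[sr rt] ->]]]; split.
    by exists x, r; split => //; rewrite rt andbT; have := lmin0; lra.
  move=> [y [r' [Uy /andP[h1 h2]]]] /proj_eq h.
  have rr : `|(x, r).2 - (y, r').2| < lmin.
    by rewrite /= ltr_norml; apply/andP; split; lra.
  have [_ e] := same_orbit_close lmin0 l_bounds rr h.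
  by move: h2; rewrite -e ltNge sr.
move=> [[x [r [Ux /andP[h1 h2] e]]] nb]; exists x, r; split => //.
rewrite h2 andbT leNgt; apply/negP => rs; apply: nb.
by exists x, r; split => //; rewrite h1 rs.
Qed.

Lemma box_measurable (w0 : W) U s t : open U -> s - lmin / 2 <= t <= s + lmin / 2 ->
  measurable (box U s t : set (borel w0)).
Proof.
move=> oU st; rewrite (boxE _ st); apply: measurableD;
  by apply: sub_sigma_algebra; exact: open_box_open.
Qed.

Lemma box_flow U s t r : tiling_flow r @^-1` box U s t = box U (s - r) (t - r).
Proof.
apply/seteqP; split => w [x [u [Ux ust e]]].
  exists x, (u - r); split => //; first by rewrite lerD2r ltrD2r.
  by rewrite -[w]flow0 -(addrN r) -flow_add e flow_proj.
exists x, (u + r); split => //; first by rewrite -lerBlDr -ltrBrDr.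
by rewrite e flow_proj.
Qed.

(** Representatives with heights in [0, lmin) are unique, so boxes in this layer
intersect like rectangles. *)
Lemma boxI U V s t s' t' : 0 <= s -> 0 <= s' -> t <= lmin -> t' <= lmin ->
  box U s t `&` box V s' t' = box (U `&` V) (Num.max s s') (Num.min t t').
Proof.
move=> s0 s0' tl tl'; apply/seteqP; split=> w.
  move=> [[x [r [Ux /andP[h1 h2] ->]]] [y [r' [Vy /andP[h3 h4]]]]] /proj_eq h.
  have rr : `|(x, r).2 - (y, r').2| < lmin.
    by rewrite /= ltr_norml; apply/andP; split; lra.
  have [e1 e2] := same_orbit_close lmin0 l_bounds rr h.
  exists x, r; split => //; first by split => //; rewrite e1.
  by rewrite ge_max lt_min h1 h2 e2 h3 h4.
move=> [x [r [[Ux Vx]]]]; rewrite ge_max lt_min => /andP[/andP[h1 h2] /andP[h3 h4]] ->.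
by split; exists x, r; split => //; rewrite ?h1 ?h2.
Qed.

(** Among the representatives of a point, only that of the current tile has
its height in [0, h), as h is at most the length of a tile. *)
Lemma box_proj U h y s n : h <= lmin -> tile_pos l y n <= s < tile_pos l y n.+1 ->
  box U 0 h (proj (y, s)) <-> U (subshift_act n%:Z y) /\ s - tile_pos l y n < h.
Proof.
move=> hl /andP[h1 h2].
have e : proj (y, s) = proj (subshift_act n%:Z y, s - tile_pos l y n).
  by rewrite -(proj_iter l n) iter_slide.
rewrite e; split.
  move=> [x [r [Ux /andP[r0 rh]]]] /proj_eq so.
  have n1 : 0 <= s - tile_pos l y n < roof l (subshift_act n%:Z y).
    by rewrite subr_ge0 h1 ltrBlDl -tile_posS.
  have n2 : 0 <= r < roof l x.
    rewrite r0 (lt_le_trans rh)// (le_trans hl)//.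
    by have /andP[] := roof_bounds l_bounds x.
  by have [-> ->] := same_orbit_normal lmin0 l_bounds so n1 n2.
move=> [Un sh]; exists (subshift_act n%:Z y), (s - tile_pos l y n); split => //.
by rewrite subr_ge0 h1.
Qed.

Lemma visitsS U (y : X) n :
  visits R U y 0 n.+1 = visits R U y 0 n + \1_U (subshift_act n%:Z y).
Proof. by rewrite /visits big_ord_recr /= add0r. Qed.

(** The sampling step h is at most the length of a tile, so no tile is
skipped, and a sample lies in the first part of length h of its tile exactly
when it is the first sample in this tile. The initial tile accounts for the
error 1. The index n is the tile that contains the last sample. *)
Lemma box_count U h y s i : 0 < h <= lmin -> 0 <= s < roof l y ->
  exists n, tile_pos l y n <= s + i%:R * h < tile_pos l y n.+1 /\
    `|\sum_(j < i.+1) \1_(box U 0 h) (tiling_flow (j%:R * h) (proj (y, s)))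
       - visits R U y 0 n.+1| <= 1.
Proof.
move=> /andP[h0 hl] /andP[s0 sr].
have ind01 (T : Type) (A : set T) (z : T) : 0 <= (\1_A z : R) <= 1.
  by rewrite indicE; case: (_ \in _); rewrite /= ?lexx ?ler01.
elim: i => [|i [n [/andP[h1 h2] IH]]].
  exists 0%N; rewrite mul0r addr0 tile_posS tile_pos0 act0 add0r s0 sr; split => //.
  rewrite big_ord1 /visits big_ord1.
  set A := \1_ _ _; set B := \1_ _ _.
  have /andP[a0 a1] : 0 <= A <= 1 := ind01 _ _ _.
  have /andP[b0 b1] : 0 <= B <= 1 := ind01 _ _ _.
  by rewrite ler_norml; apply/andP; split; lra.
have e : s + i.+1%:R * h = s + i%:R * h + h by rewrite -natr1 mulrDl mul1r addrA.
rewrite big_ord_recr /= flow_proj /= e.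
(* Either the next sample stays in the n-th tile, beyond its first part of
   length h, or it is the first sample in the next tile. *)
case: (ltP (s + i%:R * h + h) (tile_pos l y n.+1)) => hn.
  have hn' : tile_pos l y n <= s + i%:R * h + h by rewrite (le_trans h1)// lerDl ltW.
  exists n; rewrite hn hn'; split => //.
  suff -> : \1_(box U 0 h) (proj (y, s + i%:R * h + h)) = 0 :> R by rewrite addr0.
  rewrite indicE memNset// => /(box_proj U hl (n := n)).
  rewrite hn hn' => /(_ isT)[_] hh; have : h < h by lra.
  by rewrite ltxx.
have nn : tile_pos l y n.+1 <= s + i%:R * h + h < tile_pos l y n.+2.
  rewrite hn tile_posS; have /andP[h3 _] := roof_bounds l_bounds (subshift_act n.+1%:Z y).
  by rewrite ltr_leD// (le_trans hl).
exists n.+1; split => //.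
rewrite visitsS.
suff -> : \1_(box U 0 h) (proj (y, s + i%:R * h + h)) =
    \1_U (subshift_act n.+1%:Z y) :> R by rewrite opprD addrACA subrr addr0.
rewrite !indicE; congr (nat_of_bool _)%:R; apply/idP/idP; rewrite !inE.
  by move=> /(box_proj U hl nn)[].
move=> Un; apply/(box_proj U hl nn); split => //; lra.
Qed.

Hypothesis a_le_N : forall i, (a i <= N)%N.
Hypothesis a0_neq0 : a 0%N <> 0%N.
Hypothesis a_gaps : bounded_gaps a.
Hypothesis l_tile : is_tile_length l.

(** The number of tiles passed is translated into elapsed time by
[tile_pos]; the frequency per unit length p becomes p h per sample. *)
Lemma box_frequency U h : cylinder U -> 0 < h <= lmin ->
  exists q : R, forall eta, 0 < eta -> exists n0 : nat, forall (w : W) n, (n0 <= n)%N ->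
    `|\sum_(j < n) \1_(box U 0 h) (tiling_flow (j%:R * h) w) - q * n%:R|
      <= eta * n%:R.
Proof.
move=> cU /andP[h0 hl].
have [p pP] := uniform_visits a_le_N a0_neq0 a_gaps l_tile cU.
exists (p * h) => eta eta0.
have lmax0 : 0 < lmax.
  by have /andP[h1 h2] := l_bounds (fin_letter a N 0); rewrite (lt_le_trans lmin0)// (le_trans h1).
have hlm : h <= lmax.
  by have /andP[h1 h2] := l_bounds (fin_letter a N 0); rewrite (le_trans hl)// (le_trans h1).
pose e := eta / (4 * lmax).
have e0 : 0 < e by rewrite divr_gt0// mulr_gt0.
have [n0 nP] := pP _ e0.
pose K0 := 1 + e * (2 * lmax) + `|p| * (2 * lmax).
pose M : R := n0%:R * lmax / h + K0 / (eta / 2).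
have lm2 : 0 <= 2 * lmax by rewrite mulr_ge0// (ltW lmax0).
have K00 : 0 <= K0.
  by rewrite /K0 !addr_ge0 ?(mulr_ge0 (ltW e0) lm2) ?(mulr_ge0 (normr_ge0 p) lm2).
have eta2 : 0 < eta / 2 by rewrite divr_gt0.
have M1 : 0 <= n0%:R * lmax / h by rewrite divr_ge0 ?(ltW h0)// mulr_ge0 ?(ltW lmax0).
have M2 : 0 <= K0 / (eta / 2) by rewrite divr_ge0 ?(ltW eta2).
have M0 : 0 <= M by rewrite addr_ge0.
exists (Num.bound M).+1 => w [//|i] iM.
have iM' : M <= i%:R.
  by rewrite ltW// (lt_le_trans (archi_boundP M0))// ler_nat.
have [y [s [sy ->]]] := proj_normal lmin0 l_bounds w.
have [|n [/andP[h1 h2] cnt]] := @box_count U h y s i _ sy; first by rewrite h0.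
have T1 : tile_pos l y n.+1 <= i%:R * h + 2 * lmax.
  rewrite tile_posS; have /andP[_ h3] := roof_bounds l_bounds (subshift_act n%:Z y).
  have /andP[_ h4] := roof_bounds l_bounds y; case/andP: sy => _ h5; lra.
have T0 : i%:R * h <= tile_pos l y n.+1.
  case/andP: sy => h5 _; lra.
have K0e : K0 <= eta / 2 * i%:R.
  rewrite -ler_pdivrMl// mulrC; apply: le_trans iM'.
  by rewrite /M lerDr.
have nn : (n0 <= n.+1)%N.
  rewrite -(@ler_nat R) -(ler_pM2r lmax0).
  apply: le_trans (tile_pos_le l_bounds y n.+1); apply: le_trans T0.
  by rewrite -ler_pdivrMr//; apply: le_trans iM'; rewrite /M lerDl.
have := nP y 0 n.+1 nn; rewrite -/(tile_pos l y n.+1) => vis.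
set S := \sum_(j < _) _ in cnt *; set V := visits _ _ _ _ _ in cnt vis.
set T := tile_pos l y n.+1 in T0 T1 vis.
have pT : `|p * (T - i.+1%:R * h)| <= `|p| * (2 * lmax).
  rewrite normrM ler_wpM2l// ler_norml -natr1; apply/andP; split; lra.
have e1 : e * T <= e * (i%:R * h + 2 * lmax) by rewrite ler_pM2l.
have e2 : e * (i%:R * h) <= eta / 4 * i%:R.
  have -> : eta / 4 * i%:R = e * (i%:R * lmax) by rewrite /e; field; rewrite gt_eqF.
  by rewrite ler_pM2l// ler_wpM2l.
have e3 : 0 <= eta * i%:R by rewrite mulr_ge0// ltW.
rewrite /K0 in K0e; move: cnt vis pT; rewrite !ler_norml -natr1 !mulrDr !mulrDl.
move=> /andP[? ?] /andP[? ?] /andP[? ?].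
by apply/andP; split; lra.
Qed.

Variable w0 : W.

Lemma flow_borel r (A : set (borel w0)) : measurable A ->
  measurable (tiling_flow r @^-1` A : set (borel w0)).
Proof. by apply: borel_preimage; exact: flow_continuous. Qed.

Lemma box_empty U s t : t <= s -> box U s t = set0.
Proof.
by move=> ts; apply/seteqP; split => // w [x [r [_ /andP[h1 h2] _]]];
  move: (le_lt_trans h1 h2); rewrite ltNge ts.
Qed.

Section two_measures.
Variables mu nu : probability (borel w0) R.
Hypothesis mu_inv : invariant_measure (@tiling_flow a N R l) mu.
Hypothesis nu_inv : invariant_measure (@tiling_flow a N R l) nu.

(** By invariance the box may be moved to height 0; there both measures
are computed by [invariant_average] along the multiples of its height. *)
Lemma invariant_measures_box U s t : cylinder U -> t <= s + lmin / 2 ->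
  mu (box U s t) = nu (box U s t).
Proof.
move=> cU st; have [ts|ts] := leP t s; first by rewrite box_empty// !measure0.
have st' : 0 < t - s <= lmin.
  rewrite subr_gt0 ts/= lerBlDl (le_trans st)// lerD2l.
  by rewrite ler_pdivrMr// ler_peMr// ?ler1n// ltW.
have e : box U s t = tiling_flow (- s) @^-1` box U 0 (t - s).
  by rewrite box_flow opprK add0r subrK.
have mB : measurable (box U 0 (t - s) : set (borel w0)).
  apply: box_measurable; first exact: cylinder_open.
  rewrite sub0r add0r lerBlDl st andbT (@le_trans _ _ 0)//; last by rewrite subr_ge0 ltW.
  by rewrite oppr_le0 divr_ge0// ltW.
have [q qP] := box_frequency cU st'.
have avg (m : probability (borel w0) R) :
    invariant_measure (@tiling_flow a N R l) m -> m (box U 0 (t - s)) = q%:E.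
  move=> inv; apply: (invariant_average inv (@flow_continuous R a N l)) => //.
  move=> eta /qP[n0 nP].
  exists [seq j%:R * (t - s) | j <- iota 0 n0.+1]; first by rewrite size_map size_iota.
  move=> w; rewrite size_map size_iota big_map.
  have := nP w n0.+1 (leqnSn _).
  rewrite -(big_mkord xpredT (fun j : nat =>
    \1_(box U 0 (t - s)) (tiling_flow (j%:R * (t - s)) w))).
  by rewrite /index_iota subn0.
rewrite e; transitivity q%:E; first by rewrite -(avg _ mu_inv); exact: mu_inv.
by rewrite -(avg _ nu_inv); apply/esym/nu_inv.
Qed.

End two_measures.

End Boxes.

(** * Uniqueness of the invariant measure of the flow *)

Section Rect.
Variables (R : realType) (a : nat -> nat) (N : nat).
Local Notation X := (subshift a N).

(** The largest cylinder of precision n whose product with [p, q) lies in O.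
Countably many of these rectangles exhaust an open set. *)
Definition rect_core (O : set (X * R)) (n : nat) (p q : rat) : set X :=
  [set x | forall (y : X) (s : R), agree_seq n (val x) (val y) ->
     ratr p <= s < ratr q -> O (y, s)].

Lemma rect_core_cylinder O n p q : cylinder (rect_core O n p q).
Proof.
exists n => x y xy hx z s yz; apply: hx; exact: agree_seq_trans yz.
Qed.

Lemma rect_coreP (O : set (X * R)) (x : X) (t : R) : open O -> O (x, t) ->
  exists n p q, rect_core O n p q x /\ ratr p <= t < ratr q.
Proof.
move=> oO Oxt; have [n [e [e0 eO]]] := open_prod oO Oxt.
have [p] := @rat_in_itvoo R (t - e) t ltac:(by rewrite ltrBlDr ltrDl).
have [q] := @rat_in_itvoo R t (t + e) ltac:(by rewrite ltrDl).
rewrite !in_itv /= => /andP[q1 q2] /andP[p1 p2].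
exists n, p, q; rewrite (ltW p2) q1; split => // y s xy /andP[h1 h2].
by apply: eO => //; rewrite ltr_norml; apply/andP; split; lra.
Qed.
End Rect.

Section FlowUnique.
Variables (R : realType) (a : nat -> nat) (N : nat).
Local Notation L := (letter a N).
Local Notation X := (subshift a N).
Variables (l : L -> R) (lmin lmax : R).
Hypothesis l_cont : continuous l.
Hypothesis lmin0 : 0 < lmin.
Hypothesis l_bounds : forall c, lmin <= l c <= lmax.
Local Notation W := (tiling_space l).
Local Notation proj p := (\pi_(tiling_space l) p).
Hypothesis a_le_N : forall i, (a i <= N)%N.
Hypothesis a0_neq0 : a 0%N <> 0%N.
Hypothesis a_gaps : bounded_gaps a.
Hypothesis l_tile : is_tile_length l.
Local Notation bx := (@box R a N l).
Variable w0 : W.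

Let d := lmin / 2.
Let d0 : 0 < d. Proof. by rewrite divr_gt0. Qed.
Let dl : d < lmin. Proof. by rewrite ltr_pdivrMr// ltr_pMr// ltr1n. Qed.

(** A pair (x, t) with t nonnegative lies in the layer numbered by the integer
part of t / d. *)
Lemma box_cover : \bigcup_j bx setT (j%:R * d) (d + j%:R * d) = setT.
Proof.
apply/seteqP; split => // w _.
have [x [t [/andP[t0 _] ->]]] := proj_normal lmin0 l_bounds w.
have /andP[h1 h2] := truncn_itv (divr_ge0 t0 (ltW d0)).
exists (Num.truncn (t / d)) => //; exists x, t; split => //.
rewrite -ler_pdivlMr// h1 /=.
by move: h2; rewrite ltr_pdivrMr// -natr1 mulrDl mul1r addrC.
Qed.

Lemma small_box_measurable U s t : cylinder U -> 0 <= s -> t <= d ->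
  measurable (bx U s t : set (borel w0)).
Proof.
move=> cU s0 td; have [ts|ts] := leP t s; first by rewrite box_empty.
apply: box_measurable lmin0 l_bounds _ _ _ _ _ _; first exact: l_cont.
  exact: cylinder_open.
rewrite -/d; apply/andP; split; have := d0; lra.
Qed.

(** Nothing but measurability is asked off the layer of height d, so these sets
form a pi-system that generates all Borel sets, and on which measures
restricted to the layer can be compared. *)
Definition base_sets : set (set (borel w0)) := [set A : set W | measurable (A : set (borel w0)) /\
  exists U s t, [/\ cylinder U, 0 <= s, t <= d & A `&` bx setT 0 d = bx U s t]].

Lemma box_base U s t : cylinder U -> 0 <= s -> t <= d -> base_sets (bx U s t).
Proof.
move=> cU s0 td; split; first exact: small_box_measurable.
exists U, s, t; split => //.
rewrite (boxI lmin0 l_bounds)//; [|by rewrite (le_trans td)// ltW|exact: ltW].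
by rewrite setIT (max_idPl s0) (min_idPl td).
Qed.

Lemma base_setsI : setI_closed base_sets.
Proof.
move=> A B [mA [U [s [t [cU s0 td eA]]]]] [mB [V [s' [t' [cV s0' td' eB]]]]].
split; first exact: measurableI.
exists (U `&` V), (Num.max s s'), (Num.min t t'); split.
- exact: cylinderI.
- by rewrite le_max s0.
- by rewrite ge_min td.
- have -> : A `&` B `&` bx setT 0 d =
      (A `&` bx setT 0 d) `&` (B `&` bx setT 0 d).
    by rewrite setIACA setIid.
  by rewrite eA eB (boxI lmin0 l_bounds)// ltW// (le_lt_trans _ dl).
Qed.

(** Outside the layer every Borel set is allowed, and inside an open set is a
countable union of boxes over rational rectangles. *)
Lemma base_sets_generate : @measurable _ (borel w0) = <<s base_sets >>.
Proof.
apply/seteqP; split; apply: smallest_sub.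
- exact: smallest_sigma_algebra.
- move=> O oO; pose T' := g_sigma_algebraType (base_sets : set (set (pointed_at w0))).
  suff : @measurable _ T' O by [].
  have mE : measurable (bx setT 0 d : set (borel w0)).
    by apply: small_box_measurable => //; exact: cylinderT.
  have -> : O = (O `\` bx setT 0 d) `|` (O `&` bx setT 0 d).
    by rewrite setUC setUIDK.
  apply: measurableU.
    apply: sub_sigma_algebra; split.
      by apply: measurableD => //; exact: sub_sigma_algebra.
    exists set0, 0, 0; split => //; [exact: cylinder0|exact: ltW|].
    by rewrite [bx set0 0 0]box_empty// setDE -setIA setICl setI0.
  pose O' : set (X * R) := (fun p => proj p) @^-1` O.
  have -> : O `&` bx setT 0 d = \bigcup_n \bigcup_p \bigcup_q
      bx (rect_core O' n p q) (Num.max 0 (ratr p)) (Num.min d (ratr q)).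
    apply/seteqP; split=> w.
      move=> [Ow [x [t [_ /andP[t0 td] e]]]].
      have [n [p [q [hx /andP[pt tq]]]]] : exists n p q, rect_core O' n p q x /\ ratr p <= t < ratr q.
        by apply: rect_coreP; [exact/tiling_openP|rewrite /O' /= -e].
      exists n => //; exists p => //; exists q => //; exists x, t; split => //.
      by rewrite ge_max lt_min t0 pt td tq.
    move=> [n _ [p _ [q _ [x [t [hx]]]]]].
    rewrite ge_max lt_min => /andP[/andP[t0 pt] /andP[td tq]] ->; split.
      by apply: (hx x t) => //; rewrite pt tq.
    by exists x, t; rewrite t0 td.
  apply: bigcupT_measurable => n; apply: bigcupT_measurable_rat => p.
  apply: bigcupT_measurable_rat => q; apply: sub_sigma_algebra; apply: box_base.
  - exact: rect_core_cylinder.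
  - by rewrite le_max lexx.
  - by rewrite ge_min lexx.
- exact: sigma_algebra_measurable.
- by move=> A [].
Qed.

Variables mu nu : probability (borel w0) R.
Hypothesis mu_inv : invariant_measure (@tiling_flow a N R l) mu.
Hypothesis nu_inv : invariant_measure (@tiling_flow a N R l) nu.

(** Two invariant measures agree on boxes, hence after restriction to the
layer they agree on a generating pi-system. *)
Lemma flow_measure_base (B : set (borel w0)) : measurable B ->
  mu (bx setT 0 d `&` B) = nu (bx setT 0 d `&` B).
Proof.
move=> mB; have mE : measurable (bx setT 0 d : set (borel w0)).
  by apply: small_box_measurable => //; exact: cylinderT.
rewrite setIC.
apply: (@measure_unique _ R (borel w0) base_sets (fun=> setT) base_sets_generate
  base_setsI _ _ (mrestr mu mE) (mrestr nu mE)) => //.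
- move=> _; split => //; exists setT, 0, d; split => //; first exact: cylinderT.
  by rewrite setTI.
- by apply/seteqP; split => // x _; exists 0%N.
- move=> A [mA [U [s [t [cU s0 td e]]]]].
  suff : mu (A `&` bx setT 0 d) = nu (A `&` bx setT 0 d) by [].
  rewrite e.
  apply: (invariant_measures_box l_cont lmin0 l_bounds a_le_N a0_neq0 a_gaps l_tile mu_inv nu_inv) => //.
  by rewrite (le_trans td)// -/d lerDr.
- move=> _; apply: (@le_lt_trans _ _ 1%E); last exact: ltry.
  by apply: (@probability_le1 _ _ _ mu); exact: measurableI.
Qed.

(** Translates of the layer cover the tiling space, and invariance carries the
equality on one layer to all of them. *)
Lemma flow_measure_unique (A : set (borel w0)) : measurable A -> mu A = nu A.
Proof.
move=> mA.
have mE (j : nat) : measurable (bx setT (j%:R * d) (d + j%:R * d) : set (borel w0)).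
  apply: box_measurable lmin0 l_bounds _ _ _ _ _ _; [exact: l_cont|exact: openT|].
  by rewrite -/d; apply/andP; split; have := d0; lra.
apply: (@g_sigma_algebra_measure_unique_cover _ R (borel w0) (@measurable _ (borel w0))
  _ (fun j => bx setT (j%:R * d) (d + j%:R * d)) mE box_cover mu nu) => //; last first.
  exact: sub_sigma_algebra.
move=> n B sB; have mB : measurable B.
  apply: (@smallest_sub _ (sigma_algebra setT) (@measurable _ (borel w0))) sB => //.
  exact: sigma_algebra_measurable.
set s := n%:R * d.
have -> : bx setT s (d + s) `&` B =
    tiling_flow (- s) @^-1` (bx setT 0 d `&` tiling_flow s @^-1` B).
  rewrite preimage_setI box_flow opprK add0r; congr (_ `&` _).
  apply/seteqP; split => w /=; by rewrite flow_add addNr flow0.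
have mB' : measurable (tiling_flow s @^-1` B : set (borel w0)).
  exact: flow_borel.
have mE0 : measurable (bx setT 0 d : set (borel w0)).
  by apply: small_box_measurable => //; exact: cylinderT.
transitivity (mu (bx setT 0 d `&` tiling_flow s @^-1` B)).
  by apply: mu_inv; exact: measurableI.
rewrite flow_measure_base//; apply/esym; apply: nu_inv; exact: measurableI.
Qed.

End FlowUnique.

(** * Existence of an invariant measure of the flow *)

(** The image of Lebesgue measure under a translation has the same values on
intervals. *)
Lemma lebesgue_measure_translate (R : realType) (s : R) (A : set (measurableTypeR R)) :
  measurable A -> lebesgue_measure ((fun t : R => t + s) @^-1` A) = lebesgue_measure A.
Proof.
move=> mA; have mt : measurable_fun setT
    ((fun t => t + s) : measurableTypeR R -> measurableTypeR R).
  by apply: measurable_funD => //; exact: measurable_cst.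
have [m mE] := push_measure (@lebesgue_measure R) mt.
rewrite -mE; apply/esym/lebesgue_measure_unique => // _ [[u v]] _ <-.
rewrite mE; have -> : (fun t : R => t + s) @^-1` `]u, v]%classic = `]u - s, v - s]%classic.
  by apply/seteqP; split => t /=; rewrite !in_itv /= ltrBlDr lerBrDr.
apply: (etrans (lebesgue_measure_itv _)); apply: esym.
apply: (etrans (lebesgue_measure_itv _)); rewrite /= !lte_fin ltrD2r.
by case: ifP => // _; rewrite -!EFinD; congr (_%:E); ring.
Qed.

Lemma continuous_measurable_real (R : realType) (T : topologicalType) (x0 : T) (f : T -> R) :
  continuous f -> measurable_fun setT (f : borel x0 -> measurableTypeR R).
Proof.
move=> cf; apply: (@measurability _ _ (borel x0) (measurableTypeR R) setT f (@RGenOpens.G R)).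
  exact: RGenOpens.measurableE.
move=> _ [_ [u [v ->]] <-]; rewrite setTI; apply: sub_sigma_algebra.
by move/continuousP : cf; apply; exact: itv_open.
Qed.

Section FlowExists.
Variables (R : realType) (a : nat -> nat) (N : nat).
Local Notation L := (letter a N).
Local Notation X := (subshift a N).
Variables (l : L -> R) (lmin lmax : R).
Hypothesis l_cont : continuous l.
Hypothesis lmin0 : 0 < lmin.
Hypothesis l_bounds : forall c, lmin <= l c <= lmax.
Local Notation W := (tiling_space l).
Local Notation proj p := (\pi_(tiling_space l) p).
Variables (x0 : X) (mu : probability (borel x0) R).
Hypothesis mu_inv : invariant_measure (@subshift_act a N) mu.
Local Notation leb := (@lebesgue_measure R).
Local Notation XR := (borel x0 * measurableTypeR R)%type.

Definition space_measure : {measure set XR -> \bar R} := (mu \x leb)%E.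

Lemma open_product_measurable (O : set (X * R)) : open O -> measurable (O : set XR).
Proof.
move=> oO; have -> : O = \bigcup_n \bigcup_p \bigcup_q
    (rect_core O n p q `*` `[ratr p, ratr q[%classic).
  apply/seteqP; split => [[x t] Oxt|[x t] [n _ [p _ [q _ [/= hx]]]]].
    have [n [p [q [hx ht]]]] := rect_coreP oO Oxt.
    by exists n => //; exists p => //; exists q.
  by rewrite in_itv /=; exact: hx.
apply: bigcupT_measurable => n; apply: bigcupT_measurable_rat => p.
apply: bigcupT_measurable_rat => q; apply: measurableX.
  apply: sub_sigma_algebra; apply: cylinder_open; exact: rect_core_cylinder.
exact: measurable_itv.
Qed.

Lemma proj_measurable (w0 : W) :
  measurable_fun setT ((fun p => proj p) : XR -> borel w0).
Proof.
apply: (@measurability _ _ XR (borel w0) setT _ (@open (pointed_at w0))) => //.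
move=> _ [B oB <-]; rewrite setTI; apply: open_product_measurable.
exact/tiling_openP.
Qed.

Lemma act_measurable k : measurable_fun setT (@subshift_act a N k : borel x0 -> borel x0).
Proof.
move=> _ B mB; rewrite setTI; apply: borel_preimage => //.
exact: subshift_act_continuous.
Qed.

Lemma slide_measurable : measurable_fun setT (slide l : XR -> XR).
Proof.
apply: measurable_fun_pair.
  apply: (measurableT_comp (act_measurable 1)); exact: measurable_fst.
apply: measurable_funB; first exact: measurable_snd.
have mr := continuous_measurable_real (x0 := x0) (roof_continuous l_cont).
have mf : measurable_fun setT (fst : XR -> borel x0) by exact: measurable_fst.
exact: (measurableT_comp mr mf).
Qed.

Lemma space_measure_translate (s : R) (Z : set XR) : measurable Z ->
  space_measure (@susp_translate a N R s @^-1` Z) = space_measure Z.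
Proof.
move=> mZ; rewrite /space_measure /= /product_measure1; apply: eq_integral => x _ /=.
rewrite -(@lebesgue_measure_translate R s (xsection Z x)); last exact: measurable_xsection.
by congr lebesgue_measure; apply/seteqP; split => t; rewrite /xsection /= !inE.
Qed.

(** By Fubini: in each fibre [slide] is a translation, and it permutes the fibres
by the shift, which preserves mu. *)
Lemma space_measure_slide (Z : set XR) : measurable Z ->
  space_measure (slide l @^-1` Z) = space_measure Z.
Proof.
move=> mZ; rewrite /space_measure /= /product_measure1.
transitivity (\int[mu]_x ((leb \o xsection Z) (subshift_act 1 x : borel x0)))%E.
  apply: eq_integral => x _ /=.
  rewrite -(@lebesgue_measure_translate R (- roof l x) (xsection Z _));
    last exact: measurable_xsection.
  by congr lebesgue_measure; apply/seteqP; split => t; rewrite /xsection /= !inE.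
have mx : measurable_fun setT (leb \o xsection Z) by exact: measurable_fun_xsection.
have := ge0_integral_pushforward (act_measurable 1) mu measurableT mx.
rewrite preimage_setT => <-; last by move=> x _; exact: measure_ge0.
apply: eq_measure_integral; first exact: act_measurable.
by move=> mact A mA _; exact: (mu_inv 1 mA).
Qed.

Definition strip (f g : X -> R) : set XR := [set p | f p.1 <= p.2 < g p.1].

Lemma strip_measurable (f g : X -> R) : continuous f -> continuous g ->
  measurable (strip f g).
Proof.
have lt_meas (h : X -> R) : continuous h -> measurable ([set p | p.2 < h p.1] : set XR).
  move=> ch; apply: open_product_measurable.
  have -> : [set p : X * R | p.2 < h p.1] = (fun p => h p.1 - p.2) @^-1` [set r | 0 < r].
    by apply/seteqP; split => p /=; rewrite subr_gt0.
  apply: open_comp => [p _|]; last exact: open_gt.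
  apply: cvgB; last exact: cvg_snd.
  by apply: (@continuous_comp _ _ _ fst h); [exact: cvg_fst|exact: ch].
move=> cf cg; have -> : strip f g = ~` [set p | p.2 < f p.1] `&` [set p | p.2 < g p.1].
  apply/seteqP; split => p /=; first by move=> /andP[h1 h2]; split => //; apply/negP; rewrite -leNgt.
  by move=> [/negP h1 h2]; rewrite /strip /= h2 andbT leNgt.
by apply: measurableI; [apply: measurableC|]; exact: lt_meas.
Qed.

(** A fundamental domain for [slide]. *)
Definition tile_strip := strip (fun=> 0) (roof l).

Lemma tile_strip_measurable : measurable tile_strip.
Proof. by apply: strip_measurable; [exact: cst_continuous|exact: roof_continuous]. Qed.

Lemma space_measure_strip (s t : R) : s <= t ->
  space_measure (strip (fun=> s) (fun=> t)) = (t - s)%:E.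
Proof.
move=> st; have -> : strip (fun=> s) (fun=> t) = setT `*` `[s, t[%classic.
  by apply/seteqP; split => p /=; rewrite /strip /= in_itv /=; [move=> h; split|case].
rewrite /space_measure /= product_measure1E//.
transitivity (1 * leb `[s, t[%classic)%E.
  by congr (_ * _)%E; exact: (@probability_setT _ _ _ mu).
rewrite mul1e; apply: (etrans (lebesgue_measure_itv _)); rewrite /= lte_fin.
case: (ltP s t) => h; first by rewrite EFinB.
have -> : s = t by apply/le_anti; rewrite st h.
by rewrite subrr.
Qed.

Variable w0 : W.

(** Raising the fundamental domain by s removes the strip S of heights below s
and adds a strip above the roof, which is the preimage of S under [slide].
Both have the same mass inside a saturated set, because [slide] preserves the
measure. The mass of S is finite, so it can be cancelled. *)
Lemma strip_shift (A : set (borel w0)) (s : R) : measurable A -> 0 <= s ->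
  space_measure ((fun p => proj (p.1, p.2 + s)) @^-1` A `&` tile_strip) =
  space_measure ((fun p => proj p) @^-1` A `&` tile_strip).
Proof.
move=> mA s0; set A' : set XR := (fun p => proj p) @^-1` A.
have mA' : measurable A' by rewrite -[A']setTI; exact: (@proj_measurable w0 measurableT A mA).
pose S := strip (fun=> 0) (fun=> s).
pose D := strip (fun=> s) (fun x => roof l x + s).
have cr : continuous (roof l : X -> R) by exact: roof_continuous.
have croof : continuous (fun x : X => roof l x + s : R).
  move=> x; apply: (@continuous_comp _ _ _ (roof l) (fun r => r + s)); first exact: cr.
  by apply: cvgD; [exact: cvg_id|exact: cvg_cst].
have mS : measurable S by apply: strip_measurable; exact: cst_continuous.
have mD : measurable D by apply: strip_measurable => //; exact: cst_continuous.
have mT := tile_strip_measurable.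
have mpre : measurable (slide l @^-1` S : set XR).
  by rewrite -[_ @^-1` _]setTI; exact: (slide_measurable measurableT mS).
have -> : (fun p => proj (p.1, p.2 + s)) @^-1` A `&` tile_strip =
    @susp_translate a N R s @^-1` (A' `&` D).
  rewrite preimage_setI; congr (_ `&` _); apply/seteqP; split => p;
    by rewrite /D /tile_strip /strip /= lerDr ltrD2r.
rewrite space_measure_translate; last exact: measurableI.
have inv : A' `&` slide l @^-1` S = slide l @^-1` (A' `&` S).
  rewrite preimage_setI; congr (_ `&` _); apply/seteqP; split => p;
    by rewrite /A' /= proj_slide.
(* The union of the domain with the preimage of S is the union of S with the
   raised domain, and both unions are disjoint. *)
have e1 : (space_measure (A' `&` tile_strip) + space_measure (A' `&` S) =
    space_measure (A' `&` S) + space_measure (A' `&` D))%E.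
  rewrite -{1}(space_measure_slide (Z := A' `&` S)); last exact: measurableI.
  rewrite -inv -measureU; try exact: measurableI; last first.
    apply/seteqP; split => // p [[_ /andP[h1 h2]] [_ /andP[h3 h4]]].
    by move: h3; rewrite /slide /= subr_ge0 leNgt h2.
  rewrite -measureU; try exact: measurableI; last first.
    apply/seteqP; split => // p [[_ /andP[h1 h2]] [_ /andP[h3 h4]]].
    by move: h3; rewrite leNgt h2.
  rewrite -!setIUr; congr (space_measure (_ `&` _)).
  apply/seteqP; split => p; rewrite /tile_strip /S /D /strip /slide /=.
    move=> [/andP[h1 h2]|/andP]; last rewrite subr_ge0 ltrBlDl => -[h1 h2].
      have [h|h] := ltP p.2 s; first by left; rewrite h1.
      by right; rewrite (lt_le_trans h2)// lerDl.
    have [h|h] := ltP p.2 s; [left|by right; rewrite h2].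
    rewrite andbT (le_trans _ h1)//.
    by have /andP[h3 _] := roof_bounds l_bounds p.1; rewrite (le_trans (ltW lmin0)).
  move=> [|] /andP[h1 h2].
    have [h|h] := ltP p.2 (roof l p.1); first by left; rewrite h1.
    right; rewrite subr_ge0 h ltrBlDl (lt_le_trans h2)// lerDr.
    by have /andP[h3 _] := roof_bounds l_bounds p.1; rewrite (le_trans (ltW lmin0)).
  have [h|h] := ltP p.2 (roof l p.1); first by left; rewrite (le_trans s0 h1).
  by right; rewrite subr_ge0 h ltrBlDl.
have fS : space_measure (A' `&` S) \is a fin_num.
  rewrite ge0_fin_numE; last exact: measure_ge0.
  apply: (@le_lt_trans _ _ (space_measure S)).
    by apply: le_measure; rewrite ?inE//; exact: measurableI.
  by rewrite space_measure_strip// ltry.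
rewrite [RHS]addeC in e1.
by rewrite -[LHS](@addeK _ (space_measure (A' `&` S)) _ fS) -e1 addeK.
Qed.

(** Project the product measure on the fundamental domain and normalize it: its
mass lies between lmin and lmax. *)
Lemma flow_measure_exists : exists m : probability (borel w0) R,
  invariant_measure (@tiling_flow a N R l) m.
Proof.
have mT := tile_strip_measurable.
have [m mE] := push_measure (mrestr space_measure mT) (@proj_measurable w0).
have mE' A : m A = space_measure ((fun p => proj p) @^-1` A `&` tile_strip) by rewrite mE.
have inv_pos (s : R) (A : set (borel w0)) : measurable A -> 0 <= s ->
    m (tiling_flow s @^-1` A) = m A.
  move=> mA s0; rewrite !mE' -(strip_shift mA s0).
  have -> : (fun p => proj p) @^-1` (tiling_flow s @^-1` A) =
      (fun p => proj (p.1, p.2 + s)) @^-1` A.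
    by apply/funext => p; rewrite /preimage /mkset flow_proj.
  by [].
have inv (s : R) (A : set (borel w0)) : measurable A ->
    m (tiling_flow s @^-1` A) = m A.
  move=> mA; case: (leP 0 s) => [|s0]; first exact: inv_pos.
  have mfA : measurable (tiling_flow s @^-1` A : set (borel w0)).
    exact: flow_borel.
  rewrite -(inv_pos (- s) _ mfA); last by rewrite oppr_ge0 ltW.
  congr (m _); apply/seteqP; split => w /=; by rewrite flow_add addNr flow0.
exists (mnormalize m (dirac (w0 : borel w0))) => s A mA.
have fin : (m setT < +oo)%E.
  rewrite mE' preimage_setT setTI.
  apply: (@le_lt_trans _ _ (space_measure (strip (fun=> 0) (fun=> lmax)))).
    apply: le_measure; rewrite ?inE//.
      by apply: strip_measurable; exact: cst_continuous.
    move=> p /andP[h1 h2]; apply/andP; split => //; apply: (lt_le_trans h2).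
    by have /andP[] := roof_bounds l_bounds p.1.
  rewrite space_measure_strip ?ltry//.
  by have /andP[h h'] := l_bounds (fin_letter a N 0); rewrite (le_trans (ltW lmin0))// (le_trans h).
have pos : (0 < m setT)%E.
  rewrite mE' preimage_setT setTI.
  apply: (@lt_le_trans _ _ (space_measure (strip (fun=> 0) (fun=> lmin)))).
    by rewrite space_measure_strip ?ltW// subr0 lte_fin.
  apply: le_measure; rewrite ?inE//.
    by apply: strip_measurable; exact: cst_continuous.
  move=> p /andP[h1 h2]; apply/andP; split => //; apply: (lt_le_trans h2).
  by have /andP[] := roof_bounds l_bounds p.1.
by rewrite /= /mnormalize gt_eqF//= lt_eqF//= inv.
Qed.

End FlowExists.

(** * Minimality, unique ergodicity and tile lengths *)

Theorem theorem1p3 (R : realType) (a : nat -> nat) (N : nat)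
    (a_le_N : forall i, (a i <= N)%N) (a_eq_N : exists i, a i = N)
    (a0_neq0 : a 0%N <> 0%N)
    (a_gaps : exists C : nat, (0 < C)%N /\
       forall i k : nat,
         (forall j : nat, (j <= k)%N -> a (i + j)%N = 0%N) -> (k < C)%N) :
  [/\ minimal (@subshift_act a N) /\ uniquely_ergodic (@subshift_act a N) R,
      exists2 l : letter a N -> R, is_tile_length l &
        forall l' : letter a N -> R, is_tile_length l' ->
          exists2 k : R, 0 < k & forall c, l' c = k * l c &
      forall l : letter a N -> R, is_tile_length l ->
        minimal (@tiling_flow a N R l) /\
        uniquely_ergodic (@tiling_flow a N R l) R].
Proof.
have [x Xx] := subshift_nonempty a_le_N a0_neq0.
pose x0 : subshift a N := SigSub (mem_set Xx).
have [mu mu_inv mu_unique] := subshift_ergodic_at R a_le_N a0_neq0 a_gaps x0.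
have smin := subshift_minimal a_le_N a0_neq0 a_gaps.
split; first by split => //; exists x0, mu.
  have [l hl] := tile_length_exists R a_le_N a0_neq0 a_gaps.
  exists l => // l' hl'; exact: tile_length_unique hl'.
move=> l hl; have [cl l0 _] := hl.
have [lmin [lmax [lmin0 lb]]] := tile_length_bounds cl l0.
split; first exact: (flow_minimal lmin0 lb).
pose w0 : tiling_space l := \pi_(tiling_space l) (x0, 0).
have [m m_inv] := flow_measure_exists cl lmin0 lb mu_inv w0.
exists w0, m => // nu nu_inv A mA.
exact: (flow_measure_unique cl lmin0 lb a_le_N a0_neq0 a_gaps hl nu_inv m_inv).
Qed.
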